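(* Let $k\ge1$. Let $u$ be the smooth solution of $u_t=-(\partial_x^2+\partial_y^2)^2u$ on a rectangle $\Omega\subset\mathbb{R}^2$, $t>0$, with $u(x,y,0)=u_0(x,y)$ and periodic boundary conditions. Let $(u_h,q_h)(\cdot,t)\in Q_h\times Q_h$ be the solution of the semi-discrete DG scheme $$(u_{ht},\phi)=-A(q_h,\phi),\qquad (q_h,\psi)=A(u_h,\psi)\qquad\text{for all }\phi,\psi\in Q_h,$$ where $u_h(\cdot,0)$ is the $L^2$ projection of $u_0$ onto $Q_h$. Then $$\|u(\cdot,t)-u_h(\cdot,t)\|\le Ch^{k+1}\qquad\text{for }0\le t\le T,$$ where $C$ depends on $\sup_{t\in[0,T]}\|u_t(\cdot,t)\|_{k+1}$ and linearly on $T$, but is independent of $h$.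
   Context: $\Omega$ is a rectangle partitioned into rectangular cells $I_{i,j}=[x_{i-1/2},x_{i+1/2}]\times[y_{j-1/2},y_{j+1/2}]$, $1\le i\le N$, $1\le j\le M$, uniform with sizes $\Delta x=x_{i+1/2}-x_{i-1/2}$, $\Delta y=y_{j+1/2}-y_{j-1/2}$; $h=\max\{\Delta x,\Delta y\}$ is the mesh size. $Q_h=\{v\in L^2(\Omega): v|_{I_{i,j}}\in Q^k(I_{i,j})\}$, where $Q^k$ denotes tensor-product polynomials of degree at most $k$ in each variable. On a vertical interface $x=x_{i+1/2}$: $\{v\}=\frac12(v(x_{i+1/2}^-,y)+v(x_{i+1/2}^+,y))$, $[v]=v(x_{i+1/2}^+,y)-v(x_{i+1/2}^-,y)$, and analogously on horizontal interfaces $y=y_{j+1/2}$; traces from outside $\Omega$ on the boundary are taken by periodicity. $(\cdot,\cdot)$ and $\|\cdot\|$ are the $L^2(\Omega)$ inner product and norm; $\|\cdot\|_m$ is the $H^m(\Omega)$ norm. The bilinear form is $$A(w,v)=\sum_{i,j=1}^{N,M}\iint_{I_{i,j}}\nabla w\cdot\nabla v\,dxdy+\sum_{i,j=1}^{N,M}\int_{y_{j-1/2}}^{y_{j+1/2}}\big(\{w_x\}[v]+\{v_x\}[w]\big)_{x_{i+1/2}}dy+\sum_{i,j=1}^{N,M}\int_{x_{i-1/2}}^{x_{i+1/2}}\big(\{w_y\}[v]+\{v_y\}[w]\big)_{y_{j+1/2}}dx .$$ *)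

(* Defs.v *)
From HB Require Import structures.
From mathcomp Require Import all_boot all_order all_algebra.
From mathcomp Require Import all_classical all_reals all_analysis.

Set Implicit Arguments.
Unset Strict Implicit.
Unset Printing Implicit Defensive.

Import Order.TTheory GRing.Theory Num.Theory.
Import numFieldNormedType.Exports.

Local Open Scope classical_set_scope.
Local Open Scope ring_scope.

Section SpaceTime.
Variable R : realType.

Definition dx (v : R -> R -> R) : R -> R -> R :=
  fun x y => derive1 (v ^~ y) x.

Definition dy (v : R -> R -> R) : R -> R -> R :=
  fun x y => derive1 (v x) y.

Definition lap (v : R -> R -> R) : R -> R -> R :=
  fun x y => dx (dx v) x y + dy (dy v) x y.

(* Functions of time are written [u t x y] and only matter for [0 <= t]; the
   time derivative is taken relative to [0, +oo[, hence is one-sided at 0. *)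
Definition tquot (g : R -> R) (t : R) : set_system R :=
  (fun s => (s - t)^-1 * (g s - g t)) @ within [set s | 0 <= s] t^'.

Definition tderivable (g : R -> R) (t : R) : Prop := cvg (tquot g t).

Definition tderive (g : R -> R) (t : R) : R := lim (tquot g t).

Definition dt (u : R -> R -> R -> R) : R -> R -> R -> R :=
  fun t x y => tderive (fun s => u s x y) t.

Inductive direction := Time | SpaceX | SpaceY.

Definition pderive (e : direction) (u : R -> R -> R -> R) : R -> R -> R -> R :=
  match e with
  | Time => dt u
  | SpaceX => fun t => dx (u t)
  | SpaceY => fun t => dy (u t)
  end.

(* C^oo on [0, +oo[ x R^2: every iterated partial derivative, in any order,
   exists and is jointly continuous. *)
Definition smooth (u : R -> R -> R -> R) : Prop :=
  forall w : seq direction, let f := foldr pderive u w in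
    (forall t x y, 0 <= t ->
       [/\ tderivable (fun s => f s x y) t,
           derivable (f t ^~ y) x 1 &
           derivable (f t x) y 1]) /\
    {within [set z : R * R * R | 0 <= z.1.1],
       continuous (fun z : R * R * R => f z.1.1 z.1.2 z.2)}.

Definition iint (D : set (R * R)) (f : R -> R -> R) : R :=
  \int[(@lebesgue_measure R \x @lebesgue_measure R)%E]_(z in D) f z.1 z.2.

Section Rectangle.
Variables a b c d : R.

(* Periodicity of the solution on [a, b] x [c, d] is expressed on its
   periodic extension to R^2. *)
Definition periodic (u : R -> R -> R -> R) : Prop :=
  forall t x y, 0 <= t ->
    u t (x + (b - a)) y = u t x y /\ u t x (y + (d - c)) = u t x y.

Definition smooth_solution (u0 : R -> R -> R) (u : R -> R -> R -> R) : Prop :=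
  [/\ smooth u,
      periodic u,
      forall t x y, 0 < t -> dt u t x y = - lap (lap (u t)) x y &
      forall x y, u 0 x y = u0 x y].

(* The H^m norm on the rectangle, for smooth functions (classical derivatives
   are then the weak ones). *)
Definition Hnorm (m : nat) (v : R -> R -> R) : R :=
  Num.sqrt (\sum_(i < m.+1) \sum_(j < m.+1 | (i + j <= m)%N)
    iint (`[a, b] `*` `[c, d]) (fun x y => iter i dx (iter j dy v) x y ^+ 2)).

Section Mesh.
Variables N M : nat.

Definition step (l r : R) (n : nat) : R := (r - l) / n%:R.
Definition node (l r : R) (n i : nat) : R := l + i%:R * step l r n.

Definition mesh_size : R := Num.max (step a b N) (step c d M).

(* Cells are numbered from 0: the nodes [xn i] and [xn i.+1] bound column i. *)
Definition xn (i : nat) : R := node a b N i.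
Definition yn (j : nat) : R := node c d M j.
Definition xcell (i : 'I_N) : set R := `[xn i, xn i.+1].
Definition ycell (j : 'I_M) : set R := `[yn j, yn j.+1].

(* A piecewise function is given by its restrictions to the closed cells;
   [v i j] is only ever used on cell (i, j) and, with its derivatives, on the
   edges of that cell, where it gives the traces from inside. *)
Definition piecewise := 'I_N -> 'I_M -> R -> R -> R.

Definition in_Qh (k : nat) (v : piecewise) : Prop :=
  forall i j, exists C : 'M[R]_k.+1, forall x y,
    v i j x y = \sum_p \sum_q C p q * x ^+ p * y ^+ q.

Definition inner (w v : piecewise) : R :=
  \sum_i \sum_j iint (xcell i `*` ycell j) (fun x y => w i j x y * v i j x y).

Definition L2norm (v : piecewise) : R := Num.sqrt (inner v v).

Definition pdx (v : piecewise) : piecewise := fun i j => dx (v i j).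
Definition pdy (v : piecewise) : piecewise := fun i j => dy (v i j).

(* Traces on the right edge of column i, resp. the top edge of row j.  [ordS]
   is the cyclic successor, so that for the last column (row) the outer trace
   is taken on the first one, by periodicity. *)
Definition xminus (v : piecewise) i j (y : R) : R := v i j (xn i.+1) y.
Definition xplus (v : piecewise) i j (y : R) : R :=
  v (ordS i) j (xn (ordS i)) y.
Definition yminus (v : piecewise) i j (x : R) : R := v i j x (yn j.+1).
Definition yplus (v : piecewise) i j (x : R) : R :=
  v i (ordS j) x (yn (ordS j)).

Definition xavg v i j y : R := (xminus v i j y + xplus v i j y) / 2.
Definition xjump v i j y : R := xplus v i j y - xminus v i j y.
Definition yavg v i j x : R := (yminus v i j x + yplus v i j x) / 2.
Definition yjump v i j x : R := yplus v i j x - yminus v i j x.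

Definition Aform (w v : piecewise) : R :=
  \sum_i \sum_j iint (xcell i `*` ycell j)
    (fun x y => pdx w i j x y * pdx v i j x y + pdy w i j x y * pdy v i j x y)
  + \sum_i \sum_j \int[@lebesgue_measure R]_(y in ycell j)
    (xavg (pdx w) i j y * xjump v i j y + xavg (pdx v) i j y * xjump w i j y)
  + \sum_i \sum_j \int[@lebesgue_measure R]_(x in xcell i)
    (yavg (pdy w) i j x * yjump v i j x + yavg (pdy v) i j x * yjump w i j x).

Definition is_L2proj (k : nat) (u0 : R -> R -> R) (v : piecewise) : Prop :=
  in_Qh k v /\
  forall phi, in_Qh k phi -> inner v phi = inner (fun _ _ => u0) phi.

Definition ptderive (uh : R -> piecewise) (t : R) : piecewise :=
  fun i j x y => tderive (fun s => uh s i j x y) t.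

Definition dg_solution (k : nat) (u0 : R -> R -> R) (uh qh : R -> piecewise)
    : Prop :=
  [/\ forall t, 0 <= t -> in_Qh k (uh t) /\ in_Qh k (qh t),
      forall t i j x y, 0 <= t -> tderivable (fun s => uh s i j x y) t,
      forall t phi, 0 <= t -> in_Qh k phi ->
        inner (ptderive uh t) phi = - Aform (qh t) phi,
      forall t psi, 0 <= t -> in_Qh k psi ->
        inner (qh t) psi = Aform (uh t) psi &
      is_L2proj k u0 (uh 0)].

End Mesh.
End Rectangle.
End SpaceTime.

(* Main.v *)
(* The form A is not coercive enough to be treated by a Ritz projection, so the
   exact solution is compared with a local interpolant P instead. On one
   reference cell there is an interpolation of point values into polynomials of
   degree k whose error, on polynomials of degree k + 2, is orthogonal to degree
   k - 2 and antiperiodic together with its derivative, so that the averages {.}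
   of value and derivative across an interface of the uniform mesh are
   reproduced. Tensorising, the residual A(Pw, v) + (Lap w, v) vanishes for w of
   degree k + 2; Taylor expansion on pairs of cells and inverse inequalities give
   residual <= C h^(k+1) |w|_(k+3) ||v||, with no negative power of h lost.

   Put q = - Lap u, xi = Pu - u_h and zeta = q_h - Pq. As A is symmetric, the
   cross terms A(zeta, xi) cancel and
     (xi_t, xi) + ||zeta||^2 = [A(Pq, xi) + (Lap q, xi)] + [A(Pu, zeta) + (Lap u, zeta)]
                               + (Pu_t - u_t, xi) + (q - Pq, zeta).
   Every term on the right is O(h^(k+1)) times ||xi|| or ||zeta||, whence
   sqrt(||xi||^2 + delta^2) grows at most linearly in time, delta = O(h^(k+1)).
   Periodic elliptic regularity bounds all the derivatives of u and q which occur
   by the H^(k+1) norm of Lap q = u_t. *)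

Require Import Defs.
From HB Require Import structures.
From mathcomp Require Import all_boot all_order all_algebra.
From mathcomp Require Import all_classical all_reals all_analysis.
From mathcomp Require Import measurable_realfun.
From mathcomp Require Import ring lra zify.

Set Implicit Arguments.
Unset Strict Implicit.
Unset Printing Implicit Defensive.

Import Order.TTheory GRing.Theory Num.Theory.
Import numFieldNormedType.Exports.

Local Open Scope classical_set_scope.
Local Open Scope ring_scope.

(** * Calculus in one and two variables *)

(** [A] is of second order, so testing it with a discrete function costs two powers of the mesh
    size. To keep h^(k+1), an interpolation with values in degree k must look exact inside the form
    up to degree k + 2. Matching interface averages by a global projection would couple all cells;
    here the match is demanded only of polynomials, seen from two neighbouring cells. The error phi
    of X^(k+1) is then antiperiodic on the unit cell. Shifting X^(k+2) by one cell creates (k+2)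
    X^(k+1), so the error psi of X^(k+2) must satisfy psi(1) + psi(0) + (k+2) phi(0) = 0, and
    likewise for the derivatives. The moments of degree at most k - 2 and the two end conditions are
    k + 1 equations for k + 1 coefficients, uniquely solvable for every k >= 1. Point values are
    interpolated, rather than moments, so that the operator commutes with derivatives in time and in
    the other variable. In the energy estimate a free Young weight is left on ||xi||^2 and chosen
    afterwards as delta / sqrt(||xi||^2 + delta^2). This replaces the exponential of a Gronwall
    argument by linear growth in time. *)

Section ContinuousOperations.
Variables (T : topologicalType) (R : realType).
Implicit Types f g : T -> R.

Lemma ctD f g : continuous f -> continuous g -> continuous (fun x => f x + g x).
Proof. by move=> cf cg x; exact: (continuousD (cf x) (cg x)). Qed.

Lemma ctN f : continuous f -> continuous (fun x => - f x).
Proof. by move=> cf x; exact: (continuousN (cf x)). Qed.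

Lemma ctB f g : continuous f -> continuous g -> continuous (fun x => f x - g x).
Proof. by move=> cf cg; apply: ctD => //; exact: ctN. Qed.

Lemma ctM f g : continuous f -> continuous g -> continuous (fun x => f x * g x).
Proof. by move=> cf cg x; exact: (continuousM (cf x) (cg x)). Qed.

Lemma ct_cst (k : R) : continuous (fun _ : T => k).
Proof. by move=> x; exact: cvg_cst. Qed.

Lemma ctZ k f : continuous f -> continuous (fun x => k * f x).
Proof. by move=> cf; apply: ctM => //; exact: ct_cst. Qed.

Lemma ctX n f : continuous f -> continuous (fun x => f x ^+ n).
Proof.
move=> cf; elim: n => [|n ih].
  by under eq_fun do rewrite expr0; exact: ct_cst.
by under eq_fun do rewrite exprS; exact: ctM.
Qed.

Lemma ct_sum (I : Type) (r : seq I) (P : pred I) (h : I -> T -> R) :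
  (forall i, continuous (h i)) ->
  continuous (fun x => \sum_(i <- r | P i) h i x).
Proof.
move=> ch; elim: r => [|i r ih].
  by under eq_fun do rewrite big_nil; exact: ct_cst.
under eq_fun do rewrite big_cons.
by case: (P i) => //; exact: ctD.
Qed.

End ContinuousOperations.

Section PointwiseDerivatives.
Variable R : realType.
Implicit Types (f g : R -> R) (x a b : R).

Lemma dvD f g x a b : is_derive x 1 f a -> is_derive x 1 g b ->
  is_derive x 1 (fun t => f t + g t) (a + b).
Proof. by move=> df dg; exact: is_deriveD. Qed.

Lemma dvB f g x a b : is_derive x 1 f a -> is_derive x 1 g b ->
  is_derive x 1 (fun t => f t - g t) (a - b).
Proof. by move=> df dg; exact: is_deriveB. Qed.

Lemma dvM f g x a b : is_derive x 1 f a -> is_derive x 1 g b ->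
  is_derive x 1 (fun t => f t * g t) (a * g x + f x * b).
Proof.
move=> df dg; have h := is_deriveM df dg.
by apply: (is_derive_eq h); rewrite /GRing.scale/= addrC mulrC.
Qed.

Lemma dv_cst (k : R) x : is_derive x 1 (fun=> k) 0.
Proof. exact: is_derive_cst. Qed.

Lemma dvZ k f x a : is_derive x 1 f a -> is_derive x 1 (fun t => k * f t) (k * a).
Proof.
by move=> df; apply: (is_derive_eq (dvM (dv_cst k x) df)); rewrite mul0r add0r.
Qed.

Lemma dv_sum (I : Type) (r : seq I) (P : pred I) (h : I -> R -> R) (d : I -> R) x :
  (forall i, is_derive x 1 (h i) (d i)) ->
  is_derive x 1 (fun t => \sum_(i <- r | P i) h i t) (\sum_(i <- r | P i) d i).
Proof.
move=> dh; elim: r => [|i r ih].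
  by under eq_fun do rewrite big_nil; rewrite big_nil; exact: dv_cst.
under eq_fun do rewrite big_cons.
by rewrite big_cons; case: (P i) => //; exact: dvD.
Qed.

End PointwiseDerivatives.

(* Locked: unification must never unfold the Lebesgue integral. *)
HB.lock Definition J (R : realType) (a b : R) (f : R -> R) : R :=
  \int[@lebesgue_measure R]_(x in `[a, b]) f x.

Section OneDimensionalIntegral.
Variable R : realType.
Implicit Types (f g F G : R -> R) (a b x : R).

Lemma continuous_integrable a b f : continuous f ->
  (@lebesgue_measure R).-integrable `[a, b] (EFin \o f).
Proof.
move=> cf; apply: continuous_compact_integrable; first exact: segment_compact.
exact: continuous_subspaceT.
Qed.

Lemma eq_J a b f g : (forall x, a <= x <= b -> f x = g x) -> J a b f = J a b g.
Proof.
move=> fg; rewrite J.unlock; apply: eq_Rintegral => x; rewrite inE/= in_itv/= => xab; exact: fg.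
Qed.

Lemma J_ge0 a b f : (forall x, a <= x <= b -> 0 <= f x) -> 0 <= J a b f.
Proof. by move=> f0; rewrite J.unlock; apply: Rintegral_ge0 => x /=; rewrite in_itv/=; exact: f0. Qed.

Lemma JD a b f g : continuous f -> continuous g ->
  J a b (fun x => f x + g x) = J a b f + J a b g.
Proof. by move=> cf cg; rewrite J.unlock; apply: RintegralD => //; exact: continuous_integrable. Qed.

Lemma JB a b f g : continuous f -> continuous g ->
  J a b (fun x => f x - g x) = J a b f - J a b g.
Proof. by move=> cf cg; rewrite J.unlock; apply: RintegralB => //; exact: continuous_integrable. Qed.

Lemma JZ a b k f : continuous f -> J a b (fun x => k * f x) = k * J a b f.
Proof. by move=> cf; rewrite J.unlock; apply: RintegralZl => //; exact: continuous_integrable. Qed.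

Lemma JN a b f : continuous f -> J a b (fun x => - f x) = - J a b f.
Proof.
move=> cf; rewrite -mulN1r -JZ//; apply: eq_J => x _; by rewrite mulN1r.
Qed.

Lemma J0 a b : J a b (fun=> 0) = 0.
Proof. by rewrite J.unlock Rintegral_cst// mul0r. Qed.

Lemma J_cst a b k : a <= b -> J a b (fun=> k) = k * (b - a).
Proof.
move=> ab; rewrite J.unlock Rintegral_cst//= lebesgue_measure_itv/=.
rewrite lte_fin; case: ltgtP ab => // -> _.
by rewrite subrr mulr0.
Qed.

Lemma le_J a b f g : continuous f -> continuous g ->
  (forall x, a <= x <= b -> f x <= g x) -> J a b f <= J a b g.
Proof.
move=> cf cg fg; rewrite J.unlock; apply: le_Rintegral => //; exact: continuous_integrable.
Qed.

Lemma J_sum (I : Type) (r : seq I) (P : pred I) a b (h : I -> R -> R) :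
  (forall i, continuous (h i)) ->
  J a b (fun x => \sum_(i <- r | P i) h i x) = \sum_(i <- r | P i) J a b (h i).
Proof.
move=> ch; elim: r => [|i r ih].
  rewrite big_nil -[RHS](J0 a b); apply: eq_J => x _; by rewrite big_nil.
rewrite big_cons -ih; case: (boolP (P i)) => Pi.
  rewrite -JD//; last exact: ct_sum.
  by apply: eq_J => x _; rewrite big_cons Pi.
by apply: eq_J => x _; rewrite big_cons (negbTE Pi).
Qed.

Lemma J_FTC a b f F : a <= b -> continuous f ->
  (forall x, a <= x <= b -> is_derive x 1 F (f x)) -> J a b f = F b - F a.
Proof.
rewrite le_eqVlt => /predU1P[<- _ _|ab cf dF].
  by rewrite J.unlock set_itv1 Rintegral_set1 subrr.
have cF x : a <= x <= b -> {for x, continuous F}.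
  by move=> /dF h; apply: differentiable_continuous; apply/derivable1_diffP; exact: ex_derive.
rewrite J.unlock /Rintegral (@continuous_FTC2 _ _ F)//.
- exact: continuous_subspaceT.
- split.
  + by move=> x; rewrite in_itv/= => /andP[/ltW ax /ltW xb]; have := dF x; rewrite ax xb => /(_ isT)[].
  + by apply: cvg_at_right_filter; apply: cF; rewrite lexx ltW.
  + by apply: cvg_at_left_filter; apply: cF; rewrite lexx ltW.
- move=> x; rewrite in_itv/= => /andP[/ltW ax /ltW xb].
  have := dF x; rewrite ax xb => /(_ isT) h.
  by rewrite derive1E derive_val.
Qed.

(** Once a primitive is available, splitting of the interval and affine substitution both follow
    from [J_FTC]. *)
Lemma primitive_exists a b f : continuous f ->
  exists F, forall x, a <= x <= b -> is_derive x 1 F (f x).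
Proof.
(* Starting at [a - 1] and stopping at [b + 1] puts the closed interval in the interior, so that the
   derivative is two-sided at [a] and at [b]. *)
move=> cf; exists (fun x => J (a - 1) x f) => x /andP[ax xb]; rewrite J.unlock.
have [] := @continuous_FTC1_closed R f (a - 1) x (b + 1).
- lra.
- exact: continuous_integrable.
- lra.
- exact: cf.
move=> d1 d2; apply: DeriveDef; first exact: d1.
by rewrite -derive1E d2.
Qed.

Lemma J_split m a b f : continuous f -> a <= m <= b ->
  J a b f = J a m f + J m b f.
Proof.
move=> cf /andP[am mb]; have [F dF] := primitive_exists a b cf.
have h p q : a <= p -> p <= q -> q <= b -> J p q f = F q - F p.
  move=> ap pq qb; apply: J_FTC => // x /andP[px xq]; apply: dF.
  by rewrite (le_trans ap px) (le_trans xq qb).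
by rewrite !h// ?(le_trans am mb)//; ring.
Qed.

Lemma derive_continuous f g : (forall x, is_derive x 1 f (g x)) -> continuous f.
Proof.
move=> df x; apply: differentiable_continuous; apply/derivable1_diffP.
by have [] := df x.
Qed.

Lemma is_derive_affine (u h x : R) : is_derive x 1 (fun t => u + h * t) h.
Proof.
have d := dvD (dv_cst u x) (dvZ h (is_derive_id x 1)).
by apply: (is_derive_eq d); rewrite add0r mulr1.
Qed.

Lemma is_derive_comp_affine F (u h x d : R) : is_derive (u + h * x) 1 F d ->
  is_derive x 1 (fun t => F (u + h * t)) (h * d).
Proof.
move=> dF; have := is_derive_affine u h x => dA.
have := @is_derive1_comp _ F (fun t => u + h * t) x d h dF dA.
by rewrite mulrC.
Qed.

Lemma J_affine u h a b f : 0 < h -> a <= b -> continuous f ->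
  J (u + h * a) (u + h * b) f = h * J a b (fun t => f (u + h * t)).
Proof.
move=> h0 ab cf; have [F dF] := primitive_exists (u + h * a) (u + h * b) cf.
have ab' : u + h * a <= u + h * b by rewrite lerD2l ler_pM2l.
have cfa : continuous (fun t => f (u + h * t)).
  move=> x; apply: (@continuous_comp _ _ _ (fun t => u + h * t) f); last exact: cf.
  exact: (derive_continuous (is_derive_affine u h)).
rewrite (J_FTC ab' cf dF) -JZ//.
apply/esym/(@J_FTC _ _ _ (fun t => F (u + h * t))) => //.
- exact: ctZ.
- move=> x /andP[ax xb]; apply: is_derive_comp_affine; apply: dF.
  by rewrite !lerD2l !ler_pM2l// ax.
Qed.

Lemma J_parts a b F G f g : a <= b ->
  (forall x, is_derive x 1 F (f x)) -> (forall x, is_derive x 1 G (g x)) ->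
  continuous f -> continuous g ->
  J a b (fun x => f x * G x) = F b * G b - F a * G a - J a b (fun x => F x * g x).
Proof.
move=> ab dF dG cf cg.
have cF := derive_continuous dF; have cG := derive_continuous dG.
have c1 : continuous (fun x => f x * G x).
  exact: ctM.
have c2 : continuous (fun x => F x * g x).
  exact: ctM.
apply/eqP; rewrite eq_sym subr_eq eq_sym -JD//; apply/eqP.
apply: (@J_FTC _ _ _ (fun x => F x * G x)) => //; first exact: ctD.
move=> x _; apply: (is_derive_eq (dvM (dF x) (dG x))); ring.
Qed.

(** Cauchy-Schwarz against the constant 1: expand the integral of the nonnegative function (f -
    mean)^2. *)
Lemma J_sqr_le a b f : a <= b -> continuous f ->
  J a b f ^+ 2 <= (b - a) * J a b (fun x => f x ^+ 2).
Proof.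
rewrite le_eqVlt => /predU1P[<- _|ab cf].
  by rewrite J.unlock set_itv1 Rintegral_set1 subrr mul0r expr0n.
set m := J a b f; set L := b - a; have L0 : 0 < L by rewrite subr_gt0.
have c2 : continuous (fun x => 2 * (m / L) * f x).
  exact: ctZ.
have csq : continuous (fun x => f x ^+ 2 - 2 * (m / L) * f x).
  by apply: ctB => //; exact: ctX.
have : 0 <= J a b (fun x => f x ^+ 2 - 2 * (m / L) * f x + (m / L) ^+ 2).
  apply: J_ge0 => x _; rewrite (_ : _ + _ = (f x - m / L) ^+ 2) ?sqr_ge0//; ring.
rewrite JD//; last exact: ct_cst.
rewrite JB//; last exact: ctX.
rewrite JZ// J_cst ?(ltW ab)// -/m -/L.
have -> : 2 * (m / L) * m = 2 * m ^+ 2 / L by field; rewrite gt_eqF.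
have -> : (m / L) ^+ 2 * L = m ^+ 2 / L by field; rewrite gt_eqF.
move=> h.
have : m ^+ 2 / L <= J a b (fun x => f x ^+ 2).
  by move: h; set q := m ^+ 2 / L; rewrite -mulrA -/q; lra.
by rewrite ler_pdivrMr// mulrC.
Qed.

End OneDimensionalIntegral.

Lemma ct_comp (T U V : topologicalType) (f : T -> U) (g : U -> V) :
  continuous f -> continuous g -> continuous (fun x => g (f x)).
Proof. by move=> cf cg x; exact: (continuous_comp (cf x) (cg (f x))). Qed.

Lemma ct_pair (T U V : topologicalType) (f : T -> U) (g : T -> V) :
  continuous f -> continuous g -> continuous (fun x => (f x, g x)).
Proof. by move=> cf cg x; apply: cvg_pair; [exact: cf|exact: cg]. Qed.

Lemma ct_fst (T U : topologicalType) : continuous (@fst T U).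
Proof. by move=> x; exact: cvg_fst. Qed.

Lemma ct_snd (T U : topologicalType) : continuous (@snd T U).
Proof. by move=> x; exact: cvg_snd. Qed.

Lemma ct_const (T U : topologicalType) (u : U) : continuous (fun _ : T => u).
Proof. by move=> x; exact: cvg_cst. Qed.

Lemma ct_id (T : topologicalType) : continuous (fun x : T => x).
Proof. by move=> x; exact: cvg_id. Qed.

(** * Fubini for jointly continuous functions on rectangles *)

Section TwoDimensionalIntegral.
Variable R : realType.
Notation mu := (@lebesgue_measure R).
Implicit Types (f : R -> R -> R) (a b c d : R).

Definition ct2 f := continuous (fun z : R * R => f z.1 z.2).

(** The sigma-algebra on the plane is the product one, generated by measurable rectangles. The open
    preimage of an interval is therefore written as a countable union of boxes with rational
    corners. *)
Lemma ct2_measurable f (A : set (measurableTypeR R * measurableTypeR R)) :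
  ct2 f -> measurable A -> measurable_fun A (fun z : measurableTypeR R * measurableTypeR R => f z.1 z.2).
Proof.
move=> cf mA; apply: measurable_funTS.
apply: (measurability _ (RGenOpens.measurableE R)).
move=> _ [_ [l [u ->] <-]]; rewrite setTI.
pose g (z : R * R) := f z.1 z.2.
pose box (p : rat * rat * (rat * rat)) : set (measurableTypeR R * measurableTypeR R) :=
  `]ratr p.1.1, ratr p.1.2[%classic `*` `]ratr p.2.1, ratr p.2.2[%classic.
have oU : open (g @^-1` `]l, u[%classic).
  by apply: open_comp => [z _|]; [exact: cf|exact: interval_open].
rewrite [X in measurable X](_ : _ = \bigcup_(p in [set p | box p `<=` g @^-1` `]l, u[%classic]) box p).
  rewrite bigcup_mkcond; apply: countable_bigcupT_measurable => [|p].
    exact: countableP.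
  by case: ifP => // _; apply: measurableX; exact: measurable_itv.
apply/seteqP; split => [[x y] /= rxy|[x y] [p /= bp /bp]//].
have /nbhs_ballP[e /= e0 he] : nbhs ((x, y) : R * R) (g @^-1` `]l, u[%classic).
  by apply: open_nbhs_nbhs; split.
have rat_near t : exists p : rat * rat, t - e < ratr p.1 < t /\ t < ratr p.2 < t + e.
  have /rat_in_itvoo[p] : t - e < t by rewrite ltrBlDr ltrDl.
  have /rat_in_itvoo[q] : t < t + e by rewrite ltrDl.
  by rewrite !in_itv/= => qt pt; exists (p, q).
have [p [/andP[p1 p2] /andP[p3 p4]]] := rat_near x.
have [q [/andP[q1 q2] /andP[q3 q4]]] := rat_near y.
exists (p, q) => /=; last by rewrite /box/=; split; rewrite /= in_itv/= ?p2 ?p3 ?q2 ?q3.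
move=> [s t] [/=]; rewrite !in_itv/= => /andP[s1 s2] /andP[t1 t2].
have /he : ball ((x, y) : R * R) e (s, t).
  by split; rewrite /ball/= ltr_distl; lra.
by rewrite /g/= in_itv.
Qed.

Lemma ct2_compact_bound f a b c d : ct2 f ->
  exists K, forall x y, a <= x <= b -> c <= y <= d -> `|f x y| <= K.
Proof.
move=> cf.
have cK : compact ((`[a, b]%classic `*` `[c, d]%classic) : set (R * R)).
  by apply: compact_setX; exact: segment_compact.
have := continuous_compact (continuous_subspaceT cf) cK.
move=> /compact_bounded[K [_ hK]]; exists (K + 1) => x y xab ycd.
apply: (hK (K + 1)); first by rewrite ltrDl.
by exists (x, y) => //; split; rewrite /= in_itv.
Qed.

Lemma ct2_integrable f a b c d : ct2 f ->
  (mu \x mu)%E.-integrable (`[a, b] `*` `[c, d]) (EFin \o (fun z => f z.1 z.2)).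
Proof.
move=> cf; have [K hK] := ct2_compact_bound a b c d cf.
have mAB : measurable ((`[a, b]%classic : set (measurableTypeR R)) `*` (`[c, d]%classic : set (measurableTypeR R))).
  by apply: measurableX; exact: measurable_itv.
apply: measurable_bounded_integrable => //.
- rewrite [ltLHS](_ : _ = mu `[a, b] * mu `[c, d])%E; last first.
    by apply: product_measure1E; exact: measurable_itv.
  by rewrite !lebesgue_measure_itv/=; do 2 case: ifP => _; rewrite ?mule0 ?mul0e// ?ltry.
- exact: ct2_measurable.
- exists K; split; first exact: num_real.
  move=> M KM [x y] [/=]; rewrite !in_itv/= => xab ycd.
  by apply: le_trans (ltW KM); exact: hK.
Qed.

Lemma ct2_x f y : ct2 f -> continuous (f ^~ y).
Proof.
apply: (@ct_comp _ _ _ (fun x : R => (x, y)) (fun z : R * R => f z.1 z.2)).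
by apply: ct_pair; [exact: ct_id|exact: ct_const].
Qed.

Lemma ct2_swap f : ct2 f -> ct2 (fun y x => f x y).
Proof.
apply: (@ct_comp _ _ _ (fun z : R * R => (z.2, z.1)) (fun z : R * R => f z.1 z.2)).
by apply: ct_pair; [exact: ct_snd|exact: ct_fst].
Qed.

Lemma ct2_y f x : ct2 f -> continuous (f x).
Proof. by move=> /ct2_swap/(@ct2_x _ x). Qed.

(** Dominated convergence on a window of radius 1 around the point, with the constant bound that
    compactness provides there. *)
Lemma ct2_J f c d : ct2 f -> continuous (fun x => J c d (f x)).
Proof.
move=> cf x.
have [K hK] := ct2_compact_bound (x - 1) (x + 1) c d cf.
rewrite J.unlock.
have H := @continuity_under_integral R _ _ mu f `[c, d] (measurable_itv _) (x - 1) (x + 1).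
apply: (H _ _ (fun=> K)).
- by move=> s _; apply: continuous_integrable; exact: ct2_y.
- by apply: aeW => y _ s _; exact: ct2_x.
- by apply: continuous_integrable; exact: ct_cst.
- move=> s /=; rewrite in_itv/= => /andP[s1 s2]; apply: aeW => y /=; rewrite in_itv/= => ycd.
  by apply: hK => //; rewrite !ltW.
- by rewrite inE/= in_itv/=; lra.
Qed.

Lemma iint_JJ f a b c d : ct2 f ->
  iint (`[a, b] `*` `[c, d]) f = J a b (fun x => J c d (f x)).
Proof.
move=> cf.
have mAB : measurable ((`[a, b]%classic : set (measurableTypeR R)) `*` (`[c, d]%classic : set (measurableTypeR R))).
  by apply: measurableX; exact: measurable_itv.
(* Fubini is applied on the whole plane to the integrand extended by zero; the case distinctions
   below undo the extension in each variable. *)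
rewrite /iint J.unlock /Rintegral integral_mkcond -integral12_prod_meas1; last first.
  by apply/(integrable_mkcond _ mAB); exact: ct2_integrable.
rewrite [in RHS]integral_mkcond; congr fine; apply: eq_integral => x _.
rewrite /fubini_F /= !patchE /=.
case: ifPn => xab; last first.
  rewrite integral0_eq// => y _; rewrite patchE; case: ifPn => // /set_mem[/= xab'].
  by move: xab; rewrite notin_setE.
rewrite fineK; last first.
  by apply: integrable_fin_num => //; apply: continuous_integrable; exact: ct2_y.
rewrite [RHS]integral_mkcond; apply: eq_integral => y _.
rewrite !patchE in_setX xab /=. by case: ifP.
Qed.

Lemma iint_JJ_swap f a b c d : ct2 f ->
  iint (`[a, b] `*` `[c, d]) f = J c d (fun y => J a b (f ^~ y)).
Proof.
move=> cf.
have mAB : measurable ((`[a, b]%classic : set (measurableTypeR R)) `*` (`[c, d]%classic : set (measurableTypeR R))).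
  by apply: measurableX; exact: measurable_itv.
rewrite /iint J.unlock /Rintegral integral_mkcond -integral21_prod_meas1; last first.
  by apply/(integrable_mkcond _ mAB); exact: ct2_integrable.
rewrite [in RHS]integral_mkcond; congr fine; apply: eq_integral => y _.
rewrite /fubini_G /= !patchE /=.
case: ifPn => ycd; last first.
  rewrite integral0_eq// => x _; rewrite patchE; case: ifPn => // /set_mem[/= _ ycd'].
  by move: ycd; rewrite notin_setE.
rewrite fineK; last first.
  by apply: integrable_fin_num => //; apply: continuous_integrable; exact: ct2_x.
rewrite [RHS]integral_mkcond; apply: eq_integral => x _.
rewrite !patchE in_setX ycd /= andbT. by case: ifP.
Qed.

Lemma J_swap f a b c d : ct2 f ->
  J a b (fun x => J c d (f x)) = J c d (fun y => J a b (f ^~ y)).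
Proof. by move=> cf; rewrite -iint_JJ// iint_JJ_swap. Qed.

Lemma ct2_J_swap f a b : ct2 f -> continuous (fun y => J a b (f ^~ y)).
Proof. by move=> /ct2_swap; exact: ct2_J. Qed.

End TwoDimensionalIntegral.

Arguments ct2_x {R f} y _ [x t] _.
Arguments ct2_y {R f} x _ [x0 t] _.
Arguments ct2_J {R f} c d _ [x t] _.
Arguments ct2_J_swap {R f} a b _ [x t] _.

Section FiniteSums.
Variable R : realFieldType.

Lemma sqr_sum_le (n : nat) (a : 'I_n -> R) :
  (\sum_i a i) ^+ 2 <= n%:R * \sum_i a i ^+ 2.
Proof.
elim: n a => [|n ih] a; first by rewrite !big_ord0 expr0n mulr0.
rewrite !big_ord_recr /=; set s := \sum_(i < n) _; set q := \sum_(i < n) _.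
set t := a ord_max.
have hs : s ^+ 2 <= n%:R * q by exact: ih.
have q0 : 0 <= q by apply: sumr_ge0 => i _; exact: sqr_ge0.
(* For n > 0 this is (s - n t)^2 >= 0 divided by n, together with s^2 <= n q; for n = 0 the sum s is
   zero. *)
have st : 2 * s * t <= q + n%:R * t ^+ 2.
  case: (posnP n) => [n0|n0].
    have -> : s = 0.
      by apply/eqP; rewrite -(sqrf_eq0 s) eq_le sqr_ge0 andbT; move: hs; rewrite n0 mul0r.
    by rewrite mulr0 mul0r n0 mul0r addr0.
  have N0 : 0 < n%:R :> R by rewrite ltr0n.
  rewrite -(ler_pM2l N0).
  have : 0 <= (s - n%:R * t) ^+ 2 by exact: sqr_ge0.
  nra.
rewrite -natr1; nra.
Qed.

End FiniteSums.

(** * The reference interpolation *)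

Section PolynomialsOnUnitInterval.
Variable R : realType.
Implicit Types (p q : {poly R}) (x : R).

Definition Int p : R := J 0 1 (horner p).

Lemma cp p : continuous (horner p).
Proof. exact: continuous_horner. Qed.

Lemma IntD p q : Int (p + q) = Int p + Int q.
Proof.
rewrite -JD; [|exact: cp..]; apply: eq_J => x _; exact: hornerD.
Qed.

Lemma IntZ c p : Int (c *: p) = c * Int p.
Proof. by rewrite -JZ; [apply: eq_J => x _; exact: hornerZ|exact: cp]. Qed.

Lemma IntN p : Int (- p) = - Int p.
Proof. by rewrite -scaleN1r IntZ mulN1r. Qed.

Lemma Int_deriv p : Int p^`() = p.[1] - p.[0].
Proof. by apply: J_FTC => //; exact: cp. Qed.

Lemma Int_sq_ge0 p : 0 <= Int (p ^+ 2).
Proof. by apply: J_ge0 => x _; rewrite horner_exp sqr_ge0. Qed.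

(** At [i = 0] the division by [0%:R] yields 0, so this is the primitive without constant term. *)
Definition antideriv p : {poly R} := \poly_(i < (size p).+1) (p`_i.-1 / i%:R).

Lemma antiderivK p : (antideriv p)^`() = p.
Proof.
apply/polyP => i; rewrite coef_deriv coef_poly ltnS.
case: ltnP => ip /=; last by rewrite mul0rn nth_default.
by rewrite -[LHS]mulr_natr /= -mulrA mulVf ?mulr1 ?pnatr_eq0.
Qed.

Lemma size_antideriv p : (size (antideriv p) <= (size p).+1)%N.
Proof. exact: size_poly. Qed.

Lemma poly_eq0_itv p : (forall x, 0 <= x <= 1 -> p.[x] = 0) -> p = 0.
Proof.
move=> p0; pose s := [seq (i%:R / (size p).+1%:R : R) | i <- iota 0 (size p).+1].
apply: (@roots_geq_poly_eq0 _ p s); last by rewrite size_map size_iota.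
- apply/allP => _ /mapP[i + ->]; rewrite mem_iota /= add0n => ip.
  apply/rootP/p0; rewrite divr_ge0//= ler_pdivrMr ?ltr0n// mul1r ler_nat.
  exact: ltnW.
- rewrite map_inj_uniq ?iota_uniq// => i j /divIf h.
  by apply/eqP; rewrite -(eqr_nat R); apply/eqP/h; rewrite pnatr_eq0.
Qed.

(** The primitive of p^2 is nondecreasing with equal values at 0 and 1, hence constant on the unit
    interval, hence constant as a polynomial; its derivative p^2 is zero. *)
Lemma Int_sq_eq0 p : Int (p ^+ 2) = 0 -> p = 0.
Proof.
move=> ip; apply: poly_eq0_itv => x /andP[x0 x1].
have dA (t : R) : is_derive t 1 (horner (antideriv (p ^+ 2))) (p ^+ 2).[t].
  by have := is_derive_poly (antideriv (p ^+ 2)) t; rewrite antiderivK.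
suff : antideriv (p ^+ 2) - (antideriv (p ^+ 2)).[0]%:P = 0.
  move=> /(congr1 (fun q => q^`())); rewrite derivB derivC subr0 antiderivK deriv0.
  by move=> /eqP; rewrite sqrf_eq0 => /eqP ->; rewrite horner0.
apply: poly_eq0_itv => t /andP[t0 t1]; rewrite hornerD hornerN hornerC.
rewrite -(@J_FTC R 0 t (horner (p ^+ 2)))//; last exact: cp.
have := @J_split R t 0 1 (horner (p ^+ 2)) (@cp _).
rewrite t0 t1 => /(_ isT); rewrite -/(Int _) ip.
have h1 : 0 <= J 0 t (horner (p ^+ 2)) by apply: J_ge0 => u _; rewrite horner_exp sqr_ge0.
have h2 : 0 <= J t 1 (horner (p ^+ 2)) by apply: J_ge0 => u _; rewrite horner_exp sqr_ge0.
lra.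
Qed.

Lemma poly_sum_lt n p : (size p <= n)%N -> p = \sum_(i < n) p`_i *: 'X^i.
Proof. by move=> sp; rewrite -poly_def; apply/polyP => i; rewrite coef_poly; case: ltnP => // ni; rewrite nth_default// (leq_trans sp). Qed.

Lemma size_sum_lt n (u : 'I_n -> R) : (size (\sum_(i < n) u i *: 'X^i)%R <= n)%N.
Proof.
apply: (leq_trans (size_sum _ _ _)); apply/bigmax_leqP => i _; apply: leq_trans (size_scale_leq _ _) _.
by rewrite size_polyXn.
Qed.

Lemma coef_sum_lt n (u : 'I_n -> R) (i : 'I_n) : (\sum_(j < n) u j *: 'X^j)`_i = u i.
Proof.
rewrite coef_sum (bigD1 i)//= coefZ coefXn eqxx mulr1 big1 ?addr0// => j ji.
rewrite coefZ coefXn; case: eqP => [e|]; last by rewrite mulr0.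
by case/eqP: ji; apply/val_inj.
Qed.

(** A square linear system: on an n-dimensional space, n functionals without common kernel take
    arbitrary values. It yields the reference interpolation, the Lagrange basis and the polynomials
    representing coefficients as integrals. *)
Lemma solve_functionals n (l : 'I_n -> {poly R} -> R) (c : 'I_n -> R) :
  (forall i a p q, l i (a *: p + q) = a * l i p + l i q) ->
  (forall p, (size p <= n)%N -> (forall i, l i p = 0) -> p = 0) ->
  exists p, (size p <= n)%N /\ forall i, l i p = c i.
Proof.
move=> lin inj.
have l0 i : l i 0 = 0.
  by have := lin i 1 0 0; rewrite scaler0 addr0 mul1r; lra.
have lsum i (u : 'I_n -> R) : l i (\sum_(j < n) u j *: 'X^j) = \sum_j u j * l i 'X^j.
  elim/big_ind2 : _ => [|a p b q <- <-|j _].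
  - exact: l0.
  - by rewrite -[p]scale1r lin mul1r scale1r.
  - by have := lin i (u j) 'X^j 0; rewrite addr0 l0 addr0.
pose B := \matrix_(i < n, j < n) l j 'X^i.
have BU : B \in unitmx.
  rewrite -row_free_unit -kermx_eq0; apply/eqP/row_matrixP => i.
  rewrite row0; set u := row i _.
  have uB : u *m B = 0 by apply/eqP; rewrite -sub_kermx; exact: row_sub.
  have h0 : \sum_(j < n) u 0 j *: 'X^j = 0.
    apply: inj => [|m]; first exact: size_sum_lt.
    rewrite lsum; move/rowP/(_ m): uB; rewrite mxE [RHS]mxE => e; apply: (etrans _ e).
by apply: eq_bigr => s _; congr (_ * _); rewrite mxE.
  by apply/rowP => j; rewrite [RHS]mxE -(coef_sum_lt (fun j => u 0 j)) h0 coef0.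
pose u := (\row_j c j) *m invmx B.
exists (\sum_(j < n) u 0 j *: 'X^j); split; first exact: size_sum_lt.
move=> i; rewrite lsum.
have /rowP/(_ i) : u *m B = \row_j c j by rewrite mulmxKV.
rewrite mxE [RHS]mxE => <-; apply: eq_bigr => s _; congr (_ * _); by rewrite mxE.
Qed.

End PolynomialsOnUnitInterval.

Section ReferenceCell.
Variable R : realType.
Implicit Types (p q g W : {poly R}) (x : R).

Lemma size_le_addp n p q : (size p <= n)%N -> (size q <= n)%N -> (size (p + q)%R <= n)%N.
Proof. by move=> sp sq; rewrite (leq_trans (size_polyD _ _))// geq_max sp. Qed.

Lemma size_le_oppp n p : (size p <= n)%N -> (size (- p)%R <= n)%N.
Proof. by rewrite size_polyN. Qed.

Lemma size_le_scalep n c p : (size p <= n)%N -> (size (c *: p) <= n)%N.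
Proof. exact/leq_trans/size_scale_leq. Qed.

(* A polynomial [p] of degree [<= k] in the kernel of the system satisfies
   [int p'^2 = p(1) p'(1) - p(0) p'(0) - int p p'' = 0]. *)
Lemma antiperiodic_projection k g (u v : R) : (0 < k)%N ->
  exists p, [/\ (size p <= k.+1)%N,
    forall q, (size q < k)%N -> Int ((p - g) * q) = 0,
    p.[0] + p.[1] = u & p^`().[0] + p^`().[1] = v].
Proof.
move=> k0.
(* The moments against X^i for i < k - 1 and the two end conditions, at the indices k - 1 and k, are
   as many functionals as a polynomial of degree k has coefficients. *)
pose l (i : 'I_k.+1) p := if (i < k.-1)%N then Int (p * 'X^i) else
  if i == k.-1 :> nat then p.[0] + p.[1] else p^`().[0] + p^`().[1].
have Hk1 : (k.-1 < k.+1)%N by lia.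
have lX p q : (forall i, l i p = 0) -> (size q < k)%N -> Int (p * q) = 0.
  move=> lp sq; rewrite (@poly_sum_lt _ k.-1 q) ?mulr_sumr; last by lia.
  elim/big_rec : _ => [|i r _ ir]; first by rewrite -(scale0r 0) IntZ mul0r.
  rewrite IntD ir addr0 -scalerAr IntZ.
  have ik : (i < k.+1)%N by have := ltn_ord i; lia.
  by have := lp (Ordinal ik); rewrite /l /= ltn_ord => ->; rewrite mulr0.
have l1 p : (forall i, l i p = 0) -> p.[0] + p.[1] = 0.
  by move=> /(_ (Ordinal Hk1)); rewrite /l /= ltnn eqxx.
have l2 p : (forall i, l i p = 0) -> p^`().[0] + p^`().[1] = 0.
  move=> /(_ ord_max); rewrite /l /= ifN; last by lia.
  by rewrite ifN//; apply/eqP; lia.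
have lin i (a : R) p q : l i (a *: p + q) = a * l i p + l i q.
  rewrite /l; case: ifP => _; first by rewrite mulrDl IntD -scalerAl IntZ.
  by case: ifP => _; rewrite ?derivD ?derivZ !hornerD !hornerZ; ring.
have inj p : (size p <= k.+1)%N -> (forall i, l i p = 0) -> p = 0.
  move=> sp lp; have sp2 : (size p^`()^`() < k)%N.
    have [->|p0] := eqVneq p 0; first by rewrite !deriv0 size_poly0.
    have [p'0|p'0] := eqVneq p^`() 0; first by rewrite p'0 deriv0 size_poly0.
    have := lt_size_deriv p0; have := lt_size_deriv p'0; lia.
  have := Int_deriv (p * p^`()); rewrite derivM IntD (lX _ _ lp sp2) addr0.
  rewrite !hornerM; have := l1 _ lp; have := l2 _ lp.
  move=> /eqP; rewrite addr_eq0 => /eqP -> /eqP; rewrite addr_eq0 => /eqP ->.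
  rewrite mulrNN subrr -expr2 => /Int_sq_eq0 p'0.
  (* With p' = 0 the polynomial is constant, and p(0) + p(1) = 0 leaves only zero. *)
  have pc : p = (p.[0])%:P.
    apply/polyP => i; rewrite coefC horner_coef0; case: i => [//|i] /=.
    have /polyP/(_ i) := p'0; rewrite coef_deriv coef0 => /eqP.
    by rewrite mulrn_eq0 /= => /eqP.
  have := l1 _ lp; rewrite pc !hornerC => /eqP.
  by rewrite -mulr2n mulrn_eq0 /= => /eqP ->.
have [p [sp lp]] := @solve_functionals R _ l (fun i => if (i < k.-1)%N then Int (g * 'X^i) else
  if i == k.-1 :> nat then u else v) lin inj.
exists p; split => //.
- move=> q sq; rewrite (@poly_sum_lt _ k.-1 q) ?mulr_sumr; last by lia.
  elim/big_rec : _ => [|i r _ ir]; first by rewrite -(scale0r 0) IntZ mul0r.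
  rewrite IntD ir addr0 -scalerAr IntZ mulrBl IntD IntN.
  have ik : (i < k.+1)%N by have := ltn_ord i; lia.
  by have := lp (Ordinal ik); rewrite /l /= ltn_ord => ->; rewrite subrr mulr0.
- by have := lp (Ordinal Hk1); rewrite /l /= ltnn eqxx.
- have := lp ord_max; rewrite /l /= ifN; last by lia.
  by rewrite !ifN//; [apply/eqP; lia|lia|apply/eqP; lia].
Qed.

(** Only the two leading terms matter: they tell how the coefficients of X^(k+1) and X^(k+2) change
    when a polynomial is viewed from the neighbouring cell. *)
Lemma Xadd1_expr n : exists2 r : {poly R}, (size r <= n.-1)%N &
  (1 + 'X) ^+ n = 'X^n + (n%:R : R) *: 'X^(n.-1) + r :> {poly R}.
Proof.
elim: n => [|n [r sr e]].
  by exists 0; rewrite ?size_poly0// !expr0 scale0r !addr0.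
case: n => [|n] in r sr e *.
  by exists 0; rewrite ?size_poly0// !expr1 expr0 scale1r addr0 addrC.
exists ((1 + 'X) * r + (n.+1%:R : R) *: 'X^n : {poly R}).
  apply: size_le_addp; last by apply: size_le_scalep; rewrite size_polyXn.
  apply: (leq_trans (size_polyMleq _ _)).
  have : (size (1 + 'X : {poly R})%R <= 2)%N.
    by apply: size_le_addp; rewrite ?size_polyX// size_poly1.
  by move: sr => /=; lia.
rewrite exprS e mulrDr; rewrite -addrA [in RHS](addrC (_ * r)) !addrA; congr (_ + _).
rewrite /= -!mul_polyC !exprS -[n.+2%:R]natr1 polyCD; ring.
Qed.

Lemma lagrange_basis n (s : 'I_n -> R) : injective s ->
  exists l : 'I_n -> {poly R}, (forall i, (size (l i) <= n)%N) /\
    forall W, (size W <= n)%N -> W = \sum_i W.[s i] *: l i.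
Proof.
move=> sinj.
pose l (i : 'I_n) p := p.[s i].
have lin i (a : R) p q : l i (a *: p + q) = a * l i p + l i q.
  by rewrite /l hornerD hornerZ.
have inj p : (size p <= n)%N -> (forall i, l i p = 0) -> p = 0.
  move=> sp lp; apply: (@roots_geq_poly_eq0 _ p [seq s i | i <- enum 'I_n]).
  - by apply/allP => _ /mapP[i _ ->]; apply/rootP/lp.
  - by rewrite map_inj_uniq ?enum_uniq.
  - by rewrite size_map size_enum_ord.
have [L HL] := choice (fun j : 'I_n => @solve_functionals R n l (fun i => (i == j)%:R) lin inj).
exists L; split => [i|W sW]; first by have [] := HL i.
apply/eqP; rewrite -subr_eq0; apply/eqP/inj.
  apply: size_le_addp => //; apply: size_le_oppp.
  apply: (leq_trans (size_sum _ _ _)); apply/bigmax_leqP => i _.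
  by apply: size_le_scalep; have [] := HL i.
move=> i; rewrite /l hornerD hornerN horner_sum (bigD1 i)//= hornerZ.
have [_ /(_ i)] := HL i; rewrite /l => ->; rewrite eqxx mulr1 big1 ?addr0 ?subrr// => j ji.
by rewrite hornerZ; have [_ /(_ i)] := HL j; rewrite /l => ->; rewrite eq_sym (negbTE ji) mulr0.
Qed.

(** It sees nothing but the values of [z] at the nodes. It is thus defined for arbitrary functions,
    linear, and compatible with derivatives in a parameter. *)
Definition interp n (s : 'I_n -> R) (lam : 'I_n -> {poly R}) (z : R -> R) : {poly R} :=
  \sum_i z (s i) *: lam i.

(* The exactness at the common endpoint of two adjacent cells ([ref_avg],
   [ref_avg']) together with [ref_orth] makes the DG form of the interpolation
   error vanish on polynomials of degree [k + 2], two degrees more than the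
   interpolation reproduces. *)
Record reference_interpolation k (s : 'I_k.+3 -> R) (lam : 'I_k.+3 -> {poly R}) : Prop :=
  RefInterp {
  ref_node : forall i, 0 <= s i <= 1;
  ref_size : forall i, (size (lam i) <= k.+1)%N;
  ref_exact : forall W, (size W <= k.+1)%N -> interp s lam (horner W) = W;
  ref_orth : forall W q, (size W <= k.+3)%N -> (size q < k)%N ->
    Int ((interp s lam (horner W) - W) * q) = 0;
  ref_avg : forall W, (size W <= k.+3)%N ->
    (interp s lam (horner W)).[1] + (interp s lam (fun t => W.[1 + t])).[0] = 2 * W.[1];
  ref_avg' : forall W, (size W <= k.+3)%N ->
    (interp s lam (horner W))^`().[1] + (interp s lam (fun t => W.[1 + t]))^`().[0]
    = 2 * W^`().[1] }.

(** The error operator [E] is designed first, and the interpolation of a polynomial of degree k + 2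
    is then forced to be [W - E W]. *)
Lemma reference_interpolation_exists k : (0 < k)%N ->
  exists s lam, @reference_interpolation k s lam.
Proof.
move=> k0.
set g1 : {poly R} := 'X^(k.+1).
have [p1 [sp1 op1 vp1 dp1]] := @antiperiodic_projection k g1
  (g1.[0] + g1.[1]) (g1^`().[0] + g1^`().[1]) k0.
pose phi : {poly R} := g1 - p1.
set g2 : {poly R} := 'X^(k.+2).
(* The additional data (k+2) phi compensate the term (k+2) X^(k+1) that appears when X^(k+2) is
   shifted by one cell. *)
have [p2 [sp2 op2 vp2 dp2]] := @antiperiodic_projection k g2
  (g2.[0] + g2.[1] + k.+2%:R * phi.[0])
  (g2^`().[0] + g2^`().[1] + k.+2%:R * phi^`().[0]) k0.
pose psi : {poly R} := g2 - p2.
(* Replacing X^(k+1) by [p1] and X^(k+2) by [p2] is subtracting [E W]; this lowers the degree to k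
   and leaves polynomials of degree k unchanged. *)
pose E W : {poly R} := W`_k.+1 *: phi + W`_k.+2 *: psi.
have Elin (a : R) (W V : {poly R}) : E (a *: W + V) = a *: E W + E V.
  by rewrite /E !coefD !coefZ -!mul_polyC !polyCD !polyCM; ring.
have E0 : E 0 = 0 by rewrite /E !coef0 !scale0r addr0.
have Esmall W : (size W <= k.+1)%N -> E W = 0.
  by move=> sW; rewrite /E !nth_default ?scale0r ?addr0// ltnW.
have sphi : (size phi <= k.+2)%N.
  apply: size_le_addp; first by rewrite size_polyXn.
  exact/size_le_oppp/(leq_trans sp1).
have spsi : (size psi <= k.+3)%N.
  apply: size_le_addp; first by rewrite size_polyXn.
  by apply: size_le_oppp; apply: (leq_trans sp2); lia.
have sLam W : (size W <= k.+3)%N -> (size (W - E W)%R <= k.+1)%N.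
  move=> sW; apply/leq_sizeP => j kj; rewrite coefB coefD !coefZ /phi /psi /g1 /g2 !coefB.
  rewrite !coefXn (nth_default _ (leq_trans sp1 kj)) (nth_default _ (leq_trans sp2 kj)) !subr0.
  have [->|jk1] := eqVneq j k.+1.
    rewrite (_ : (k.+1 == k.+2) = false); last by apply/negbTE; lia.
    by rewrite mulr1 mulr0 addr0 subrr.
  have [->|jk2] := eqVneq j k.+2.
    by rewrite mulr1 mulr0 add0r subrr.
  rewrite !mulr0 addr0 subr0 nth_default//.
  by move: sW kj jk1 jk2; move: (size W) => n; clear; lia.
(* Values at k + 3 distinct nodes determine a polynomial of degree k + 2, so the operator [W - E W]
   can be written through point values, by applying it to the Lagrange basis. *)
pose s (i : 'I_k.+3) : R := i%:R / k.+2%:R.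
have sinj : injective s.
  move=> i j /divIf h; apply/val_inj/eqP; rewrite -(eqr_nat R); apply/eqP/h.
  by rewrite pnatr_eq0.
have [l [sl ll]] := lagrange_basis sinj.
pose lam i : {poly R} := l i - E (l i).
have interpE W : (size W <= k.+3)%N -> interp s lam (horner W) = W - E W.
  move=> sW; rewrite [in RHS](ll _ sW) /interp /lam.
  have -> : E (\sum_i W.[s i] *: l i) = \sum_i W.[s i] *: E (l i).
    elim/big_ind2 : _ => [|a p b q <- <-|j _] //.
      by rewrite -[p in LHS]scale1r Elin scale1r.
    by rewrite -[X in E X]addr0 Elin E0 addr0.
  by rewrite -sumrB; apply: eq_bigr => i _; rewrite scalerBr.
have sX1 : (size (1 + 'X : {poly R})%R <= 2)%N.
  by apply: size_le_addp; rewrite ?size_polyX// size_poly1.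
(* [V] is W(1 + X), the same polynomial in the coordinate of the next cell. Only the coefficient of
   phi in its error differs, by (k+2) times the leading coefficient. *)
have shift W : (size W <= k.+3)%N -> exists V : {poly R}, [/\ (size V <= k.+3)%N,
    (forall t, W.[1 + t] = V.[t]), (forall t, W^`().[1 + t] = V^`().[t]) &
    E V = (W`_k.+1 + k.+2%:R * W`_k.+2) *: phi + W`_k.+2 *: psi].
  move=> sW; exists (W \Po (1 + 'X)).
  have hV t : (1 + 'X : {poly R}).[t] = 1 + t by rewrite hornerD hornerX hornerC.
  split.
  - rewrite comp_polyE; apply: (leq_trans (size_sum _ _ _)); apply/bigmax_leqP => i _.
    apply: size_le_scalep; apply: (leq_trans (size_poly_exp_leq _ _)).
    have := ltn_ord i; nia.
  - by move=> t; rewrite horner_comp hV.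
  - move=> t; rewrite deriv_comp hornerM horner_comp hV derivD derivC derivX add0r.
    by rewrite hornerC mulr1.
  pose V0 := \sum_(i < k.+1) W`_i *: (1 + 'X : {poly R}) ^+ i.
  have sV0 : (size V0 <= k.+1)%N.
    apply: (leq_trans (size_sum _ _ _)); apply/bigmax_leqP => i _.
    apply: size_le_scalep; apply: (leq_trans (size_poly_exp_leq _ _)).
    have := ltn_ord i; nia.
  have VE : W \Po (1 + 'X) = V0 + W`_k.+1 *: (1 + 'X) ^+ k.+1 + W`_k.+2 *: (1 + 'X) ^+ k.+2.
    rewrite [in LHS](poly_sum_lt sW) linear_sum /= !big_ord_recr /=.
    rewrite !linearZ /= !comp_Xn_poly; congr (_ + _ + _).
    rewrite /V0 big_ord_recr /=; congr (_ + _); apply: eq_bigr => i _.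
    by rewrite linearZ /= comp_Xn_poly.
  have [r1 sr1 e1] := Xadd1_expr k.+1; have [r2 sr2 e2] := Xadd1_expr k.+2.
  have n1 : (k.+1 == k) = false by apply/negbTE; lia.
  have n2 : (k.+2 == k.+1) = false by apply/negbTE; lia.
  have n3 : (k.+2 == k) = false by apply/negbTE; lia.
  have n4 : (k.+1 == k.+2) = false by apply/negbTE; lia.
  have a1 : ((1 + 'X) ^+ k.+1)`_k.+1 = 1 :> R.
    rewrite e1 !coefD coefZ !coefXn /= n1 eqxx (nth_default _ (leq_trans sr1 _)) /=; last by lia.
    by rewrite mulr0 !addr0.
  have a2 : ((1 + 'X) ^+ k.+1)`_k.+2 = 0 :> R.
    rewrite e1 !coefD coefZ !coefXn /= n2 n3 (nth_default _ (leq_trans sr1 _)) /=; last by lia.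
    by rewrite mulr0 !addr0.
  have a3 : ((1 + 'X) ^+ k.+2)`_k.+1 = k.+2%:R :> R.
    rewrite e2 !coefD coefZ !coefXn /= n4 eqxx (nth_default _ (leq_trans sr2 _)) /=; last by lia.
    by rewrite mulr1 addr0 add0r.
  have a4 : ((1 + 'X) ^+ k.+2)`_k.+2 = 1 :> R.
    rewrite e2 !coefD coefZ !coefXn /= n2 eqxx (nth_default _ (leq_trans sr2 _)) /=; last by lia.
    by rewrite mulr0 !addr0.
  have v1 : V0`_k.+1 = 0 by rewrite nth_default.
  have v2 : V0`_k.+2 = 0 by rewrite nth_default// (leq_trans sV0).
  rewrite /E VE !coefD !coefZ a1 a2 a3 a4 v1 v2.
  by rewrite mulr0 !mulr1 !addr0 !add0r [in RHS]mulrC.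
exists s, lam; split.
- move=> i; rewrite /s divr_ge0//= ler_pdivrMr ?ltr0n// mul1r ler_nat.
  by have := ltn_ord i; lia.
- by move=> i; exact: sLam.
- by move=> W sW; rewrite interpE ?Esmall ?subr0//; lia.
- move=> W q sW sq; rewrite interpE// addrC addKr mulNr IntN mulrDl IntD -!scalerAl !IntZ.
  have -> : Int (phi * q) = 0 by rewrite -[phi]opprB mulNr IntN op1// oppr0.
  have -> : Int (psi * q) = 0 by rewrite -[psi]opprB mulNr IntN op2// oppr0.
  by rewrite !mulr0 addr0 oppr0.
- move=> W sW; have [V [sV hV _ EV]] := shift W sW.
  have -> : (fun t => W.[1 + t]) = horner V by apply/funext.
  rewrite !interpE// EV !hornerD !hornerN !hornerD !hornerZ -hV addr0.
  have h1 : phi.[1] + phi.[0] = 0 by rewrite /phi !hornerD !hornerN; lra.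
  have h2 : psi.[1] + psi.[0] + k.+2%:R * phi.[0] = 0.
    by rewrite {1 2}/psi !(hornerD g2) !hornerN; lra.
  rewrite (_ : phi.[1] = - phi.[0]); last by lra.
  rewrite (_ : psi.[1] = - psi.[0] - k.+2%:R * phi.[0]); last by lra.
  by ring.
- move=> W sW; have [V [sV hV dV EV]] := shift W sW.
  have -> : (fun t => W.[1 + t]) = horner V by apply/funext.
  have h1 : phi^`().[1] + phi^`().[0] = 0.
    by rewrite /phi !derivB !hornerD !hornerN; lra.
  have h2 : psi^`().[1] + psi^`().[0] + k.+2%:R * phi^`().[0] = 0.
    by rewrite {1 2}/psi !(derivB g2) !(hornerD g2^`()) !hornerN; lra.
  have EW : E W = W`_k.+1 *: phi + W`_k.+2 *: psi by [].
  rewrite !interpE// EV EW; move: h1 h2; move: (phi) (psi) => f1 f2 h1 h2.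
  rewrite !(derivD, derivN, derivZ) !(hornerD, hornerN, hornerZ) -dV addr0.
  rewrite (_ : f1^`().[1] = - f1^`().[0]); last by lra.
  rewrite (_ : f2^`().[1] = - f2^`().[0] - k.+2%:R * f1^`().[0]); last by lra.
  by ring.
Qed.

End ReferenceCell.

(** * One-dimensional residual estimate *)

Section InverseInequalities.
Variable R : realType.
Implicit Types (p q W : {poly R}) (x : R).

Lemma Int0 : Int (0 : {poly R}) = 0.
Proof. by rewrite -(scale0r (0 : {poly R})) IntZ mul0r. Qed.

Lemma horner_bound p : exists K : R, 0 <= K /\ forall x, 0 <= x <= 1 -> `|p.[x]| <= K.
Proof.
exists (\sum_(i < size p) `|p`_i|); split; first exact: sumr_ge0.
move=> x /andP[x0 x1]; rewrite horner_coef; apply: (le_trans (ler_norm_sum _ _ _)).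
apply: ler_sum => i _; rewrite normrM normrX (ger0_norm x0) ler_piMr//.
exact: exprn_ile1.
Qed.

Lemma young (A B e : R) : 0 < e -> A * B <= A ^+ 2 / e + e * B ^+ 2.
Proof.
move=> e0; have h1 : 0 <= A ^+ 2 / e by rewrite divr_ge0 ?sqr_ge0// ltW.
have h2 : 0 <= e * B ^+ 2 by rewrite mulr_ge0 ?sqr_ge0// ltW.
have : 0 <= (A / e - B) ^+ 2 * e by rewrite mulr_ge0 ?sqr_ge0// ltW.
have -> : (A / e - B) ^+ 2 * e = A ^+ 2 / e + e * B ^+ 2 - 2 * (A * B).
  by field; rewrite gt_eqF.
lra.
Qed.

(** Each coefficient is the integral of p against a fixed dual polynomial [rho i], so Cauchy-Schwarz
    bounds it by the L2 norm. *)
Lemma Int_coef_bound n : exists C : R, 0 <= C /\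
  forall p, (size p <= n)%N -> forall i, p`_i ^+ 2 <= C * Int (p ^+ 2).
Proof.
pose l (j : 'I_n) p := Int (p * 'X^j).
have lin i (a : R) p q : l i (a *: p + q) = a * l i p + l i q.
  by rewrite /l mulrDl IntD -scalerAl IntZ.
have inj p : (size p <= n)%N -> (forall i, l i p = 0) -> p = 0.
  move=> sp lp; apply: Int_sq_eq0; rewrite expr2 {2}(poly_sum_lt sp) mulr_sumr.
  elim/big_rec : _ => [|i r _ ir]; first by rewrite Int0.
  by rewrite IntD ir addr0 -scalerAr IntZ; have := lp i; rewrite /l => ->; rewrite mulr0.
have [rho Hrho] := choice (fun i : 'I_n => @solve_functionals R n l (fun j => (i == j)%:R) lin inj).
have [K HK] := choice (fun i : 'I_n => horner_bound (rho i)).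
have coefE p (i : 'I_n) : (size p <= n)%N -> p`_i = Int (rho i * p).
  move=> sp; rewrite {2}(poly_sum_lt sp) mulr_sumr.
  transitivity (\sum_(j < n) p`_j * Int (rho i * 'X^j)).
    rewrite (bigD1 i)//= big1 ?addr0.
      by have [_ /(_ i)] := Hrho i; rewrite /l => ->; rewrite eqxx mulr1.
    move=> j ji; have [_ /(_ j)] := Hrho i; rewrite /l => ->.
    by rewrite eq_sym (negbTE ji) mulr0.
  elim/big_ind2 : _ => [|? p1 ? p2 -> ->|j _]; first by rewrite Int0.
    by rewrite IntD.
  by rewrite -scalerAr IntZ.
exists (\sum_i K i ^+ 2); split; first by apply: sumr_ge0 => i _; exact: sqr_ge0.
move=> p sp i; case: (ltnP i n) => ni; last first.
  rewrite nth_default ?expr0n/=; last exact: leq_trans sp ni.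
  by rewrite mulr_ge0 ?Int_sq_ge0//; apply: sumr_ge0 => j _; exact: sqr_ge0.
rewrite (coefE p (Ordinal ni) sp).
have := J_sqr_le ler01 (@cp R (rho (Ordinal ni) * p)); rewrite subr0 mul1r.
move/le_trans; apply.
apply: (@le_trans _ _ (K (Ordinal ni) ^+ 2 * Int (p ^+ 2))).
  rewrite -JZ; last exact: cp.
  apply: le_J; [exact/ctX/cp|exact/ctZ/cp|].
  move=> x x01; rewrite hornerM exprMn horner_exp ler_wpM2r ?sqr_ge0//.
  have [K0 /(_ x x01) h] := HK (Ordinal ni).
  by rewrite -real_normK ?num_real// lerXn2r// nnegrE.
rewrite ler_wpM2r ?Int_sq_ge0// (bigD1 (Ordinal ni))//= lerDl.
by apply: sumr_ge0 => j _; exact: sqr_ge0.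
Qed.

Lemma horner_sqr_le n p A x : (size p <= n)%N -> 0 <= x <= 1 ->
  (forall i, p`_i ^+ 2 <= A) -> p.[x] ^+ 2 <= n%:R ^+ 2 * A.
Proof.
move=> sp /andP[x0 x1] hA; rewrite (poly_sum_lt sp) horner_sum.
apply: (le_trans (sqr_sum_le _)).
rewrite expr2 -mulrA ler_wpM2l ?ler0n//.
apply: (@le_trans _ _ (\sum_(i < n) A)); last by rewrite sumr_const card_ord mulr_natl.
apply: ler_sum => i _; rewrite hornerZ hornerXn exprMn.
apply: le_trans (hA i); rewrite ler_piMr ?sqr_ge0//.
by rewrite exprn_ile1// ?exprn_ge0// exprn_ile1.
Qed.

(** Stated on the unit interval, where no mesh size occurs; the powers of h enter only through the
    rescaling of cells. *)
Lemma inverse_inequality n : exists C : R, 0 <= C /\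
  forall p, (size p <= n)%N -> forall x, 0 <= x <= 1 ->
  [/\ p.[x] ^+ 2 <= C * Int (p ^+ 2), p^`().[x] ^+ 2 <= C * Int (p ^+ 2) &
      p^`()^`().[x] ^+ 2 <= C * Int (p ^+ 2)].
Proof.
have [C [C0 HC]] := Int_coef_bound n.
have dcoef p A i : (size p <= n)%N -> (forall i, p`_i ^+ 2 <= A) ->
    p^`()`_i ^+ 2 <= n%:R ^+ 2 * A.
  move=> sp hA; have A0 : 0 <= A by apply: le_trans (hA 0%N); exact: sqr_ge0.
  rewrite coef_deriv; case: (ltnP i.+1 n) => ni; last first.
    by rewrite nth_default ?mul0rn ?expr0n/= ?mulr_ge0 ?sqr_ge0//; exact: leq_trans ni.
  rewrite -[p`_i.+1 *+ i.+1]mulr_natl exprMn; apply: ler_pM => //; rewrite ?sqr_ge0//.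
  by rewrite lerXn2r ?nnegrE ?ler0n// ler_nat ltnW.
have sd p : (size p <= n)%N -> (size p^`() <= n)%N.
  move=> sp; have [->|p0] := eqVneq p 0; first by rewrite deriv0 size_poly0.
  by rewrite ltnW// (leq_trans (lt_size_deriv p0)).
pose N : R := n%:R ^+ 2.
have N0 : 0 <= N by exact: sqr_ge0.
exists (N * C + N * (N * C) + N * (N * (N * C))); split.
  by rewrite !addr_ge0 ?mulr_ge0.
move=> p sp x x01; have I0 := Int_sq_ge0 p; set I := Int _ in I0 *.
have c0 i : p`_i ^+ 2 <= C * I by exact: HC.
have c1 i : p^`()`_i ^+ 2 <= N * (C * I) by exact: dcoef.
have c2 i : p^`()^`()`_i ^+ 2 <= N * (N * (C * I)) by apply: dcoef => //; exact: sd.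
have h0 := horner_sqr_le sp x01 c0.
have h1 := horner_sqr_le (sd _ sp) x01 c1.
have h2 := horner_sqr_le (sd _ (sd _ sp)) x01 c2.
have e1 : 0 <= N * C * I by rewrite !mulr_ge0.
have e2 : 0 <= N * (N * C) * I by rewrite !mulr_ge0.
have e3 : 0 <= N * (N * (N * C)) * I by rewrite !mulr_ge0.
rewrite !mulrDl; move: h0 h1 h2; rewrite -/N !mulrA in e1 e2 e3 *.
by split; lra.
Qed.

End InverseInequalities.

Section TaylorApproximation.
Variable R : realType.
Implicit Types (z : nat -> R -> R) (H x : R) (W : {poly R}).

(** [z m] stands for the m-th derivative of [z 0]. A family instead of an iterated operator lets
    restrictions to a row and interpolation errors in the other variable be treated alike. *)
Definition jets z := forall m x, is_derive x 1 (z m) (z m.+1 x).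

Lemma jets_ct z m : jets z -> continuous (z m).
Proof. by move=> jz; apply: (derive_continuous (jz m)). Qed.

Lemma jetsS z : jets z -> jets (fun m => z m.+1).
Proof. by move=> jz m; exact: jz. Qed.

Lemma J_sqr_prefix H x (f : R -> R) : continuous f -> 0 <= x <= H ->
  `|J 0 x f| <= Num.sqrt (H * J 0 H (fun t => f t ^+ 2)).
Proof.
move=> cf /andP[x0 xH]; rewrite -sqrtr_sqr; apply: ler_wsqrtr.
have cf2 := ctX (n := 2) cf.
have h1 : 0 <= J 0 x (fun t => f t ^+ 2) by apply: J_ge0 => t _; exact: sqr_ge0.
have h2 : 0 <= J x H (fun t => f t ^+ 2) by apply: J_ge0 => t _; exact: sqr_ge0.
apply: (le_trans (J_sqr_le x0 cf)); rewrite subr0.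
by apply: ler_pM => //; rewrite (@J_split _ x 0 H)// ?x0// lerDl.
Qed.

(** Integrate the approximation of the derivative, fix the constant at 0, and apply the mean value
    theorem to the difference. *)
Lemma taylor_step H (z0 z1 : R -> R) W (K : R) : 0 <= H ->
  (forall x, is_derive x 1 z0 (z1 x)) ->
  (forall x, 0 <= x <= H -> `|z1 x - W.[x]| <= K) ->
  exists V : {poly R}, [/\ (size V <= (size W).+1)%N, V^`() = W &
    forall x, 0 <= x <= H -> `|z0 x - V.[x]| <= H * K].
Proof.
move=> H0 dz hW.
pose V := antideriv W + (z0 0 - (antideriv W).[0])%:P.
have VW : V^`() = W by rewrite derivD derivC addr0 antiderivK.
exists V; split => //.
  apply: size_le_addp; first exact: size_antideriv.
  by rewrite (leq_trans (size_polyC_leq1 _)).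
move=> x /andP[x0 xH].
have d (t : R) : is_derive t 1 (fun s => z0 s - V.[s]) (z1 t - W.[t]).
  by rewrite -VW; exact: (dvB (dz t) (is_derive_poly V t)).
have ct := derive_continuous d.
have [c c01 e] := @MVT_segment R _ (fun t => z1 t - W.[t]) 0 x x0 (fun t _ => d t) (continuous_subspaceT ct).
move: c01; rewrite in_itv /= => /andP[c0 cx].
have V0 : z0 0 - V.[0] = 0 by rewrite hornerD hornerC; ring.
move: e; rewrite V0 !subr0 => ->; rewrite normrM (ger0_norm x0) mulrC.
by apply: ler_pM => //; apply: hW; rewrite c0 (le_trans cx).
Qed.

(** The remainder is kept in L2 form because the final bounds are integrals of squared
    derivatives. *)
Lemma taylor_poly H m z : 0 <= H -> jets z ->
  exists W : {poly R}, (size W <= m.+1)%N /\ forall x, 0 <= x <= H ->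
    `|z 0%N x - W.[x]| <= H ^+ m * Num.sqrt (H * J 0 H (fun t => z m.+1 t ^+ 2)).
Proof.
move=> H0; elim: m z => [|m ih] z jz.
  exists (z 0%N 0)%:P; split; first exact: size_polyC_leq1.
  move=> x /andP[x0 xH]; rewrite hornerC expr0 mul1r.
  rewrite -(J_FTC x0 (jets_ct (m := 1) jz) (fun t _ => jz 0%N t)).
  by apply: J_sqr_prefix; rewrite ?x0//; exact: jets_ct.
have [W [sW hW]] := ih _ (jetsS jz).
have [V [sV _ hV]] := taylor_step H0 (jz 0%N) hW.
by exists V; split; [exact: leq_trans sV _|move=> x xH; rewrite exprS -mulrA; exact: hV].
Qed.

(** The first derivative is approximated as well, since the interface terms contain the average of
    [z 1] next to that of [z 0]. *)
Lemma taylor_poly2 H m z : 0 <= H -> jets z ->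
  exists W : {poly R}, (size W <= m.+2)%N /\ forall x, 0 <= x <= H ->
    `|z 0%N x - W.[x]| <= H ^+ m.+1 * Num.sqrt (H * J 0 H (fun t => z m.+2 t ^+ 2)) /\
    `|z 1%N x - W^`().[x]| <= H ^+ m * Num.sqrt (H * J 0 H (fun t => z m.+2 t ^+ 2)).
Proof.
move=> H0 jz; have [W [sW hW]] := taylor_poly m H0 (jetsS jz).
have [V [sV VW hV]] := taylor_step H0 (jz 0%N) hW.
exists V; split; first exact: leq_trans sV _.
by move=> x xH; rewrite exprS -mulrA VW; split; [exact: hV|exact: hW].
Qed.

End TaylorApproximation.

(** * Interpolation error and residual on one pair of reference cells *)

Section InterpolationEstimates.
Variables (R : realType) (k : nat) (s : 'I_k.+3 -> R) (lam : 'I_k.+3 -> {poly R}).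
Hypothesis k0 : (0 < k)%N.
Hypothesis ref : reference_interpolation s lam.
Implicit Types (p q V W : {poly R}) (x : R) (z : nat -> R -> R) (f g : R -> R).
Local Notation interp := (interp s lam).

Lemma interpB f g : interp (fun t => f t - g t) = interp f - interp g.
Proof. by rewrite /interp -sumrB; apply: eq_bigr => i _; rewrite scalerBl. Qed.

Lemma interpD f g : interp (fun t => f t + g t) = interp f + interp g.
Proof. by rewrite /interp -big_split; apply: eq_bigr => i _; rewrite scalerDl. Qed.

Lemma interp_bound : exists K : R, 0 <= K /\ forall f D, 0 <= D ->
  (forall i, `|f (s i)| <= D) -> forall x, 0 <= x <= 1 ->
  `|(interp f).[x]| <= K * D /\ `|(interp f)^`().[x]| <= K * D.
Proof.
have [K1 HK1] := choice (fun i => horner_bound (lam i)).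
have [K2 HK2] := choice (fun i => horner_bound (lam i)^`()).
have k1 i : 0 <= K1 i by have [] := HK1 i.
have k2 i : 0 <= K2 i by have [] := HK2 i.
exists (\sum_i (K1 i + K2 i)); split; first by apply: sumr_ge0 => i _; exact: addr_ge0.
move=> f D D0 hf x x01; rewrite mulr_suml; split.
  rewrite horner_sum; apply: (le_trans (ler_norm_sum _ _ _)); apply: ler_sum => i _.
  rewrite hornerZ normrM mulrC; apply: ler_pM => //.
  by have [_ /(_ x x01) h] := HK1 i; rewrite (le_trans h)// lerDl.
rewrite (big_morph _ (@derivD R) (@deriv0 R)) horner_sum; apply: (le_trans (ler_norm_sum _ _ _)); apply: ler_sum => i _.
rewrite /= derivZ hornerZ normrM mulrC; apply: ler_pM => //.
by have [_ /(_ x x01) h] := HK2 i; rewrite (le_trans h)// lerDr.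
Qed.

(** The Taylor polynomial of degree m is reproduced, and the rest is stable in the maximum norm.
    Orders [m] below k are needed for the mixed term of the tensor-product error. *)
Lemma interp_error : exists C : R, 0 <= C /\ forall m z, (m <= k)%N -> jets z ->
  forall x, 0 <= x <= 1 ->
  (z 0%N x - (interp (z 0%N)).[x]) ^+ 2 <= C * J 0 1 (fun t => z m.+1 t ^+ 2).
Proof.
have [K [K0 HK]] := interp_bound.
exists ((1 + K) ^+ 2); split; first exact: sqr_ge0.
move=> m z mk jz x x01; have [W [sW hW]] := taylor_poly m ler01 jz.
set I := J 0 1 _ in hW *; have I0 : 0 <= I by apply: J_ge0 => t _; exact: sqr_ge0.
set B := Num.sqrt I; have B0 : 0 <= B by exact: sqrtr_ge0.
have {}hW y : 0 <= y <= 1 -> `|z 0%N y - W.[y]| <= B.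
  by move=> /hW; rewrite expr1n mul1r mul1r.
have e : interp (z 0%N) = interp (fun t => z 0%N t - W.[t]) + W.
  by rewrite interpB (ref_exact ref) ?subrK// (leq_trans sW).
have [h _] := HK (fun t => z 0%N t - W.[t]) B B0 (fun i => hW _ (ref_node ref i)) x x01.
have := hW x x01 => h'.
have : `|z 0%N x - (interp (z 0%N)).[x]| <= (1 + K) * B.
  rewrite e hornerD mulrDl mul1r opprD addrCA addrC.
  rewrite (_ : _ + _ = (z 0%N x - W.[x]) - (interp (fun t => z 0%N t - W.[t])).[x]); last by ring.
  by apply: (le_trans (ler_normB _ _)); exact: lerD.
have CB0 : 0 <= (1 + K) * B by rewrite mulr_ge0// addr_ge0.
rewrite -(@ler_pXn2r _ 2) ?nnegrE// real_normK ?num_real// => /le_trans; apply.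
by rewrite exprMn sqr_sqrtr.
Qed.

(** What remains of the form after two integrations by parts. For polynomial z of degree k + 2 the
    three terms vanish by [ref_orth], [ref_avg] and [ref_avg'] respectively. *)
Definition cell_residual z V0 V1 : R :=
  let Z0 := interp (z 0%N) in let Z1 := interp (fun t => z 0%N (1 + t)) in
  - J 0 1 (fun x => (Z0.[x] - z 0%N x) * V0^`()^`().[x])
  - (Z0.[1] + Z1.[0] - 2 * z 0%N 1) / 2 * (V1^`().[0] - V0^`().[1])
  + (Z0^`().[1] + Z1^`().[0] - 2 * z 1%N 1) / 2 * (V1.[0] - V0.[1]).

(** A polynomial W of degree m + 1 <= k + 2 may be subtracted from z without changing the residual.
    Taylor expansion on [0, 2], which covers both cells, makes the difference small, and inverse
    inequalities bound the factors with V. *)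
Lemma cell_residual_bound : exists C : R, 0 <= C /\ forall m z V0 V1 (e : R),
  (m <= k.+1)%N -> jets z -> (size V0 <= k.+1)%N -> (size V1 <= k.+1)%N -> 0 < e ->
  cell_residual z V0 V1 <= C / e * J 0 2 (fun t => z m.+2 t ^+ 2)
    + e * (Int (V0 ^+ 2) + Int (V1 ^+ 2)).
Proof.
have [K [K0 HK]] := interp_bound.
have [Ci [Ci0 HCi]] := @inverse_inequality R k.+1.
(* five products, each split by Young's inequality with weight [d] *)
pose c := 3 * Ci + 1; have c0 : 0 < c by rewrite /c; lra.
(* The factor 5 counts the products, (K + 1) 2^(k+3) bounds interpolant plus function by the Taylor
   remainder [B] on an interval of length 2, the factor 2 is that of [B ^+ 2 = 2 * I], and [c] comes
   from the weight [e / c]. *)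
exists (5 * ((K + 1) * 2 ^+ k.+3) ^+ 2 * 2 * c); split.
  apply: mulr_ge0 (ltW c0); apply: mulr_ge0 => //.
  by apply: mulr_ge0 => //; exact: sqr_ge0.
move=> m z V0 V1 e mk jz sV0 sV1 e0.
have [W [sW hW]] := taylor_poly2 m (ler0n R 2) jz.
set I := J 0 2 _ in hW *; have I0 : 0 <= I by apply: J_ge0 => t _; exact: sqr_ge0.
set B := Num.sqrt (2 * I); have B0 : 0 <= B by exact: sqrtr_ge0.
have BE : B ^+ 2 = 2 * I by rewrite sqr_sqrtr// mulr_ge0.
pose D := 2 ^+ k.+3 * B; have D0 : 0 <= D by rewrite mulr_ge0// exprn_ge0.
have pw i : (i <= k.+3)%N -> 2 ^+ i * B <= D.
  by move=> ik; rewrite ler_wpM2r// ler_weXn2l// ler1n.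
pose g0 t := z 0%N t - W.[t]; pose g1 t := z 1%N t - W^`().[t].
have hg0 y : 0 <= y <= 2 -> `|g0 y| <= D.
  by move=> /hW[h _]; apply: (le_trans h); apply: pw; lia.
have hg1 y : 0 <= y <= 2 -> `|g1 y| <= D.
  by move=> /hW[_ h]; apply: (le_trans h); apply: pw; lia.
have sW3 : (size W <= k.+3)%N by apply: leq_trans sW _; lia.
set Z0 := interp (z 0%N); set Z1 := interp (fun t => z 0%N (1 + t)).
pose G0 := interp g0; pose G1 := interp (fun t => g0 (1 + t)).
pose W0 := interp (horner W); pose W1 := interp (fun t => W.[1 + t]).
have Z0E : Z0 = G0 + W0 by rewrite /G0 /g0 interpB subrK.
have Z1E : Z1 = G1 + W1 by rewrite /G1 /g0 (interpB (fun t => z 0%N (1 + t))) subrK.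
have n0 i : `|g0 (s i)| <= D.
  by have /andP[a b] := ref_node ref i; apply: hg0; rewrite a (le_trans b)// ler1n.
have n1 i : `|g0 (1 + s i)| <= D.
  by have /andP[a b] := ref_node ref i; apply: hg0; apply/andP; split; lra.
pose A := (K + 1) * D; have A0 : 0 <= A by rewrite mulr_ge0// addr_ge0.
have DA : D <= A by rewrite /A mulrDl mul1r lerDr mulr_ge0.
have KA : K * D + D <= A by rewrite /A mulrDl mul1r.
have G0b x (hx : 0 <= x <= 1) : `|G0.[x]| <= K * D /\ `|G0^`().[x]| <= K * D by exact: HK.
have G1b x (hx : 0 <= x <= 1) : `|G1.[x]| <= K * D /\ `|G1^`().[x]| <= K * D by exact: HK.
have i00 : 0 <= (0 : R) <= 1 by apply/andP; split; lra.
have i11 : 0 <= (1 : R) <= 1 by apply/andP; split; lra.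
have i12 : 0 <= (1 : R) <= 2 by apply/andP; split; lra.
set I0' := Int (V0 ^+ 2); set I1' := Int (V1 ^+ 2).
have I00 : 0 <= I0' by exact: Int_sq_ge0.
have I10 : 0 <= I1' by exact: Int_sq_ge0.
(* [V0] occurs in three of the five products and [V1] in two, whence [3 * Ci] in [c]; the summand 1
   keeps [c] positive. *)
pose d := e / c; have d0 : 0 < d by rewrite divr_gt0.
have yg a b (y : R) : `|a| <= A -> b ^+ 2 <= Ci * y -> a * b <= A ^+ 2 / d + d * Ci * y.
  move=> ha hb; apply: (le_trans (young a b d0)); apply: lerD.
    rewrite ler_pM2r ?invr_gt0// -(@real_normK _ a) ?num_real//.
    by rewrite lerXn2r ?nnegrE.
  by rewrite -mulrA ler_pM2l.
have t1 : - J 0 1 (fun x => (Z0.[x] - z 0%N x) * V0^`()^`().[x]) <= A ^+ 2 / d + d * Ci * I0'.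
  have cz := jets_ct (m := 0) jz.
  have cg : continuous (fun x => G0.[x] - g0 x).
    by apply: ctB; [exact: cp|apply: ctB => //; exact: cp].
  (* V0'' has degree at most k - 2, so the error of [W] is orthogonal to it and [z] may be replaced
     by [g0]. *)
  have -> : J 0 1 (fun x => (Z0.[x] - z 0%N x) * V0^`()^`().[x]) =
            J 0 1 (fun x => (G0.[x] - g0 x) * V0^`()^`().[x]).
    have o : J 0 1 (fun x => ((W0 - W) * V0^`()^`()).[x]) = 0.
      apply: (ref_orth ref sW3).
      have [->|p0] := eqVneq V0 0; first by rewrite !deriv0 size_poly0.
      have [p'0|p'0] := eqVneq V0^`() 0; first by rewrite p'0 deriv0 size_poly0.
      have h1 := lt_size_deriv p0; have h2 := lt_size_deriv p'0.
      move: h1 h2 sV0; move: (size V0) (size V0^`()) (size V0^`()^`()) => a b a'; clear -k0; lia.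
    transitivity (J 0 1 (fun x => (G0.[x] - g0 x) * V0^`()^`().[x]) +
      J 0 1 (fun x => ((W0 - W) * V0^`()^`()).[x])); last by rewrite o addr0.
    rewrite -JD; [|by apply: ctM => //; exact: cp|exact: cp].
    by apply: eq_J => x _; rewrite Z0E hornerM !hornerD hornerN /g0; ring.
  rewrite -JN; last by apply: ctM => //; exact: cp.
  rewrite -[leRHS]mulr1 -[X in _ * X](subr0 1) -(J_cst _ ler01).
  apply: le_J; [apply: ctN; apply: ctM => //; exact: cp|exact: ct_cst|].
  move=> x x01; rewrite -mulNr; apply: yg; last by have [] := HCi _ sV0 x x01.
  rewrite normrN; apply: (le_trans (ler_normB _ _)); apply: le_trans KA; apply: lerD.
    by have [] := G0b x x01.
  by apply: hg0; move: x01 => /andP[? ?]; apply/andP; split; lra.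
have avg1 : `|(Z0.[1] + Z1.[0] - 2 * z 0%N 1) / 2| <= A.
  have -> : (Z0.[1] + Z1.[0] - 2 * z 0%N 1) / 2 = (G0.[1] + G1.[0]) / 2 - g0 1.
    have := ref_avg ref sW3; rewrite -/W0 -/W1 /g0 Z0E Z1E !hornerD => h.
    by rewrite (_ : W.[1] = (W0.[1] + W1.[0]) / 2); [field|rewrite h; field].
  have [a1 _] := G0b 1 i11; have [a2 _] := G1b 0 i00.
  apply: (le_trans (ler_normB _ _)); apply: le_trans KA; apply: lerD; last exact: hg0.
  rewrite normrM (@ger0_norm _ 2^-1) ?invr_ge0// ler_pdivrMr//.
  by apply: (le_trans (ler_normD _ _)); lra.
have avg2 : `|(Z0^`().[1] + Z1^`().[0] - 2 * z 1%N 1) / 2| <= A.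
  have -> : (Z0^`().[1] + Z1^`().[0] - 2 * z 1%N 1) / 2 = (G0^`().[1] + G1^`().[0]) / 2 - g1 1.
    have := ref_avg' ref sW3; rewrite -/W0 -/W1 /g1 Z0E Z1E !derivD !hornerD => h.
    by rewrite (_ : W^`().[1] = (W0^`().[1] + W1^`().[0]) / 2); [field|rewrite h; field].
  have [_ a1] := G0b 1 i11; have [_ a2] := G1b 0 i00.
  apply: (le_trans (ler_normB _ _)); apply: le_trans KA; apply: lerD; last exact: hg1.
  rewrite normrM (@ger0_norm _ 2^-1) ?invr_ge0// ler_pdivrMr//.
  by apply: (le_trans (ler_normD _ _)); lra.
rewrite /cell_residual -/Z0 -/Z1.
set a1 := (_ / 2) in avg1 *; set a2 := (_ / 2) in avg2 *.
have [v1 v2 _] := HCi _ sV0 1 i11; have [v3 v4 _] := HCi _ sV1 0 i00.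
have t2 : - a1 * V1^`().[0] <= A ^+ 2 / d + d * Ci * I1' by apply: yg; rewrite ?normrN.
have t3 : a1 * V0^`().[1] <= A ^+ 2 / d + d * Ci * I0' by apply: yg.
have t4 : a2 * V1.[0] <= A ^+ 2 / d + d * Ci * I1' by apply: yg.
have t5 : - a2 * V0.[1] <= A ^+ 2 / d + d * Ci * I0' by apply: yg; rewrite ?normrN.
have AE : 5 * (A ^+ 2 / d) = 5 * ((K + 1) * 2 ^+ k.+3) ^+ 2 * 2 * c / e * I.
  have -> : A ^+ 2 = ((K + 1) * 2 ^+ k.+3) ^+ 2 * (2 * I).
    by rewrite -BE -exprMn /A /D mulrA.
  by rewrite /d; field; rewrite !gt_eqF.
rewrite -AE.
have dc : d * Ci * 3 <= e.
  rewrite /d -mulrA -[leRHS]mulr1 -mulrA ler_pM2l// mulrC ler_pdivrMr// mul1r /c; lra.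
have e1 : d * Ci * 3 * (I0' + I1') <= e * (I0' + I1') by rewrite ler_wpM2r ?addr_ge0.
have e2 : 0 <= d * Ci * I1' by apply: mulr_ge0 => //; apply: mulr_ge0 => //; exact: ltW.
apply: le_trans (lerD (lexx _) e1).
set A5 := A ^+ 2 / d in t1 t2 t3 t4 t5 *; set dC := d * Ci in t1 t2 t3 t4 t5 e2 *.
set j := J 0 1 _ in t1 *.
rewrite (_ : _ + _ = - j + - a1 * V1^`().[0] + a1 * V0^`().[1] + a2 * V1.[0] + - a2 * V0.[1]); last by ring.
lra.
Qed.

End InterpolationEstimates.

Section PeriodicResidual.
Variables (R : realType) (k : nat) (s : 'I_k.+3 -> R) (lam : 'I_k.+3 -> {poly R}).
Hypothesis k0 : (0 < k)%N.
Hypothesis ref : reference_interpolation s lam.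
Implicit Types (p q V W : {poly R}) (x : R) (f g : R -> R).
Local Notation interp := (interp s lam).

Lemma sum_ordS N (F : 'I_N -> R) : \sum_i F (ordS i) = \sum_i F i.
Proof. by rewrite [RHS](reindex (@ordS N))//; exact: onW_bij (@ordS_bij N). Qed.

(** The share of one cell and of its right interface in the one-dimensional form plus the product of
    z'' with V, in reference coordinates. *)
Definition bilinear_residual (Z0 Z1 V0 V1 : {poly R}) (z2 : R -> R) : R :=
  J 0 1 (fun x => Z0^`().[x] * V0^`().[x])
  + ((Z0^`().[1] + Z1^`().[0]) / 2 * (V1.[0] - V0.[1])
     + (V0^`().[1] + V1^`().[0]) / 2 * (Z1.[0] - Z0.[1]))
  + J 0 1 (fun x => z2 x * V0.[x]).

Lemma Int_parts p q : J 0 1 (fun x => p^`().[x] * q.[x]) =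
  p.[1] * q.[1] - p.[0] * q.[0] - J 0 1 (fun x => p.[x] * q^`().[x]).
Proof. by apply: J_parts => //; exact: cp. Qed.

(* Summing by parts moves all derivatives off the interpolation error; the
   boundary contributions of neighbouring cells are regrouped at interfaces. *)
Lemma periodic_residualE N (z : 'I_N -> nat -> R -> R) (V : 'I_N -> {poly R}) :
  (forall i, jets (z i)) -> (forall i m t, z (ordS i) m t = z i m (1 + t)) ->
  \sum_i bilinear_residual (interp (z i 0%N)) (interp (z (ordS i) 0%N))
    (V i) (V (ordS i)) (z i 2%N)
  = \sum_i cell_residual s lam (z i) (V i) (V (ordS i)).
Proof.
move=> jz link.
(* [- F i] is the sum of the left-end terms produced by integrating by parts on cell i. Adding [F i]
   and subtracting [F (ordS i)] moves them to the interface with the preceding cell, at no cost by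
   periodicity. *)
pose F i := (interp (z i 0%N)).[0] * (V i)^`().[0] + z i 1%N 0 * (V i).[0] - z i 0%N 0 * (V i)^`().[0].
have : \sum_i F i = \sum_i F (ordS i) by rewrite sum_ordS.
move/eqP; rewrite -subr_eq0 => /eqP F0.
transitivity (\sum_i bilinear_residual (interp (z i 0%N)) (interp (z (ordS i) 0%N))
    (V i) (V (ordS i)) (z i 2%N) + (\sum_i F i - \sum_i F (ordS i))).
  by rewrite F0 addr0.
rewrite -sumrB -big_split; apply: eq_bigr => i _ /=.
rewrite /cell_residual /bilinear_residual.
rewrite (_ : (fun t => z i 0%N (1 + t)) = z (ordS i) 0%N); last by apply/funext => t; rewrite link.
rewrite /F !link addr0; set Z0 := interp (z i 0%N); set Z1 := interp (z (ordS i) 0%N).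
set V0 := V i; set V1 := V (ordS i).
have jzi := jz i.
have c0 := jets_ct (m := 0) jzi; have c1 := jets_ct (m := 1) jzi.
have c2 := jets_ct (m := 2) jzi.
have h1 : J 0 1 (fun x => Z0^`().[x] * V0^`().[x]) =
   Z0.[1] * V0^`().[1] - Z0.[0] * V0^`().[0] - J 0 1 (fun x => Z0.[x] * V0^`()^`().[x]).
  exact: Int_parts.
have h2 : J 0 1 (fun x => z i 2%N x * V0.[x]) = z i 1%N 1 * V0.[1] - z i 1%N 0 * V0.[0]
    - J 0 1 (fun x => z i 1%N x * V0^`().[x]).
  exact: (J_parts ler01 (jzi 1%N) (is_derive_poly V0) c2 (@cp R _)).
have h3 : J 0 1 (fun x => z i 1%N x * V0^`().[x]) = z i 0%N 1 * V0^`().[1] - z i 0%N 0 * V0^`().[0]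
    - J 0 1 (fun x => z i 0%N x * V0^`()^`().[x]).
  exact: (J_parts ler01 (jzi 0%N) (is_derive_poly V0^`()) c1 (@cp R _)).
have h4 : J 0 1 (fun x => (Z0.[x] - z i 0%N x) * V0^`()^`().[x]) =
   J 0 1 (fun x => Z0.[x] * V0^`()^`().[x]) - J 0 1 (fun x => z i 0%N x * V0^`()^`().[x]).
  rewrite -JB; [|by apply: ctM => //; exact: cp..].
  by apply: eq_J => x _; rewrite mulrBl.
by rewrite h1 h2 h3 h4; field.
Qed.

(** The order [m] is left free: m = k + 1 serves the exact function, m = 0 the interpolation error
    in the other variable, which is already small. *)
Lemma periodic_residual_bound : exists C : R, 0 <= C /\
  forall N (z : 'I_N -> nat -> R -> R) (V : 'I_N -> {poly R}) m (e : R),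
  (forall i, jets (z i)) -> (forall i m t, z (ordS i) m t = z i m (1 + t)) ->
  (forall i, (size (V i) <= k.+1)%N) -> (m <= k.+1)%N -> 0 < e ->
  \sum_i bilinear_residual (interp (z i 0%N)) (interp (z (ordS i) 0%N))
    (V i) (V (ordS i)) (z i 2%N)
  <= C / e * \sum_i J 0 1 (fun t => z i m.+2 t ^+ 2) + e * \sum_i Int (V i ^+ 2).
Proof.
have [C [C0 HC]] := cell_residual_bound k0 ref.
(* Every V lies in two pairs of cells, hence the weight e/2 and a factor 2; every cell is also
   covered by two intervals of length 2, hence the other factor 2. *)
exists (C * 4); split; first by rewrite mulr_ge0.
move=> N z V m e jz link sV mk e0; rewrite periodic_residualE//.
have e20 : 0 < e / 2 by rewrite divr_gt0.
apply: (le_trans (ler_sum _ (fun i _ => HC m (z i) _ _ _ mk (jz i) (sV i) (sV (ordS i)) e20))).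
rewrite big_split /= -!mulr_sumr big_split /= (sum_ordS (fun i => Int (V i ^+ 2))).
have -> : \sum_i J 0 2 (fun t => z i m.+2 t ^+ 2) = 2 * \sum_i J 0 1 (fun t => z i m.+2 t ^+ 2).
  have -> : \sum_i J 0 2 (fun t => z i m.+2 t ^+ 2) =
     \sum_i (J 0 1 (fun t => z i m.+2 t ^+ 2) + J 0 1 (fun t => z (ordS i) m.+2 t ^+ 2)).
    apply: eq_bigr => i _; have cz := jets_ct (m := m.+2) (jz i).
    rewrite (@J_split _ 1)//; [|exact: ctX|by apply/andP; split; lra].
    congr (_ + _); have := @J_affine R 1 1 0 1 (fun t => z i m.+2 t ^+ 2) ltr01 ler01 (ctX (n:=2) cz).
    rewrite mulr0 addr0 mulr1 mul1r => ->.
    by apply: eq_J => t _; rewrite mul1r link.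
  by rewrite big_split /= (sum_ordS (fun i => J 0 1 (fun t => z i m.+2 t ^+ 2))); ring.
by rewrite le_eqVlt; apply/orP; left; apply/eqP; field; rewrite gt_eqF.
Qed.

End PeriodicResidual.

(** * Smooth functions on the torus *)

(* Locked: unification must never unfold a derivative. *)
HB.lock Definition Dx (R : realType) (v : R -> R -> R) : R -> R -> R := dx v.
HB.lock Definition Dy (R : realType) (v : R -> R -> R) : R -> R -> R := dy v.

Definition Lap (R : realType) (v : R -> R -> R) : R -> R -> R :=
  fun x y => Dx (Dx v) x y + Dy (Dy v) x y.

Lemma LapE (R : realType) : @Lap R = @lap R.
Proof. by rewrite /Lap Dx.unlock Dy.unlock. Qed.

Section SmoothPlaneFunctions.
Variable R : realType.
Implicit Types (f g : R -> R -> R) (a b c d x y : R).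

(** The recursion descends through both first derivatives, so that no order of mixed derivatives is
    preferred; that they agree is [schwarz]. *)
Fixpoint Cn n f : Prop := ct2 f /\
  if n is m.+1 then
    [/\ forall x y, derivable (f ^~ y) x 1, forall x y, derivable (f x) y 1,
        Cn m (Dx f) & Cn m (Dy f)]
  else True.

Definition smooth2 f := forall n, Cn n f.

Lemma dxE f x y : Dx f x y = derive1 (f ^~ y) x.
Proof. by rewrite Dx.unlock. Qed.

Lemma dyE f x y : Dy f x y = derive1 (f x) y.
Proof. by rewrite Dy.unlock. Qed.

Lemma smooth2_ct f : smooth2 f -> ct2 f.
Proof. by move=> /(_ 0%N)[]. Qed.

Lemma smooth2_dx f : smooth2 f -> smooth2 (Dx f).
Proof. by move=> sf n; have [_ []] := sf n.+1. Qed.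

Lemma smooth2_dy f : smooth2 f -> smooth2 (Dy f).
Proof. by move=> sf n; have [_ []] := sf n.+1. Qed.

Lemma smooth2_is_dx f x y : smooth2 f -> is_derive x 1 (f ^~ y) (Dx f x y).
Proof.
move=> /(_ 1%N)[_ [/(_ x y) d _ _ _]]; apply: DeriveDef => //.
by rewrite dxE derive1E.
Qed.

Lemma smooth2_is_dy f x y : smooth2 f -> is_derive y 1 (f x) (Dy f x y).
Proof.
move=> /(_ 1%N)[_ [_ /(_ x y) d _ _]]; apply: DeriveDef => //.
by rewrite dyE derive1E.
Qed.

Lemma is_derive_derive1 (h : R -> R) x (v : R) : is_derive x 1 h v -> derive1 h x = v.
Proof. by move=> [_ e]; rewrite derive1E. Qed.

Definition tr f : R -> R -> R := fun y x => f x y.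

Lemma dx_tr f : Dx (tr f) = tr (Dy f).
Proof. by rewrite Dx.unlock Dy.unlock. Qed.

Lemma dy_tr f : Dy (tr f) = tr (Dx f).
Proof. by rewrite Dx.unlock Dy.unlock. Qed.

Lemma Cn_tr n f : Cn n f -> Cn n (tr f).
Proof.
elim: n f => [|n ih] f [cf h]; split; try exact: ct2_swap; try exact: I.
case: h => h1 h2 h3 h4; split.
- by move=> x y; exact: h2.
- by move=> x y; exact: h1.
- by rewrite dx_tr; exact: ih.
- by rewrite dy_tr; exact: ih.
Qed.

Lemma smooth2_tr f : smooth2 f -> smooth2 (tr f).
Proof. by move=> sf n; exact: Cn_tr. Qed.

Lemma dxD f g : smooth2 f -> smooth2 g -> Dx (fun x y => f x y + g x y) =
  (fun x y => Dx f x y + Dx g x y).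
Proof.
move=> sf sg; apply/funext => x; apply/funext => y.
by rewrite dxE; apply: is_derive_derive1; apply: dvD; exact: smooth2_is_dx.
Qed.

Lemma dyD f g : smooth2 f -> smooth2 g -> Dy (fun x y => f x y + g x y) =
  (fun x y => Dy f x y + Dy g x y).
Proof.
move=> sf sg; apply/funext => x; apply/funext => y.
by rewrite dyE; apply: is_derive_derive1; apply: dvD; exact: smooth2_is_dy.
Qed.

Lemma dxZ k f : smooth2 f -> Dx (fun x y => k * f x y) = (fun x y => k * Dx f x y).
Proof.
move=> sf; apply/funext => x; apply/funext => y.
by rewrite dxE; apply: is_derive_derive1; apply: dvZ; exact: smooth2_is_dx.
Qed.

Lemma dyZ k f : smooth2 f -> Dy (fun x y => k * f x y) = (fun x y => k * Dy f x y).
Proof.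
move=> sf; apply/funext => x; apply/funext => y.
by rewrite dyE; apply: is_derive_derive1; apply: dvZ; exact: smooth2_is_dy.
Qed.

Lemma smooth2D f g : smooth2 f -> smooth2 g -> smooth2 (fun x y => f x y + g x y).
Proof.
move=> sf sg n; elim: n f g sf sg => [|n ih] f g sf sg; split => //.
- by apply: ctD; exact: smooth2_ct.
- by apply: ctD; exact: smooth2_ct.
- split.
  + by move=> x y; have [] := dvD (smooth2_is_dx x y sf) (smooth2_is_dx x y sg).
  + by move=> x y; have [] := dvD (smooth2_is_dy x y sf) (smooth2_is_dy x y sg).
  + by rewrite dxD//; apply: ih; exact: smooth2_dx.
  + by rewrite dyD//; apply: ih; exact: smooth2_dy.
Qed.

Lemma smooth2Z k f : smooth2 f -> smooth2 (fun x y => k * f x y).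
Proof.
move=> sf n; elim: n f sf => [|n ih] f sf; split => //.
- by apply: ctZ; exact: smooth2_ct.
- by apply: ctZ; exact: smooth2_ct.
- split.
  + by move=> x y; have [] := dvZ k (smooth2_is_dx x y sf).
  + by move=> x y; have [] := dvZ k (smooth2_is_dy x y sf).
  + by rewrite dxZ//; apply: ih; exact: smooth2_dx.
  + by rewrite dyZ//; apply: ih; exact: smooth2_dy.
Qed.

Lemma smooth2_iterdx m f : smooth2 f -> smooth2 (iter m (@Dx R) f).
Proof. by move=> sf; elim: m => //= m ih; exact: smooth2_dx. Qed.

Lemma smooth2_iterdy m f : smooth2 f -> smooth2 (iter m (@Dy R) f).
Proof. by move=> sf; elim: m => //= m ih; exact: smooth2_dy. Qed.

Lemma smooth2_lap f : smooth2 f -> smooth2 (Lap f).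
Proof. by move=> sf; apply: smooth2D; [exact/smooth2_dx/smooth2_dx|exact/smooth2_dy/smooth2_dy]. Qed.

Lemma J_empty a b (h : R -> R) : b < a -> J a b h = 0.
Proof. by move=> ba; rewrite J.unlock set_itv_ge ?Rintegral_set0// bnd_simp -ltNge. Qed.

(** Differentiate the integral with respect to its upper end. *)
Lemma J_eq0 (h : R -> R) : continuous h -> (forall a b, a <= b -> J a b h = 0) ->
  forall x, h x = 0.
Proof.
move=> ch h0 x.
have x1 : x < x + 1 by rewrite ltrDl.
have x2 : x - 1 < x by rewrite ltrBlDr ltrDl.
have [_] := continuous_FTC1_closed x1 (@continuous_integrable R (x - 1) _ _ ch) x2 (ch x).
move=> <-; apply: is_derive_derive1.
rewrite (_ : (fun _ => _) = (fun=> 0)); first exact: dv_cst.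
apply/funext => t; have [le|lt] := leP (x - 1) t.
  by have := h0 _ _ le; rewrite J.unlock.
by have := J_empty h lt; rewrite J.unlock.
Qed.

(** By Fubini and the fundamental theorem both mixed derivatives have the same integral over every
    rectangle, namely the alternating sum of f at the corners; continuity then gives equality at
    every point. *)
Lemma schwarz f : smooth2 f -> Dx (Dy f) = Dy (Dx f).
Proof.
move=> sf.
have sxy := smooth2_dx (smooth2_dy sf); have syx := smooth2_dy (smooth2_dx sf).
have cxy := smooth2_ct sxy; have cyx := smooth2_ct syx.
pose g x y := Dx (Dy f) x y - Dy (Dx f) x y.
have cg : ct2 g := ctB cxy cyx.
have FTCx (h : R -> R -> R) a b y : smooth2 h -> a <= b -> J a b (Dx h ^~ y) = h b y - h a y.
  move=> sh ab; apply: (@J_FTC _ a b _ (h ^~ y) ab) => [|x _]; last exact: smooth2_is_dx.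
  exact/ct2_x/smooth2_ct/smooth2_dx.
have FTCy (h : R -> R -> R) c d x : smooth2 h -> c <= d -> J c d (Dy h x) = h x d - h x c.
  move=> sh cd; apply: (@J_FTC _ c d _ (h x) cd) => [|y _]; last exact: smooth2_is_dy.
  exact/ct2_y/smooth2_ct/smooth2_dy.
have g0 a b c d : a <= b -> c <= d -> J a b (fun x => J c d (g x)) = 0.
  move=> ab cd.
  have cy x : continuous (Dy f x) by exact/ct2_y/smooth2_ct/smooth2_dy.
  have cx' y : continuous (Dx f ^~ y) by exact/ct2_x/smooth2_ct/smooth2_dx.
  have e1 : J a b (fun x => J c d (Dx (Dy f) x)) = f b d - f b c - (f a d - f a c).
    rewrite J_swap//.
    rewrite (eq_J (g := fun y => Dy f b y - Dy f a y)); last first.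
      by move=> y _; exact: (FTCx (Dy f) a b y (smooth2_dy sf) ab).
    by rewrite (JB _ _ (cy b) (cy a)) !(FTCy f).
  have e2 : J a b (fun x => J c d (Dy (Dx f) x)) = f b d - f b c - (f a d - f a c).
    rewrite (eq_J (g := fun x => Dx f x d - Dx f x c)); last first.
      by move=> x _; exact: (FTCy (Dx f) c d x (smooth2_dx sf) cd).
    by rewrite (JB _ _ (cx' d) (cx' c)) !(FTCx f)//; ring.
  rewrite (eq_J (g := fun x => J c d (Dx (Dy f) x) - J c d (Dy (Dx f) x))); last first.
    by move=> x _; rewrite -(JB c d (ct2_y x cxy) (ct2_y x cyx)).
  rewrite (JB a b (ct2_J c d cxy) (ct2_J c d cyx)) [X in X - _]e1 [X in _ - X]e2.
  exact: subrr.
apply/funext => x; apply/funext => y; apply/eqP; rewrite -subr_eq0; apply/eqP.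
apply: (@J_eq0 (g x)) => [|c d cd]; first exact: ct2_y.
apply: (@J_eq0 (fun x => J c d (g x))) => [|a b ab]; first exact: ct2_J.
exact: g0.
Qed.

Lemma dx_lap f : smooth2 f -> Dx (Lap f) = Lap (Dx f).
Proof.
move=> sf; rewrite /Lap dxD; first last.
- exact/smooth2_dy/smooth2_dy.
- exact/smooth2_dx/smooth2_dx.
by rewrite (schwarz (smooth2_dy sf)) (schwarz sf).
Qed.

Lemma dy_lap f : smooth2 f -> Dy (Lap f) = Lap (Dy f).
Proof.
move=> sf; rewrite /Lap dyD; first last.
- exact/smooth2_dy/smooth2_dy.
- exact/smooth2_dx/smooth2_dx.
by rewrite -(schwarz (smooth2_dx sf)) -(schwarz sf).
Qed.

Lemma iterdx_lap m f : smooth2 f -> iter m (@Dx R) (Lap f) = Lap (iter m (@Dx R) f).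
Proof.
by move=> sf; elim: m => //= m ->; rewrite dx_lap//; exact: smooth2_iterdx.
Qed.

Lemma iterdy_lap m f : smooth2 f -> iter m (@Dy R) (Lap f) = Lap (iter m (@Dy R) f).
Proof.
by move=> sf; elim: m => //= m ->; rewrite dy_lap//; exact: smooth2_iterdy.
Qed.

Lemma dx_iterdy m f : smooth2 f -> Dx (iter m (@Dy R) f) = iter m (@Dy R) (Dx f).
Proof.
by move=> sf; elim: m => //= m <-; rewrite schwarz//; exact: smooth2_iterdy.
Qed.

Lemma iterdx_iterdy n m f : smooth2 f ->
  iter n (@Dx R) (iter m (@Dy R) f) = iter m (@Dy R) (iter n (@Dx R) f).
Proof.
by move=> sf; elim: n => //= n ->; rewrite dx_iterdy//; exact: smooth2_iterdx.
Qed.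

End SmoothPlaneFunctions.


(** * Energy identity for the Laplacian and Poincaré inequality for periodic functions *)

Section PeriodicEnergy.
Variables (R : realType) (a b c d : R).
Hypotheses (ab : a < b) (cd : c < d).
Implicit Types (f g : R -> R -> R).

Definition JJ f : R := J a b (fun x => J c d (f x)).

Definition Nsq f : R := JJ (fun x y => f x y ^+ 2).

Definition periodic2 f := forall x y, f (x + (b - a)) y = f x y /\ f x (y + (d - c)) = f x y.

Lemma ct2D f g : ct2 f -> ct2 g -> ct2 (fun x y => f x y + g x y).
Proof. by move=> cf cg; exact: (ctD cf cg). Qed.

Lemma ct2M f g : ct2 f -> ct2 g -> ct2 (fun x y => f x y * g x y).
Proof. by move=> cf cg; exact: (ctM cf cg). Qed.

Lemma ct2Z k f : ct2 f -> ct2 (fun x y => k * f x y).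
Proof. by move=> cf; exact: (ctZ cf). Qed.

Lemma ct2X f n : ct2 f -> ct2 (fun x y => f x y ^+ n).
Proof. by move=> cf; exact: (ctX cf). Qed.

Lemma JJD f g : ct2 f -> ct2 g -> JJ (fun x y => f x y + g x y) = JJ f + JJ g.
Proof.
move=> cf cg; rewrite /JJ -JD; [|exact: ct2_J..].
by apply: eq_J => x _; rewrite JD//; exact: ct2_y.
Qed.

Lemma JJZ k f : ct2 f -> JJ (fun x y => k * f x y) = k * JJ f.
Proof.
move=> cf; rewrite /JJ -JZ; [|exact: ct2_J].
by apply: eq_J => x _; rewrite JZ//; exact: ct2_y.
Qed.

Lemma eq_JJ f g : (forall x y, a <= x <= b -> c <= y <= d -> f x y = g x y) -> JJ f = JJ g.
Proof. by move=> fg; apply: eq_J => x xab; apply: eq_J => y ycd; exact: fg. Qed.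

Lemma JJ_ge0 f : (forall x y, a <= x <= b -> c <= y <= d -> 0 <= f x y) -> 0 <= JJ f.
Proof. by move=> f0; apply: J_ge0 => x xab; apply: J_ge0 => y ycd; exact: f0. Qed.

Lemma Nsq_ge0 f : 0 <= Nsq f.
Proof. by apply: JJ_ge0 => *; exact: sqr_ge0. Qed.

Lemma JJ_swap f : ct2 f -> JJ f = J c d (fun y => J a b (f ^~ y)).
Proof. exact: J_swap. Qed.

Lemma derive1_shift (h : R -> R) L x : (forall t, h (t + L) = h t) ->
  derivable h (x + L) 1 -> derive1 h (x + L) = derive1 h x.
Proof.
move=> hL dh; have D : is_derive (L + 1 * x) 1 h (derive1 h (x + L)).
  by rewrite mul1r addrC; apply: DeriveDef => //; rewrite derive1E.
have := is_derive_comp_affine D; rewrite mul1r.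
have -> : (fun t => h (L + 1 * t)) = h by apply/funext => t; rewrite mul1r addrC.
by move=> /is_derive_derive1.
Qed.

Lemma periodic2_dx f : smooth2 f -> periodic2 f -> periodic2 (Dx f).
Proof.
move=> sf pf x y; split.
  rewrite !dxE; apply: (@derive1_shift (f ^~ y)) => [t|]; first by have [] := pf t y.
  by have [] := smooth2_is_dx (x + (b - a)) y sf.
by rewrite !dxE; congr (derive1 _ x); apply/funext => t; have [] := pf t y.
Qed.

Lemma periodic2_dy f : smooth2 f -> periodic2 f -> periodic2 (Dy f).
Proof.
move=> sf pf x y; split.
  by rewrite !dyE; congr (derive1 _ y); apply/funext => t; have [] := pf x t.
rewrite !dyE; apply: (@derive1_shift (f x)) => [t|]; first by have [] := pf x t.
by have [] := smooth2_is_dy x (y + (d - c)) sf.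
Qed.

Lemma periodic2_iterdx m f : smooth2 f -> periodic2 f -> periodic2 (iter m (@Dx R) f).
Proof.
by move=> sf pf; elim: m => //= m; apply: periodic2_dx; exact: smooth2_iterdx.
Qed.

Lemma periodic2_iterdy m f : smooth2 f -> periodic2 f -> periodic2 (iter m (@Dy R) f).
Proof.
by move=> sf pf; elim: m => //= m; apply: periodic2_dy; exact: smooth2_iterdy.
Qed.

Lemma periodic2_xab f y : periodic2 f -> f b y = f a y.
Proof. by move=> /(_ a y)[+ _]; rewrite addrC subrK. Qed.

Lemma periodic2_ycd f x : periodic2 f -> f x d = f x c.
Proof. by move=> /(_ x c)[_]; rewrite addrC subrK. Qed.

(** One integration by parts in x and one in y; periodicity cancels the boundary terms. *)
Lemma JJ_dxx_dyy f : smooth2 f -> periodic2 f ->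
  JJ (fun x y => Dx (Dx f) x y * Dy (Dy f) x y) = Nsq (Dx (Dy f)).
Proof.
move=> sf pf.
have sx := smooth2_dx sf; have sy := smooth2_dy sf.
have sxx := smooth2_dx sx; have syy := smooth2_dy sy.
have sxyy := smooth2_dx syy.
have px := periodic2_dx sf pf; have pyy := periodic2_dy sy (periodic2_dy sf pf).
have px_y : periodic2 (Dx (Dy f)) by apply: periodic2_dx => //; exact: periodic2_dy.
have e1 : JJ (fun x y => Dx (Dx f) x y * Dy (Dy f) x y) =
          - JJ (fun x y => Dx f x y * Dy (Dx (Dy f)) x y).
  have c1 := ct2M (smooth2_ct sxx) (smooth2_ct syy).
  have c2 := ct2M (smooth2_ct sx) (smooth2_ct (smooth2_dy (smooth2_dx sy))).
  rewrite !JJ_swap// -JN; last exact: ct2_J_swap.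
  apply: eq_J => y _.
  rewrite (J_parts (ltW ab) (fun x => smooth2_is_dx x y sx) (fun x => smooth2_is_dx x y syy)).
  - by rewrite (periodic2_xab y px) (periodic2_xab y pyy) subrr sub0r schwarz.
  - exact/ct2_x/smooth2_ct.
  - exact/ct2_x/smooth2_ct.
have e2 : JJ (fun x y => Dy (Dx (Dy f)) x y * Dx f x y) = - Nsq (Dx (Dy f)).
  have s2 := smooth2_dx sy.
  rewrite /Nsq /JJ -JN; last exact/ct2_J/ct2X/smooth2_ct.
  apply: eq_J => x _.
  rewrite (J_parts (ltW cd) (fun y => smooth2_is_dy x y s2) (fun y => smooth2_is_dy x y sx)).
  - rewrite (periodic2_ycd x px) (periodic2_ycd x px_y) subrr sub0r -(schwarz sf).
    by congr (- _); apply: eq_J => y _; rewrite expr2.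
  - exact/ct2_y/smooth2_ct/smooth2_dy.
  - exact/ct2_y/smooth2_ct/smooth2_dy.
rewrite e1 -[RHS]opprK -e2; congr (- _).
by apply: eq_JJ => x y _ _; rewrite mulrC.
Qed.

(** Expanding the square, the cross term is a mixed second derivative squared. Hence every second
    derivative is bounded by the Laplacian with constant 1. *)
Lemma Nsq_lap f : smooth2 f -> periodic2 f ->
  Nsq (Lap f) = Nsq (Dx (Dx f)) + 2 * Nsq (Dx (Dy f)) + Nsq (Dy (Dy f)).
Proof.
move=> sf pf; rewrite -(JJ_dxx_dyy sf pf).
have cxx : ct2 (Dx (Dx f)) by exact/smooth2_ct/smooth2_dx/smooth2_dx.
have cyy : ct2 (Dy (Dy f)) by exact/smooth2_ct/smooth2_dy/smooth2_dy.
rewrite /Nsq -JJZ; last exact: ct2M.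
rewrite -JJD; [|exact: ct2X|exact/ct2Z/ct2M].
rewrite -JJD; [|by apply: ct2D; [exact: ct2X|exact/ct2Z/ct2M]|exact: ct2X].
by apply: eq_JJ => x y _ _; rewrite /Lap; ring.
Qed.

Lemma Nsq_dxx_le f : smooth2 f -> periodic2 f -> Nsq (Dx (Dx f)) <= Nsq (Lap f).
Proof.
move=> sf pf; rewrite Nsq_lap//.
by have := Nsq_ge0 (Dx (Dy f)); have := Nsq_ge0 (Dy (Dy f)); lra.
Qed.

Lemma Nsq_dyy_le f : smooth2 f -> periodic2 f -> Nsq (Dy (Dy f)) <= Nsq (Lap f).
Proof.
move=> sf pf; rewrite Nsq_lap//.
by have := Nsq_ge0 (Dx (Dy f)); have := Nsq_ge0 (Dx (Dx f)); lra.
Qed.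

Lemma sqr_le_J_of_zero (h h' : R -> R) (l r x0 x : R) : (forall t : R, is_derive t 1 h (h' t)) ->
  continuous h' -> l <= x0 <= r -> l <= x <= r -> h x0 = 0 ->
  h x ^+ 2 <= (r - l) * J l r (fun t => h' t ^+ 2).
Proof.
move=> dh ch'.
have main p q : p <= q -> l <= p -> q <= r ->
    (h q - h p) ^+ 2 <= (r - l) * J l r (fun t => h' t ^+ 2).
  move=> pq lp qr; rewrite -(J_FTC pq ch' (fun t _ => dh t)).
  have c2 := ctX (n := 2) ch'.
  have J0' u v : 0 <= J u v (fun t => h' t ^+ 2) by apply: J_ge0 => *; exact: sqr_ge0.
  apply: (le_trans (J_sqr_le pq ch')); apply: ler_pM; rewrite ?subr_ge0 ?lerB//.
  rewrite (@J_split _ p l r)//; last by rewrite lp (le_trans pq).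
  by rewrite (@J_split _ q p r) ?pq//; have := J0' l p; have := J0' q r; lra.
move=> /andP[l0 r0] /andP[lx xr] h0; have [le|/ltW le] := leP x0 x.
  by have := main _ _ le l0 xr; rewrite h0 subr0.
by have := main _ _ le lx r0; rewrite h0 sub0r sqrrN.
Qed.

(** A Poincaré inequality without a mean value condition: on every row f takes equal values at [a]
    and [b], so its x-derivative vanishes somewhere and is the integral of the second derivative
    from there. *)
Lemma Nsq_dx_le f : smooth2 f -> periodic2 f ->
  Nsq (Dx f) <= (b - a) ^+ 2 * Nsq (Dx (Dx f)).
Proof.
move=> sf pf.
have sx := smooth2_dx sf; have sxx := smooth2_dx sx.
have cx2 : ct2 (fun x y => Dx f x y ^+ 2) by exact/ct2X/smooth2_ct.
have cxx2 : ct2 (fun x y => Dx (Dx f) x y ^+ 2) by exact/ct2X/smooth2_ct.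
rewrite /Nsq !JJ_swap// -JZ; last exact: ct2_J_swap.
apply: le_J; [exact: ct2_J_swap|exact/ctZ/ct2_J_swap|move=> y _].
have ctf : continuous (f ^~ y) by exact/ct2_x/smooth2_ct.
have [x0 x0ab] := @MVT_segment R (f ^~ y) (Dx f ^~ y) a b (ltW ab)
   (fun x _ => smooth2_is_dx x y sf) (continuous_subspaceT ctf).
rewrite (periodic2_xab y pf) subrr => /esym/eqP.
rewrite mulf_eq0 subr_eq0 (gt_eqF ab) orbF => /eqP f0.
move: x0ab; rewrite in_itv /= => x0ab.
have h x : a <= x <= b -> Dx f x y ^+ 2 <= (b - a) * J a b (fun x => Dx (Dx f) x y ^+ 2).
  move=> xab; apply: (sqr_le_J_of_zero (fun t => smooth2_is_dx t y sx) _ x0ab xab f0).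
  exact/ct2_x/smooth2_ct.
have hle := le_J (ct2_x y cx2) (@ct_cst _ R _) h; apply: (le_trans hle).
by rewrite J_cst ?(ltW ab)// expr2; set j := J _ _ _; rewrite le_eqVlt; apply/orP; left; apply/eqP; ring.
Qed.

End PeriodicEnergy.

(** * Control of all needed seminorms by those of the Laplacian *)

Section EllipticRegularity.
Variables (R : realType) (a b c d : R).
Hypotheses (ab : a < b) (cd : c < d).
Implicit Types (f g w : R -> R -> R).

Lemma Nsq_tr f : ct2 f -> Nsq c d a b (tr f) = Nsq a b c d f.
Proof.
move=> cf; have ctr : ct2 (tr f) := ct2_swap cf.
by rewrite /Nsq (JJ_swap _ _ _ _ (ct2X (n := 2) ctr)).
Qed.

Lemma periodic2_tr f : periodic2 a b c d f -> periodic2 c d a b (tr f).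
Proof. by move=> pf y x; have [h1 h2] := pf x y; split. Qed.

Lemma Nsq_dy_le f : smooth2 f -> periodic2 a b c d f ->
  Nsq a b c d (Dy f) <= (d - c) ^+ 2 * Nsq a b c d (Dy (Dy f)).
Proof.
move=> sf pf; have := Nsq_dx_le cd (smooth2_tr sf) (periodic2_tr pf).
by rewrite !dx_tr (Nsq_tr (smooth2_ct (smooth2_dy sf))) (Nsq_tr (smooth2_ct (smooth2_dy (smooth2_dy sf)))).
Qed.

(** The three derivatives of order k + 1 in the tensor-product interpolation error; the mixed one
    stems from the product of the two one-dimensional errors. *)
Definition approx_seminorms k w (r : R) :=
  [/\ Nsq a b c d (iter k.+1 (@Dx R) w) <= r, Nsq a b c d (iter k.+1 (@Dy R) w) <= r &
      Nsq a b c d (Dx (iter k (@Dy R) w)) <= r].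

(** The derivatives of order k + 3 which bound the residual of the form: one pure and one mixed
    derivative for each direction. *)
Definition residual_seminorms k w (r : R) :=
  [/\ Nsq a b c d (iter k.+3 (@Dx R) w) <= r, Nsq a b c d (iter k.+3 (@Dy R) w) <= r,
      Nsq a b c d (iter k.+1 (@Dy R) (Dx (Dx w))) <= r &
      Nsq a b c d (iter k.+1 (@Dx R) (Dy (Dy w))) <= r].

(** A derivative of order k + 1 in one variable commutes with the Laplacian, and the Laplacian of
    that derivative bounds both of its pure second derivatives. *)
Lemma residual_seminorms_lap k w r : smooth2 w -> periodic2 a b c d w ->
  Nsq a b c d (iter k.+1 (@Dx R) (Lap w)) <= r ->
  Nsq a b c d (iter k.+1 (@Dy R) (Lap w)) <= r -> residual_seminorms k w r.
Proof.
move=> sw pw.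
have sx := smooth2_iterdx k.+1 sw; have sy := smooth2_iterdy k.+1 sw.
have px := periodic2_iterdx k.+1 sw pw; have py := periodic2_iterdy k.+1 sw pw.
rewrite iterdx_lap// iterdy_lap// => hx hy; split.
- exact: le_trans (Nsq_dxx_le ab cd sx px) hx.
- exact: le_trans (Nsq_dyy_le ab cd sy py) hy.
- by rewrite -!dx_iterdy//; [exact: le_trans (Nsq_dxx_le ab cd sy py) hy|exact: smooth2_dx].
- rewrite -[Dy (Dy w)]/(iter 2 (@Dy R) w) iterdx_iterdy//.
  exact: le_trans (Nsq_dyy_le ab cd sx px) hx.
Qed.

(** Two applications of the Poincaré inequality lower the order from k + 3 to k + 1; for the mixed
    derivative one is in x and one in y. *)
Lemma approx_seminorms_residual k w r : (0 < k)%N -> smooth2 w -> periodic2 a b c d w ->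
  residual_seminorms k w r ->
  approx_seminorms k w ((1 + (b - a) ^+ 2) ^+ 2 * (1 + (d - c) ^+ 2) ^+ 2 * r).
Proof.
(* The Poincaré inequality bounds first derivatives, not the function itself; k >= 1 supplies the
   y-derivative on which it acts in the mixed case. *)
case: k => // k _ sw pw [hx hy hxxy _].
set A := (b - a) ^+ 2; set B := (d - c) ^+ 2.
have A0 : 0 <= A by exact: sqr_ge0.
have B0 : 0 <= B by exact: sqr_ge0.
have r0 : 0 <= r by apply: le_trans hx; exact: Nsq_ge0.
have twice t n1 n2 n3 : 0 <= t -> n1 <= t * n2 -> n2 <= t * n3 -> n3 <= r -> n1 <= t ^+ 2 * r.
  move=> t0 h1 h2 h3; apply: (le_trans h1); rewrite expr2 -mulrA ler_wpM2l//.
  by apply: (le_trans h2); rewrite ler_wpM2l.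
have A2 : A ^+ 2 * r <= (1 + A) ^+ 2 * (1 + B) ^+ 2 * r.
  rewrite ler_wpM2r// -[leLHS]mulr1; apply: ler_pM => //; rewrite ?sqr_ge0//.
    by rewrite lerXn2r ?nnegrE ?addr_ge0// lerDr.
  by rewrite exprn_ege1// lerDl.
have B2 : B ^+ 2 * r <= (1 + A) ^+ 2 * (1 + B) ^+ 2 * r.
  rewrite ler_wpM2r// -[leLHS]mul1r; apply: ler_pM => //; rewrite ?sqr_ge0//.
    by rewrite exprn_ege1// lerDl.
  by rewrite lerXn2r ?nnegrE ?addr_ge0// lerDr.
split.
- apply: le_trans A2; apply: (twice A _ _ _ A0 _ _ hx).
    exact: (Nsq_dx_le ab (smooth2_iterdx k.+1 sw) (periodic2_iterdx k.+1 sw pw)).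
  exact: (Nsq_dx_le ab (smooth2_iterdx k.+2 sw) (periodic2_iterdx k.+2 sw pw)).
- apply: le_trans B2; apply: (twice B _ _ _ B0 _ _ hy).
    exact: (Nsq_dy_le (smooth2_iterdy k.+1 sw) (periodic2_iterdy k.+1 sw pw)).
  exact: (Nsq_dy_le (smooth2_iterdy k.+2 sw) (periodic2_iterdy k.+2 sw pw)).
- apply: (le_trans (Nsq_dx_le ab (smooth2_iterdy k.+1 sw) (periodic2_iterdy k.+1 sw pw))).
  have sxx := smooth2_dx (smooth2_dx sw).
  have pxx := periodic2_dx (smooth2_dx sw) (periodic2_dx sw pw).
  rewrite !dx_iterdy//; last exact: smooth2_dx.
  have := Nsq_dy_le (smooth2_iterdy k sxx) (periodic2_iterdy k sxx pxx).
  move=> /(ler_wpM2l A0)/le_trans; apply.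
  apply: (@le_trans _ _ (A * (B * r))).
    by rewrite ler_wpM2l// ler_wpM2l.
  rewrite mulrA ler_wpM2r//; apply: ler_pM => //.
    by rewrite expr2 -[leLHS]mulr1 ler_pM// ?lerDl// lerDr.
  by rewrite expr2 -[leLHS]mulr1 ler_pM// ?lerDl// lerDr.
Qed.

End EllipticRegularity.

(** * Tensor-product interpolation on the mesh *)

Section UniformMesh.
Variables (R : realType) (l r : R) (n : nat).
Hypotheses (lr : l < r) (n0 : (0 < n)%N).
Local Notation h := (step l r n).
Local Notation node := (node l r n).

Lemma step_gt0 : 0 < h.
Proof. by rewrite /step divr_gt0 ?subr_gt0 ?ltr0n. Qed.

Lemma nodeS i : node i.+1 = node i + h.
Proof. by rewrite /node -natr1; ring. Qed.

Lemma node_last : node n = r.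
Proof. by rewrite /node /step; field; rewrite pnatr_eq0 -lt0n. Qed.

Lemma J_cell i f : continuous f ->
  J (node i) (node i.+1) f = h * J 0 1 (fun t => f (node i + h * t)).
Proof.
move=> cf; have := J_affine (node i) step_gt0 ler01 cf.
by rewrite mulr0 addr0 mulr1 nodeS.
Qed.

Lemma node_ge i : l <= node i.
Proof. by rewrite /node lerDl mulr_ge0// ltW// step_gt0. Qed.

Lemma sum_J_nodes m f : continuous f ->
  \sum_(i < m) J (node i) (node i.+1) f = J l (node m) f.
Proof.
move=> cf; elim: m => [|m ih].
  rewrite big_ord0 /node mul0r addr0.
  by rewrite J.unlock set_itv1 Rintegral_set1.
rewrite big_ord_recr /= ih -(@J_split _ (node m))// node_ge/= nodeS.
by rewrite lerDl ltW// step_gt0.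
Qed.

Lemma sum_J_cells f : continuous f ->
  \sum_(i < n) h * J 0 1 (fun t => f (node i + h * t)) = J l r f.
Proof.
move=> cf; rewrite -[in RHS]node_last -sum_J_nodes//.
by apply: eq_bigr => i _; rewrite J_cell.
Qed.

(** After the last cell [ordS] returns to the first one, and the period r - l makes up for the jump
    of the node. *)
Lemma node_ordS (i : 'I_n) (f : R -> R) t : (forall x, f (x + (r - l)) = f x) ->
  f (node (ordS i) + h * t) = f (node i + h * (1 + t)).
Proof.
move=> pf; have e : node i + h * (1 + t) = node i.+1 + h * t by rewrite nodeS; ring.
rewrite {}e /=; have := ltn_ord i; rewrite leq_eqVlt => /predU1P[e|lt].
  rewrite e modnn node_last -pf; congr f; rewrite /node; ring.
by rewrite modn_small.
Qed.

End UniformMesh.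

Section TensorPolynomials.
Variables (R : realType).
Implicit Types (f g : R -> R -> R) (p q : {poly R}).

(** The condition that [in_Qh] imposes on a single cell. *)
Definition Qpoly k f := exists C : 'M[R]_k.+1, forall x y,
  f x y = \sum_p \sum_q C p q * x ^+ p * y ^+ q.

Lemma QpolyD k f g : Qpoly k f -> Qpoly k g -> Qpoly k (fun x y => f x y + g x y).
Proof.
move=> [A hA] [B hB]; exists (A + B) => x y; rewrite hA hB -big_split.
apply: eq_bigr => i _; rewrite -big_split; apply: eq_bigr => j _.
by rewrite mxE /= !mulrDl.
Qed.

Lemma QpolyZ k c f : Qpoly k f -> Qpoly k (fun x y => c * f x y).
Proof.
move=> [A hA]; exists (c *: A) => x y; rewrite hA mulr_sumr.
apply: eq_bigr => i _; rewrite mulr_sumr; apply: eq_bigr => j _.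
by rewrite mxE !mulrA.
Qed.

Lemma Qpoly0 k : Qpoly k (fun _ _ => 0).
Proof.
exists 0 => x y; rewrite big1// => i _; rewrite big1// => j _.
by rewrite mxE !mul0r.
Qed.

Lemma Qpoly_sum k (I : Type) (s : seq I) (P : pred I) (F : I -> R -> R -> R) :
  (forall i, Qpoly k (F i)) -> Qpoly k (fun x y => \sum_(i <- s | P i) F i x y).
Proof.
move=> hF; elim: s => [|i s ih].
  rewrite (_ : (fun _ _ => _) = (fun _ _ => 0)); first exact: Qpoly0.
  by apply/funext => x; apply/funext => y; rewrite big_nil.
rewrite (_ : (fun _ _ => _) = (fun x y => (if P i then F i x y else 0) +
   \sum_(i <- s | P i) F i x y)); last first.
  by apply/funext => x; apply/funext => y; rewrite big_cons; case: ifP; rewrite ?add0r.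
by apply: QpolyD => //; case: (P i) => //; exact: Qpoly0.
Qed.

Lemma Qpoly_horner k p q : (size p <= k.+1)%N -> (size q <= k.+1)%N ->
  Qpoly k (fun x y => p.[x] * q.[y]).
Proof.
move=> sp sq; exists (\matrix_(i, j) (p`_i * q`_j)) => x y.
rewrite {1}(poly_sum_lt sp) {1}(poly_sum_lt sq) !horner_sum mulr_suml.
apply: eq_bigr => i _; rewrite mulr_sumr; apply: eq_bigr => j _.
by rewrite mxE !hornerZ !hornerXn; ring.
Qed.

Lemma Qpoly_tr k f : Qpoly k f -> Qpoly k (tr f).
Proof.
move=> [A hA]; exists A^T => x y; rewrite /tr hA exchange_big.
by apply: eq_bigr => i _; apply: eq_bigr => j _; rewrite mxE; ring.
Qed.

Lemma Qpoly_x k f y : Qpoly k f ->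
  exists p, (size p <= k.+1)%N /\ forall x, f x y = p.[x].
Proof.
move=> [A hA]; exists (\sum_(i < k.+1) (\sum_j A i j * y ^+ j) *: 'X^i).
split; first exact: size_sum_lt.
move=> x; rewrite hA horner_sum; apply: eq_bigr => i _.
rewrite hornerZ hornerXn mulr_suml; apply: eq_bigr => j _; ring.
Qed.

Lemma ct2_horner p q : ct2 (fun x y => p.[x] * q.[y]).
Proof.
apply: ctM; [exact: (ct_comp (@ct_fst R R) (@cp R p))|exact: (ct_comp (@ct_snd R R) (@cp R q))].
Qed.

Lemma smooth2_horner p q : smooth2 (fun x y => p.[x] * q.[y]).
Proof.
have ddx (p' q' : {poly R}) (x y : R) : is_derive x 1 (fun x => p'.[x] * q'.[y]) (p'^`().[x] * q'.[y]).
  by apply: (is_derive_eq (dvM (is_derive_poly p' x) (dv_cst q'.[y] x))); rewrite mulr0 addr0.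
have ddy (p' q' : {poly R}) (x y : R) : is_derive y 1 (fun y => p'.[x] * q'.[y]) (p'.[x] * q'^`().[y]).
  exact: dvZ.
move=> n; elim: n p q => [|n ih] p q; split => //; try exact: ct2_horner.
split.
- by move=> x y; have [] := ddx p q x y.
- by move=> x y; have [] := ddy p q x y.
- rewrite (_ : Dx _ = (fun x y => p^`().[x] * q.[y])); first exact: ih.
  by apply/funext => x; apply/funext => y; rewrite dxE; exact: is_derive_derive1.
- rewrite (_ : Dy _ = (fun x y => p.[x] * q^`().[y])); first exact: ih.
  by apply/funext => x; apply/funext => y; rewrite dyE; exact: is_derive_derive1.
Qed.

Lemma smooth2_sum (I : Type) (s : seq I) (F : I -> R -> R -> R) :
  (forall i, smooth2 (F i)) -> smooth2 (fun x y => \sum_(i <- s) F i x y).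
Proof.
move=> hF; elim: s => [|i s ih].
  rewrite (_ : (fun _ _ => _) = (fun x y => (0 : {poly R}).[x] * (0 : {poly R}).[y])).
    exact: smooth2_horner.
  by apply/funext => x; apply/funext => y; rewrite big_nil horner0 mul0r.
rewrite (_ : (fun _ _ => _) = (fun x y => F i x y + \sum_(i <- s) F i x y)).
  exact: smooth2D.
by apply/funext => x; apply/funext => y; rewrite big_cons.
Qed.

Lemma Qpoly_smooth2 k f : Qpoly k f -> smooth2 f.
Proof.
move=> [A hA].
rewrite (_ : f = (fun x y => \sum_p \sum_q A p q * ('X^p).[x] * ('X^q).[y])).
  apply: smooth2_sum => i; apply: smooth2_sum => j.
  rewrite (_ : (fun _ _ => _) = (fun x y => A i j * (('X^i).[x] * ('X^j).[y]))).
    exact/smooth2Z/smooth2_horner.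
  by apply/funext => x; apply/funext => y; rewrite mulrA.
apply/funext => x; apply/funext => y; rewrite hA.
by apply: eq_bigr => i _; apply: eq_bigr => j _; rewrite !hornerXn.
Qed.

End TensorPolynomials.

Section CellIntegrals.
Variables (R : realType) (a b c d : R) (N M : nat).
Hypotheses (ab : a < b) (cd : c < d) (N0 : (0 < N)%N) (M0 : (0 < M)%N).
Implicit Types f : R -> R -> R.
Local Notation hx := (step a b N).
Local Notation hy := (step c d M).
Local Notation X i := (node a b N i).
Local Notation Y j := (node c d M j).

Definition refint (f : R -> R -> R) : R := J 0 1 (fun t => J 0 1 (f t)).

Definition oncell (i j : nat) f : R -> R -> R := fun t r => f (X i + hx * t) (Y j + hy * r).

Lemma ct2_oncell i j f : ct2 f -> ct2 (oncell i j f).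
Proof.
move=> cf.
have cx : continuous (fun z : R * R => X i + hx * z.1).
  by apply: ctD; [exact: ct_cst|apply: ctZ; exact: ct_fst].
have cy : continuous (fun z : R * R => Y j + hy * z.2).
  by apply: ctD; [exact: ct_cst|apply: ctZ; exact: ct_snd].
exact: (ct_comp (ct_pair cx cy) cf).
Qed.

Lemma iint_cell (i : 'I_N) (j : 'I_M) f : ct2 f ->
  iint (xcell a b i `*` ycell c d j) f = hx * hy * refint (oncell i j f).
Proof.
move=> cf; rewrite /xcell /ycell /xn /yn iint_JJ//.
rewrite J_cell//; last exact: ct2_J.
rewrite -mulrA; congr (_ * _); rewrite /refint -JZ; last exact: (ct2_J 0 1 (ct2_oncell (i:=i) (j:=j) cf)).
by apply: eq_J => t _; rewrite J_cell//; exact: ct2_y.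
Qed.

Lemma sum_cells f : ct2 f ->
  hx * hy * \sum_(i < N) \sum_(j < M) refint (oncell i j f) = JJ a b c d f.
Proof.
move=> cf; rewrite /JJ -(sum_J_cells ab N0 (ct2_J c d cf)) mulr_sumr.
apply: eq_bigr => i _; rewrite -mulrA; congr (_ * _).
have ch t : continuous (f (X i + hx * t)) by exact: ct2_y.
rewrite (eq_J (g := fun t => \sum_(j < M) hy * J 0 1 (oncell i j f t))); last first.
  by move=> t _; rewrite -(sum_J_cells cd M0 (ch t)).
have cj j : continuous (fun t => J 0 1 (oncell i j f t)) by exact: (ct2_J 0 1 (ct2_oncell (i:=i) (j:=j) cf)).
rewrite J_sum; last by move=> j; apply: ctZ; exact: cj.
by rewrite mulr_sumr; apply: eq_bigr => j _; rewrite -JZ.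
Qed.

End CellIntegrals.

(** * Tensor-product interpolation and the residual on one row *)

Section TensorInterpolation.
Variables (R : realType) (k : nat) (s : 'I_k.+3 -> R) (lam : 'I_k.+3 -> {poly R}).
Hypothesis k0 : (0 < k)%N.
Hypothesis ref : reference_interpolation s lam.
Implicit Types (p q V W : {poly R}) (f g : R -> R -> R).
Local Notation interp := (interp s lam).
Local Notation Dx := (@Dx R).
Local Notation Dy := (@Dy R).

Lemma jets_x g r : smooth2 g -> jets (fun m t => iter m Dx g t r).
Proof. by move=> sg m t; exact: (smooth2_is_dx t r (smooth2_iterdx m sg)). Qed.

Lemma jets_y g t : smooth2 g -> jets (fun m r => iter m Dy g t r).
Proof. by move=> sg m r; exact: (smooth2_is_dy t r (smooth2_iterdy m sg)). Qed.

Definition yerr g t r : R := g t r - (interp (g t)).[r].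

Lemma interp_hornerE (f : R -> R) t : (interp f).[t] = \sum_i f (s i) * (lam i).[t].
Proof. by rewrite horner_sum; apply: eq_bigr => i _; rewrite hornerZ. Qed.

Lemma jets_interp_y g r : smooth2 g -> jets (fun m t => (interp (iter m Dx g t)).[r]).
Proof.
move=> sg m t; under eq_fun do rewrite interp_hornerE.
rewrite interp_hornerE; apply: dv_sum => i.
under eq_fun do rewrite mulrC.
by rewrite mulrC; apply: dvZ; exact: (jets_x (s i) sg m t).
Qed.

Lemma jets_yerr g r : smooth2 g -> jets (fun m t => yerr (iter m Dx g) t r).
Proof. by move=> sg m t; apply: dvB; [exact: (jets_x r sg m t)|exact: (jets_interp_y r sg m t)]. Qed.

Lemma jets_yerrN g r : smooth2 g -> jets (fun m t => - yerr (iter m Dx g) t r).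
Proof.
move=> sg m t; rewrite (_ : (fun _ => _) = (fun t => (interp (iter m Dx g t)).[r] - iter m Dx g t r)).
  by rewrite opprB; apply: dvB; [exact: (jets_interp_y r sg m t)|exact: (jets_x r sg m t)].
by apply/funext => u; rewrite opprB.
Qed.

Definition rint g t r : R := (interp (fun t' => (interp (g t')).[r])).[t].

Lemma rintE g t r : rint g t r = \sum_p \sum_q g (s p) (s q) * ((lam p).[t] * (lam q).[r]).
Proof.
rewrite /rint interp_hornerE; apply: eq_bigr => p _.
rewrite interp_hornerE mulr_suml; apply: eq_bigr => q _; ring.
Qed.

Lemma Qpoly_rint g : Qpoly k (rint g).
Proof.
rewrite (_ : rint g = fun t r => \sum_p \sum_q g (s p) (s q) * ((lam p).[t] * (lam q).[r])).
  apply: Qpoly_sum => p; apply: Qpoly_sum => q; apply: QpolyZ.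
  by apply: Qpoly_horner; exact: (ref_size ref).
by apply/funext => t; apply/funext => r; rewrite rintE.
Qed.

(** With Px and Py the interpolations in the two variables, I - Px Py = (I - Py) + (I - Px) - (I -
    Px)(I - Py). *)
Lemma rint_errorE g t r : g t r - rint g t r =
  yerr g t r + (g t r - (interp (g ^~ r)).[t])
  - (yerr g t r - (interp (fun t' => yerr g t' r)).[t]).
Proof.
rewrite /rint /yerr (interpB s lam (g ^~ r)) hornerD hornerN; ring.
Qed.

Lemma sqr_add3 (x y z : R) : (x + y - z) ^+ 2 <= 3 * (x ^+ 2 + y ^+ 2 + z ^+ 2).
Proof.
have := sqr_ge0 (x - y); have := sqr_ge0 (x + z); have := sqr_ge0 (y + z); nra.
Qed.

Lemma ct2_fst (f : R -> R) : continuous f -> ct2 (fun t r => f t).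
Proof. by move=> cf; exact: (ct_comp (@ct_fst R R) cf). Qed.

Lemma ct2_snd (f : R -> R) : continuous f -> ct2 (fun t r => f r).
Proof. by move=> cf; exact: (ct_comp (@ct_snd R R) cf). Qed.

Lemma refint_JJ f : refint f = JJ 0 1 0 1 f. Proof. by []. Qed.

Lemma refint_fst (f : R -> R) : refint (fun t r => f t) = J 0 1 f.
Proof.
by apply: eq_J => t _; rewrite (J_cst (f t) ler01) subr0 mulr1.
Qed.

Lemma le_refint f g : ct2 f -> ct2 g ->
  (forall t r, 0 <= t <= 1 -> 0 <= r <= 1 -> f t r <= g t r) -> refint f <= refint g.
Proof.
move=> cf cg fg; apply: le_J; [exact: (ct2_J 0 1 cf)|exact: (ct2_J 0 1 cg)|].
by move=> t t01; apply: le_J; [exact: (ct2_y t cf)|exact: (ct2_y t cg)|move=> r r01; exact: fg].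
Qed.

(** The single errors cost k + 1 derivatives in one variable. The product of the errors is spread
    over both variables, one derivative in x and k in y, so that no order above k + 1 is used. *)
Lemma rint_error : exists C : R, 0 <= C /\ forall g, smooth2 g ->
  refint (fun t r => (g t r - rint g t r) ^+ 2) <=
  C * (refint (fun t r => iter k.+1 Dx g t r ^+ 2)
     + refint (fun t r => iter k.+1 Dy g t r ^+ 2)
     + refint (fun t r => Dx (iter k Dy g) t r ^+ 2)).
Proof.
have [C [C0 HC]] := interp_error ref.
exists (3 * C + 3 * (C * C)); split; first by rewrite addr_ge0 ?mulr_ge0.
move=> g sg.
have cg := smooth2_ct sg.
have crint : ct2 (rint g) by apply: smooth2_ct; apply: Qpoly_smooth2; exact: Qpoly_rint.
have cX := ct2X (n := 2) (smooth2_ct (smooth2_iterdx k.+1 sg)).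
have cY := ct2X (n := 2) (smooth2_ct (smooth2_iterdy k.+1 sg)).
have cXY := ct2X (n := 2) (smooth2_ct (smooth2_dx (smooth2_iterdy k sg))).
set A := refint (fun t r => iter k.+1 Dx g t r ^+ 2).
set B := refint (fun t r => iter k.+1 Dy g t r ^+ 2).
set D := refint (fun t r => Dx (iter k Dy g) t r ^+ 2).
have A0 : 0 <= A by apply: JJ_ge0 => *; exact: sqr_ge0.
have B0 : 0 <= B by apply: JJ_ge0 => *; exact: sqr_ge0.
have D0 : 0 <= D by apply: JJ_ge0 => *; exact: sqr_ge0.
pose B1 t := J 0 1 (fun r => iter k.+1 Dy g t r ^+ 2).
pose A1 r := J 0 1 (fun t => iter k.+1 Dx g t r ^+ 2).
have cB1 : continuous B1 by exact: (ct2_J 0 1 cY).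
have cA1 : continuous A1 by exact: (ct2_J_swap 0 1 cX).
have pw t r : 0 <= t <= 1 -> 0 <= r <= 1 -> (g t r - rint g t r) ^+ 2 <=
    3 * C * (B1 t + A1 r) + 3 * (C * C) * D.
  move=> t01 r01; rewrite rint_errorE; apply: (le_trans (sqr_add3 _ _ _)).
  have h1 : yerr g t r ^+ 2 <= C * B1 t by exact: (HC k _ (leqnn k) (jets_y t sg) r r01).
  have h2 : (g t r - (interp (g^~ r)).[t]) ^+ 2 <= C * A1 r.
    exact: (HC k _ (leqnn k) (jets_x r sg) t t01).
  (* Order m = 0 in x brings out one x-derivative, and order k - 1 in y, applied to that derivative,
     brings out k derivatives in y. *)
  have h3 : (yerr g t r - (interp (fun t' => yerr g t' r)).[t]) ^+ 2 <= C * (C * D).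
    apply: (le_trans (HC 0%N _ (leq0n k) (jets_yerr r sg) t t01)); rewrite ler_wpM2l//.
    have cyerr : continuous (fun t => yerr (Dx g) t r) by exact: (jets_ct (m := 1) (jets_yerr r sg)).
    have cD := ct2_J 0 1 cXY.
    rewrite /D /refint -JZ//; apply: le_J; [exact: ctX|exact: ctZ|move=> u u01].
    have := HC k.-1 _ (leq_pred k) (jets_y u (smooth2_dx sg)) r r01.
    by rewrite prednK// -(dx_iterdy k sg).
  lra.
have c1 : ct2 (fun t r => B1 t + A1 r) by apply: ct2D; [exact: ct2_fst|exact: ct2_snd].
apply: (@le_trans _ _ (refint (fun t r => 3 * C * (B1 t + A1 r) + 3 * (C * C) * D))).
  apply: le_refint => //; first by apply: ct2X; exact: ctB.
  by apply: ct2D; [exact: ct2Z|exact: ct_cst].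
rewrite !refint_JJ JJD; [|exact: ct2Z|exact: ct_cst].
rewrite JJZ// JJD; [|exact: ct2_fst|exact: ct2_snd].
rewrite -!refint_JJ refint_fst (refint_fst (fun=> _)) J_cst// subr0 mulr1.
have -> : refint (fun t r => A1 r) = A.
  rewrite /A !refint_JJ (JJ_swap _ _ _ _ (ct2_snd cA1)) (JJ_swap _ _ _ _ cX).
  by apply: eq_J => r _; rewrite (J_cst (A1 r) ler01) subr0 mulr1.
rewrite -/B.
have e1 : 0 <= C * C * (A + B) by rewrite !mulr_ge0// addr_ge0.
have e2 : 0 <= C * D by rewrite mulr_ge0.
rewrite (_ : J 0 1 B1 = B)//; lra.
Qed.

Lemma bilinear_residualD (Z0 Z1 Z0' Z1' V0 V1 : {poly R}) (f g : R -> R) :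
  continuous f -> continuous g ->
  bilinear_residual (Z0 + Z0') (Z1 + Z1') V0 V1 (fun t => f t + g t) =
  bilinear_residual Z0 Z1 V0 V1 f + bilinear_residual Z0' Z1' V0 V1 g.
Proof.
move=> cf cg; rewrite /bilinear_residual.
have e1 : J 0 1 (fun x => (Z0 + Z0')^`().[x] * V0^`().[x]) =
    J 0 1 (fun x => Z0^`().[x] * V0^`().[x]) + J 0 1 (fun x => Z0'^`().[x] * V0^`().[x]).
  rewrite -JD; [|by apply: ctM; exact: cp..].
  by apply: eq_J => x _; rewrite derivD hornerD mulrDl.
have e2 : J 0 1 (fun x => (f x + g x) * V0.[x]) =
    J 0 1 (fun x => f x * V0.[x]) + J 0 1 (fun x => g x * V0.[x]).
  rewrite -JD; [|by apply: ctM => //; exact: cp..].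
  by apply: eq_J => x _; rewrite mulrDl.
by rewrite e1 e2 !derivD !hornerD; field.
Qed.

(* For a frozen [y]-coordinate [r], the interpolant in [y] is split as
   [g + (Py g - g)]: the first term is estimated with [k + 3] derivatives in
   [x], the second one with 2 derivatives in [x] and [k + 1] in [y]. *)
Lemma row_residual_bound : exists C : R, 0 <= C /\
  forall N (g : 'I_N -> R -> R -> R) (V : 'I_N -> {poly R}) (r e : R),
  (forall i, smooth2 (g i)) ->
  (forall i m t r, iter m Dx (g (ordS i)) t r = iter m Dx (g i) (1 + t) r) ->
  (forall i, (size (V i) <= k.+1)%N) -> 0 <= r <= 1 -> 0 < e ->
  \sum_i bilinear_residual (interp (fun t => (interp (g i t)).[r]))
     (interp (fun t => (interp (g (ordS i) t)).[r])) (V i) (V (ordS i))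
     (fun t => Dx (Dx (g i)) t r)
  <= C / e * \sum_i (J 0 1 (fun t => iter k.+3 Dx (g i) t r ^+ 2)
       + refint (fun t r' => iter k.+1 Dy (Dx (Dx (g i))) t r' ^+ 2))
     + e * \sum_i Int (V i ^+ 2).
Proof.
have [C [C0 HC]] := periodic_residual_bound k0 ref.
have [E [E0 HE]] := interp_error ref.
(* The weight e is shared by three terms: the residual of g, the residual of Py g - g, and the last
   integral in [split_i]. The latter two carry the factor [E] of the error in y. *)
exists (3 * C + 3 * (C + 1) * E); split.
  by rewrite addr_ge0// mulr_ge0// ?mulr_ge0// ?addr_ge0.
move=> N g V r e sg link sV r01 e0.
have e30 : 0 < e / 3 by rewrite divr_gt0.
pose zw i m t := iter m Dx (g i) t r.
pose zd i m t := - yerr (iter m Dx (g i)) t r.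
have jw i : jets (zw i) := jets_x r (sg i).
have jd i : jets (zd i) := jets_yerrN r (sg i).
have lw i m t : zw (ordS i) m t = zw i m (1 + t) by exact: link.
have ld i m t : zd (ordS i) m t = zd i m (1 + t).
  rewrite /zd /yerr link; congr (- (_ - (interp _).[_])).
  by apply/funext => u; exact: link.
have cw i m := jets_ct (m := m) (jw i); have cd i m := jets_ct (m := m) (jd i).
set SV := \sum_i Int _.
set K3 := \sum_i J 0 1 (fun t => iter k.+3 Dx (g i) t r ^+ 2).
set K1 := \sum_i refint (fun t r' => iter k.+1 Dy (Dx (Dx (g i))) t r' ^+ 2).
have hw := HC N zw V k.+1 (e / 3) jw lw sV (leqnn _) e30.
have hd := HC N zd V 0%N (e / 3) jd ld sV (leq0n _) e30.
have sd : \sum_i J 0 1 (fun t => zd i 2%N t ^+ 2) <= E * K1.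
  rewrite mulr_sumr; apply: ler_sum => i _.
  have sxx := smooth2_dx (smooth2_dx (sg i)).
  have cY := ct2X (n := 2) (smooth2_ct (smooth2_iterdy k.+1 sxx)).
  rewrite /refint -JZ; last exact: (ct2_J 0 1 cY).
  apply: le_J; [exact/ctX/cd|exact/ctZ/(ct2_J 0 1 cY)|move=> t t01].
  rewrite /zd sqrrN; exact: (HE k _ (leqnn k) (jets_y t sxx) r r01).
(* The two residuals together pair V with Py g_xx, whereas the left side contains g_xx itself; the
   last integral is the difference. *)
have split_i i : bilinear_residual (interp (fun t => (interp (g i t)).[r]))
     (interp (fun t => (interp (g (ordS i) t)).[r])) (V i) (V (ordS i))
     (fun t => Dx (Dx (g i)) t r) =
   bilinear_residual (interp (zw i 0%N)) (interp (zw (ordS i) 0%N)) (V i) (V (ordS i)) (zw i 2%N)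
   + bilinear_residual (interp (zd i 0%N)) (interp (zd (ordS i) 0%N)) (V i) (V (ordS i)) (zd i 2%N)
   + J 0 1 (fun t => - zd i 2%N t * (V i).[t]).
  rewrite -bilinear_residualD; [|exact: cw|exact: cd].
  have Z i' : interp (zw i' 0%N) + interp (zd i' 0%N) = interp (fun t => (interp (g i' t)).[r]).
    rewrite -interpD; congr (interp _); apply/funext => t.
    by rewrite /zw /zd /yerr /=; ring.
  rewrite !Z /bilinear_residual -[RHS]addrA; congr (_ + _).
  rewrite -JD; first by apply: eq_J => t _; rewrite /zw /=; ring.
    by apply: ctM; [apply: ctD; [exact: cw|exact: cd]|exact: cp].
  by apply: ctM; [apply: ctN; exact: cd|exact: cp].
have last : \sum_i J 0 1 (fun t => - zd i 2%N t * (V i).[t]) <=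
    3 / e * \sum_i J 0 1 (fun t => zd i 2%N t ^+ 2) + e / 3 * SV.
  rewrite !mulr_sumr -big_split; apply: ler_sum => i _ /=.
  have cV2 : continuous (fun t => (V i).[t] ^+ 2) by apply: ctX; exact: cp.
  have -> : Int (V i ^+ 2) = J 0 1 (fun t => (V i).[t] ^+ 2).
    by apply: eq_J => t _; rewrite horner_exp.
  have cz2 : continuous (fun t => zd i 2%N t ^+ 2) by apply: ctX; exact: cd.
  rewrite -!JZ// -JD; [|exact: ctZ..].
  apply: le_J.
  - by apply: ctM; [apply: ctN; exact: cd|exact: cp].
  - by apply: ctD; exact: ctZ.
  - move=> t _; have := young (- zd i 2%N t) (V i).[t] e30.
    by rewrite sqrrN invf_div mulrC [_ / e * _]mulrC.
rewrite (eq_bigr _ (fun i _ => split_i i)) big_split /= big_split /= [in leRHS]big_split /= -/K3 -/K1.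
have K10 : 0 <= K1 by apply: sumr_ge0 => i _; apply: JJ_ge0 => *; exact: sqr_ge0.
have K30 : 0 <= K3 by apply: sumr_ge0 => i _; apply: J_ge0 => *; exact: sqr_ge0.
have ie0 : 0 <= e^-1 by rewrite invr_ge0 ltW.
have hw' : C / (e / 3) * K3 = 3 * C * (e^-1 * K3) by field; rewrite gt_eqF.
have hd' : C / (e / 3) * (\sum_i J 0 1 (fun t => zd i 2%N t ^+ 2)) <= 3 * C * E * (e^-1 * K1).
  rewrite (_ : _ * _ = 3 * C * e^-1 * \sum_i J 0 1 (fun t => zd i 2%N t ^+ 2)); last first.
    by field; rewrite gt_eqF.
  rewrite [leRHS](_ : _ = 3 * C * e^-1 * (E * K1)); last by ring.
  by rewrite ler_wpM2l// !mulr_ge0.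
have hl' : 3 / e * (\sum_i J 0 1 (fun t => zd i 2%N t ^+ 2)) <= 3 * E * (e^-1 * K1).
  rewrite [leRHS](_ : _ = 3 / e * (E * K1)); last by ring.
  by rewrite ler_wpM2l// mulr_ge0.
have p1 : 0 <= 3 * (C + 1) * E * (e^-1 * K3) by rewrite !mulr_ge0// addr_ge0.
have p2 : 0 <= 3 * C * (e^-1 * K1) by rewrite !mulr_ge0.
rewrite (_ : (3 * C + 3 * (C + 1) * E) / e * (K3 + K1) =
  3 * C * (e^-1 * K3) + 3 * C * (e^-1 * K1) + 3 * (C + 1) * E * (e^-1 * K3)
  + 3 * C * E * (e^-1 * K1) + 3 * E * (e^-1 * K1)); last by ring.
have e3 : e * SV = e / 3 * SV + e / 3 * SV + e / 3 * SV by field.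
move: hw; rewrite hw' -/SV => hw; move: hd; rewrite -/SV => hd.
lra.
Qed.

End TensorInterpolation.

Section OnCell.
Variables (R : realType) (a b c d : R) (N M : nat).
Implicit Types f g : R -> R -> R.
Local Notation hx := (step a b N).
Local Notation hy := (step c d M).
Local Notation X i := (node a b N i).
Local Notation Y j := (node c d M j).
Local Notation rescaled := (oncell a b c d N M).
Local Notation Dx := (@Dx R).
Local Notation Dy := (@Dy R).

Lemma is_dx_oncell (i j : nat) f (t r : R) : smooth2 f ->
  is_derive t 1 (rescaled i j f ^~ r) (hx * rescaled i j (Dx f) t r).
Proof.
by move=> sf; apply: (is_derive_comp_affine (F := f ^~ _)); exact: smooth2_is_dx.
Qed.

Lemma is_dy_oncell (i j : nat) f (t r : R) : smooth2 f ->
  is_derive r 1 (rescaled i j f t) (hy * rescaled i j (Dy f) t r).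
Proof.
by move=> sf; apply: (is_derive_comp_affine (F := f _)); exact: smooth2_is_dy.
Qed.

Lemma dx_oncell i j f : smooth2 f -> Dx (rescaled i j f) = fun t r => hx * rescaled i j (Dx f) t r.
Proof.
move=> sf; apply/funext => t; apply/funext => r; rewrite dxE.
exact/is_derive_derive1/is_dx_oncell.
Qed.

Lemma dy_oncell i j f : smooth2 f -> Dy (rescaled i j f) = fun t r => hy * rescaled i j (Dy f) t r.
Proof.
move=> sf; apply/funext => t; apply/funext => r; rewrite dyE.
exact/is_derive_derive1/is_dy_oncell.
Qed.

Lemma smooth2_oncell i j f : smooth2 f -> smooth2 (rescaled i j f).
Proof.
move=> sf n.
(* The scalar z strengthens the induction, because differentiating a rescaled function multiplies it
   by a step size. *)
suff : forall z, Cn n (fun t r => z * rescaled i j f t r).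
  move=> /(_ 1); rewrite (_ : (fun _ _ => _) = rescaled i j f)//.
  by apply/funext => t; apply/funext => r; rewrite mul1r.
elim: n f sf => [|n ih] f sf z; split => //.
- exact/ct2Z/ct2_oncell/smooth2_ct.
- exact/ct2Z/ct2_oncell/smooth2_ct.
- have dX t r := dvZ z (is_dx_oncell i j t r sf).
  have dY t r := dvZ z (is_dy_oncell i j t r sf).
  split.
  + by move=> t r; have [] := dX t r.
  + by move=> t r; have [] := dY t r.
  + rewrite (_ : Dx _ = (fun t r => z * hx * rescaled i j (Dx f) t r)); first exact/ih/smooth2_dx.
    apply/funext => t; apply/funext => r; rewrite dxE -mulrA.
    exact: is_derive_derive1 (dX t r).
  + rewrite (_ : Dy _ = (fun t r => z * hy * rescaled i j (Dy f) t r)); first exact/ih/smooth2_dy.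
    apply/funext => t; apply/funext => r; rewrite dyE -mulrA.
    exact: is_derive_derive1 (dY t r).
Qed.

Lemma iterdx_oncell m i j f : smooth2 f ->
  iter m Dx (rescaled i j f) = fun t r => hx ^+ m * rescaled i j (iter m Dx f) t r.
Proof.
move=> sf; elim: m => [|m ih].
  by apply/funext => t; apply/funext => r; rewrite expr0 mul1r.
have sm := smooth2_iterdx m sf.
rewrite iterS ih dxZ; last exact: smooth2_oncell.
rewrite dx_oncell//; apply/funext => t; apply/funext => r.
by rewrite iterS exprSr mulrA.
Qed.

Lemma iterdy_oncell m i j f : smooth2 f ->
  iter m Dy (rescaled i j f) = fun t r => hy ^+ m * rescaled i j (iter m Dy f) t r.
Proof.
move=> sf; elim: m => [|m ih].
  by apply/funext => t; apply/funext => r; rewrite expr0 mul1r.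
have sm := smooth2_iterdy m sf.
rewrite iterS ih dyZ; last exact: smooth2_oncell.
rewrite dy_oncell//; apply/funext => t; apply/funext => r.
by rewrite iterS exprSr mulrA.
Qed.

Lemma iterdyZ m z f : smooth2 f -> iter m Dy (fun x y => z * f x y) = fun x y => z * iter m Dy f x y.
Proof.
by move=> sf; elim: m => //= m ->; rewrite dyZ//; exact: smooth2_iterdy.
Qed.

Lemma refintZ z f : ct2 f -> refint (fun t r => z * f t r) = z * refint f.
Proof. by move=> cf; rewrite !refint_JJ JJZ. Qed.

Lemma refint_sqZ z i j f : ct2 f ->
  refint (fun t r => (z * rescaled i j f t r) ^+ 2) =
  z ^+ 2 * refint (rescaled i j (fun x y => f x y ^+ 2)).
Proof.
move=> cf; rewrite -refintZ; last exact/ct2_oncell/ct2X.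
by rewrite !refint_JJ; apply: eq_JJ => t r _ _; rewrite exprMn.
Qed.

Lemma Qpoly_oncell k i j f : Qpoly k f -> Qpoly k (rescaled i j f).
Proof.
move=> [C hC].
have sz (x h : R) (p : 'I_k.+1) : (size ((x%:P + h *: 'X) ^+ p : {poly R})%R <= k.+1)%N.
  apply: (leq_trans (size_poly_exp_leq _ _)).
  have : (size (x%:P + h *: 'X : {poly R})%R <= 2)%N.
    apply: size_le_addp; first by rewrite (leq_trans (size_polyC_leq1 _)).
    by apply: size_le_scalep; rewrite size_polyX.
  have := ltn_ord p; move: (size _) => m; nia.
rewrite (_ : rescaled i j f = fun t r => \sum_p \sum_q C p q *
   (((X i)%:P + hx *: 'X) ^+ p).[t] * (((Y j)%:P + hy *: 'X) ^+ q).[r]).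
  apply: Qpoly_sum => p; apply: Qpoly_sum => q.
  rewrite (_ : (fun _ _ => _) = (fun t r => C p q *
   ((((X i)%:P + hx *: 'X) ^+ p).[t] * (((Y j)%:P + hy *: 'X) ^+ q).[r]))).
    by apply: QpolyZ; apply: Qpoly_horner; exact: sz.
  by apply/funext => t; apply/funext => r; rewrite mulrA.
apply/funext => t; apply/funext => r; rewrite /oncell hC.
apply: eq_bigr => p _; apply: eq_bigr => q _.
by rewrite !horner_exp !hornerE.
Qed.

End OnCell.

Section Transposition.
Variables (R : realType) (N M : nat).

(** Exchanging the axes reduces the y-part of the form to its x-part on the transposed mesh. *)
Definition trp (v : piecewise R N M) : piecewise R M N := fun j i => tr (v i j).

Lemma in_Qh_trp k v : in_Qh k v -> in_Qh k (trp v).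
Proof. by move=> hv j i; exact: (Qpoly_tr (hv i j)). Qed.

End Transposition.

Section Interpolant.
Variables (R : realType) (k : nat) (s : 'I_k.+3 -> R) (lam : 'I_k.+3 -> {poly R}).
Hypothesis k0 : (0 < k)%N.
Hypothesis ref : reference_interpolation s lam.
Local Notation Dx := (@Dx R).
Local Notation Dy := (@Dy R).

Section Cells.
Variables (a b c d : R) (N M : nat).
Hypotheses (ab : a < b) (cd : c < d) (N0 : (0 < N)%N) (M0 : (0 < M)%N).
Implicit Types (f g w : R -> R -> R) (v : piecewise R N M).
Local Notation hx := (step a b N).
Local Notation hy := (step c d M).
Local Notation X i := (node a b N i).
Local Notation Y j := (node c d M j).
Local Notation rescaled := (oncell a b c d N M).
Local Notation h := (mesh_size a b c d N M).

Definition pint w : piecewise R N M := fun i j x y =>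
  rint s lam (rescaled i j w) ((x - X i) / hx) ((y - Y j) / hy).

Let hx0 : 0 < hx := step_gt0 ab N0.
Let hy0 : 0 < hy := step_gt0 cd M0.

Lemma oncell_pint w (i : 'I_N) (j : 'I_M) : rescaled i j (pint w i j) = rint s lam (rescaled i j w).
Proof.
apply/funext => t; apply/funext => r; rewrite {1}/oncell /pint.
by congr (rint _ _ _ _ _); field; rewrite gt_eqF.
Qed.

Lemma in_Qh_pint w : in_Qh k (pint w).
Proof.
move=> i j.
have sz (x z : R) p : (size (lam p \Po (x%:P + z *: 'X))%R <= k.+1)%N.
  rewrite comp_polyE; apply: (leq_trans (size_sum _ _ _)); apply/bigmax_leqP => q _.
  apply: size_le_scalep; apply: (leq_trans (size_poly_exp_leq _ _)).
  have : (size (x%:P + z *: 'X : {poly R})%R <= 2)%N.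
    apply: size_le_addp; first by rewrite (leq_trans (size_polyC_leq1 _)).
    by apply: size_le_scalep; rewrite size_polyX.
  have := ref_size ref p; have := ltn_ord q; move: (size (polyseq (_ + _))) => m; nia.
have hz (x z y : R) p : 0 < z -> (lam p).[(y - x) / z] = (lam p \Po ((- x / z)%:P + z^-1 *: 'X)).[y].
  by move=> z0; rewrite horner_comp !hornerE; congr (_.[_]); field; rewrite gt_eqF.
suff : Qpoly k (pint w i j) by [].
rewrite (_ : pint w i j = fun x y => \sum_p \sum_q rescaled i j w (s p) (s q) *
   ((lam p \Po ((- X i / hx)%:P + hx^-1 *: 'X)).[x] * (lam q \Po ((- Y j / hy)%:P + hy^-1 *: 'X)).[y])).
  apply: Qpoly_sum => p; apply: Qpoly_sum => q; apply: QpolyZ.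
  by apply: Qpoly_horner; exact: sz.
apply/funext => x; apply/funext => y; rewrite /pint rintE.
by apply: eq_bigr => p _; apply: eq_bigr => q _; rewrite -!hz.
Qed.

Lemma smooth2_pint w i j : smooth2 (pint w i j).
Proof. exact: (Qpoly_smooth2 (in_Qh_pint w i j)). Qed.

Lemma inner_refint (w v : piecewise R N M) :
  (forall i j, ct2 (w i j)) -> (forall i j, ct2 (v i j)) ->
  inner a b c d w v = hx * hy * \sum_(i < N) \sum_(j < M) refint (fun t r => rescaled i j (w i j) t r * rescaled i j (v i j) t r).
Proof.
move=> cw cv; rewrite /inner mulr_sumr; apply: eq_bigr => i _.
rewrite mulr_sumr; apply: eq_bigr => j _.
by rewrite iint_cell//; exact: ct2M.
Qed.

Lemma step_le_mesh : hx <= h /\ hy <= h.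
Proof. by rewrite /mesh_size !le_max !lexx orbT. Qed.

Lemma sum_cells_sq f (z : R) : ct2 f ->
  hx * hy * \sum_(i < N) \sum_(j < M) refint (fun t r => (z * rescaled i j f t r) ^+ 2) =
  z ^+ 2 * Nsq a b c d f.
Proof.
move=> cf; rewrite /Nsq -(sum_cells ab cd N0 M0 (ct2X (n := 2) cf)) [RHS]mulrCA; congr (_ * _).
rewrite mulr_sumr; apply: eq_bigr => i _; rewrite mulr_sumr; apply: eq_bigr => j _.
exact: refint_sqZ.
Qed.

End Cells.

(** The error is estimated on the reference square. Each derivative of a rescaled function yields
    one step size, and the cell areas reassemble the sums into integrals over the whole
    rectangle. *)
Lemma pint_error : exists C : R, 0 <= C /\
  forall (a b c d : R) (N M : nat) w (r : R), a < b -> c < d -> (0 < N)%N -> (0 < M)%N ->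
  smooth2 w -> approx_seminorms a b c d k w r ->
  inner a b c d (fun (i : 'I_N) (j : 'I_M) x y => w x y - pint a b c d w i j x y)
                (fun i j x y => w x y - pint a b c d w i j x y)
  <= C * (mesh_size a b c d N M ^+ k.+1) ^+ 2 * r.
Proof.
have [C [C0 HC]] := rint_error k0 ref.
exists (C * 3); split; first by rewrite mulr_ge0.
move=> a b c d N M w r ab cd N0 M0 sw [hX hY hXY].
set hx := step a b N; set hy := step c d M; set h := mesh_size _ _ _ _ _ _.
have hx0 : 0 < hx := step_gt0 ab N0.
have hy0 : 0 < hy := step_gt0 cd M0.
have [hxh hyh] := step_le_mesh a b c d N M.
have ce i j : ct2 (fun x y => w x y - @pint a b c d N M w i j x y).
  by apply: ctB; [exact: smooth2_ct|apply: smooth2_ct; exact: smooth2_pint].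
rewrite inner_refint//.
have e1 (i : 'I_N) (j : 'I_M) : refint (fun t r => oncell a b c d N M i j (fun x y => w x y - pint a b c d w i j x y) t r *
    oncell a b c d N M i j (fun x y => w x y - pint a b c d w i j x y) t r) <=
  C * (refint (fun t r => (hx ^+ k.+1 * oncell a b c d N M i j (iter k.+1 Dx w) t r) ^+ 2)
    + refint (fun t r => (hy ^+ k.+1 * oncell a b c d N M i j (iter k.+1 Dy w) t r) ^+ 2)
    + refint (fun t r => (hy ^+ k * hx * oncell a b c d N M i j (Dx (iter k Dy w)) t r) ^+ 2)).
  have := HC _ (smooth2_oncell a b c d N M i j sw).
  rewrite iterdx_oncell// iterdy_oncell//.
  have -> : Dx (iter k Dy (oncell a b c d N M i j w)) =
      fun t r => hy ^+ k * hx * oncell a b c d N M i j (Dx (iter k Dy w)) t r.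
    rewrite iterdy_oncell// dxZ; last exact/smooth2_oncell/smooth2_iterdy.
    rewrite dx_oncell; last exact: smooth2_iterdy.
    by apply/funext => t; apply/funext => u; rewrite mulrA.
  move=> h1; apply: le_trans h1; rewrite !refint_JJ le_eqVlt; apply/orP; left; apply/eqP.
  apply: eq_JJ => t u _ _; rewrite -oncell_pint// expr2.
apply: (@le_trans _ _ (C * (hx * hy * \sum_(i < N) \sum_(j < M) refint (fun t r => (hx ^+ k.+1 * oncell a b c d N M i j (iter k.+1 Dx w) t r) ^+ 2)
  + hx * hy * \sum_(i < N) \sum_(j < M) refint (fun t r => (hy ^+ k.+1 * oncell a b c d N M i j (iter k.+1 Dy w) t r) ^+ 2)
  + hx * hy * \sum_(i < N) \sum_(j < M) refint (fun t r => (hy ^+ k * hx * oncell a b c d N M i j (Dx (iter k Dy w)) t r) ^+ 2)))).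
  move: (mulr_gt0 hx0 hy0) e1; rewrite -/hx -/hy; move: (hx * hy) => P P0 e1.
  rewrite -!mulrDr [leRHS]mulrCA ler_pM2l//.
  rewrite -!big_split /= mulr_sumr; apply: ler_sum => i _.
  rewrite -!big_split /= mulr_sumr; apply: ler_sum => j _.
  exact: e1.
rewrite !sum_cells_sq//; try (apply: smooth2_ct; do ?[exact: smooth2_iterdx|exact: smooth2_iterdy]).
  have r0 : 0 <= r by apply: le_trans hX; exact: Nsq_ge0.
  have hpow z n : 0 <= z -> z <= h ^+ k.+1 -> n <= r -> 0 <= n -> z ^+ 2 * n <= (h ^+ k.+1) ^+ 2 * r.
    move=> z0 zh nr n0; apply: ler_pM => //; first exact: sqr_ge0.
    by rewrite lerXn2r ?nnegrE// (le_trans z0).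
  have h0 : 0 <= h by apply: le_trans hxh; exact: ltW.
  have xk : hx ^+ k.+1 <= h ^+ k.+1 by rewrite lerXn2r ?nnegrE// ltW.
  have yk : hy ^+ k.+1 <= h ^+ k.+1 by rewrite lerXn2r ?nnegrE// ltW.
  (* Only positive powers of the two steps occur, so the ratio of [hx] and [hy] may be arbitrary. *)
  have xyk : hy ^+ k * hx <= h ^+ k.+1.
    rewrite exprSr; apply: ler_pM => //; [by rewrite exprn_ge0// ltW|exact: ltW|].
    by rewrite lerXn2r ?nnegrE// ltW.
  have b1 := hpow _ _ (exprn_ge0 k.+1 (ltW hx0)) xk hX (Nsq_ge0 a b c d _).
  have b2 := hpow _ _ (exprn_ge0 k.+1 (ltW hy0)) yk hY (Nsq_ge0 a b c d _).
  have b3 := hpow _ _ (mulr_ge0 (exprn_ge0 k (ltW hy0)) (ltW hx0)) xyk hXY (Nsq_ge0 a b c d _).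
  rewrite -!(mulrA C) ler_wpM2l//; lra.
by apply: smooth2_dx; exact: smooth2_iterdy.
Qed.

End Interpolant.

(** * Residual of the DG form *)

Section OneDirectionForm.
Variables (R : realType).

(** The part of [Aform] with x-derivatives and vertical interfaces; the rest is the same expression
    for the transposed arguments, see [Aform_split]. *)
Definition Xform (a b c d : R) (N M : nat) (w v : piecewise R N M) : R :=
  \sum_(i < N) \sum_(j < M) iint (xcell a b i `*` ycell c d j) (fun x y => Dx (w i j) x y * Dx (v i j) x y)
  + \sum_(i < N) \sum_(j < M) J (yn c d M j) (yn c d M j.+1)
      (fun y => xavg a b (fun i j => Dx (w i j)) i j y * xjump a b v i j y
              + xavg a b (fun i j => Dx (v i j)) i j y * xjump a b w i j y).

End OneDirectionForm.

Section FormOnInterpolant.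
Variables (R : realType) (k : nat) (s : 'I_k.+3 -> R) (lam : 'I_k.+3 -> {poly R}).
Hypothesis k0 : (0 < k)%N.
Hypothesis ref : reference_interpolation s lam.

Section Cells.
Variables (a b c d : R) (N M : nat).
Hypotheses (ab : a < b) (cd : c < d) (N0 : (0 < N)%N) (M0 : (0 < M)%N).
Implicit Types (f g w : R -> R -> R) (v : piecewise R N M).
Local Notation hx := (step a b N).
Local Notation hy := (step c d M).
Local Notation X i := (node a b N i).
Local Notation Y j := (node c d M j).
Local Notation rescaled := (oncell a b c d N M).

Let hx0 : 0 < hx := step_gt0 ab N0.
Let hy0 : 0 < hy := step_gt0 cd M0.

(* [bilinear_residual] in the variable [t], on the row [r] of a pair of
   horizontally adjacent reference cells. *)
Definition row_form (P0 P1 V0 V1 : R -> R -> R) (r : R) : R :=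
  J 0 1 (fun t => Dx P0 t r * Dx V0 t r)
  + ((Dx P0 1 r + Dx P1 0 r) / 2 * (V1 0 r - V0 1 r)
     + (Dx V0 1 r + Dx V1 0 r) / 2 * (P1 0 r - P0 1 r)).

Lemma row_form_ct (P0 P1 V0 V1 : R -> R -> R) :
  smooth2 P0 -> smooth2 P1 -> smooth2 V0 -> smooth2 V1 ->
  continuous (row_form P0 P1 V0 V1).
Proof.
move=> sP0 sP1 sV0 sV1.
have ct (f : R -> R -> R) t : smooth2 f -> continuous (f t).
  by move=> /smooth2_ct/(ct2_y t).
have ctd (f : R -> R -> R) t : smooth2 f -> continuous (Dx f t).
  by move=> /smooth2_dx/smooth2_ct/(ct2_y t).
apply: ctD.
  apply: (ct2_J_swap 0 1 (f := fun t r => Dx P0 t r * Dx V0 t r)).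
  by apply: ctM; exact/smooth2_ct/smooth2_dx.
by apply: ctD; apply: ctM; [apply: ctM; [apply: ctD; exact: ctd|exact: ct_cst]|
  apply: ctB; exact: ct|apply: ctM; [apply: ctD; exact: ctd|exact: ct_cst]|
  apply: ctB; exact: ct].
Qed.

(** Volume terms scale as hx hy / hx^2 and interface terms as hy / hx. The common factor lets the
    form be written as an integral over rows of one-dimensional forms in reference coordinates. *)
Lemma Xform_rows (w v : piecewise R N M) : in_Qh k w -> in_Qh k v ->
  Xform a b c d w v = hy / hx * \sum_(j < M) J 0 1 (fun r => \sum_(i < N)
    row_form (rescaled i j (w i j)) (rescaled (ordS i) j (w (ordS i) j))
             (rescaled i j (v i j)) (rescaled (ordS i) j (v (ordS i) j)) r).
Proof.
move=> hw hv.
have sw i j : smooth2 (w i j) := Qpoly_smooth2 (hw i j).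
have sv i j : smooth2 (v i j) := Qpoly_smooth2 (hv i j).
have so (u : piecewise R N M) (i : 'I_N) (j : 'I_M) : (forall i j, smooth2 (u i j)) -> smooth2 (rescaled i j (u i j)).
  by move=> su; exact: smooth2_oncell.
rewrite mulr_sumr.
have -> : \sum_(j < M) hy / hx * J 0 1 (fun r => \sum_(i < N)
    row_form (rescaled i j (w i j)) (rescaled (ordS i) j (w (ordS i) j))
             (rescaled i j (v i j)) (rescaled (ordS i) j (v (ordS i) j)) r) =
   \sum_(j < M) \sum_(i < N) hy / hx * J 0 1 (
    row_form (rescaled i j (w i j)) (rescaled (ordS i) j (w (ordS i) j))
             (rescaled i j (v i j)) (rescaled (ordS i) j (v (ordS i) j))).
  apply: eq_bigr => j _; rewrite J_sum ?mulr_sumr// => i.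
  by apply: row_form_ct; apply: so.
rewrite [RHS]exchange_big /Xform -big_split; apply: eq_bigr => i _ /=.
rewrite -big_split; apply: eq_bigr => j _ /=.
rewrite iint_cell//; last by apply: ct2M; exact/smooth2_ct/smooth2_dx.
have dxo (u : piecewise R N M) (i' : 'I_N) t r : (forall i j, smooth2 (u i j)) ->
    Dx (u i' j) (X i' + hx * t) (Y j + hy * r) = hx^-1 * Dx (rescaled i' j (u i' j)) t r.
  by move=> su; rewrite dx_oncell// mulrA mulVf ?mul1r// gt_eqF.
rewrite /yn; rewrite J_cell//; last first.
  have ct (u : piecewise R N M) (i' : 'I_N) x : (forall i j, smooth2 (u i j)) -> continuous (u i' j x).
    by move=> su; apply: ct2_y; exact/smooth2_ct.
  have ctd (u : piecewise R N M) (i' : 'I_N) x : (forall i j, smooth2 (u i j)) -> continuous (Dx (u i' j) x).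
    by move=> su; apply: ct2_y; exact/smooth2_ct/smooth2_dx.
  by apply: ctD; apply: ctM; [apply: ctM; [apply: ctD; exact: ctd|exact: ct_cst]|
    apply: ctB; exact: ct|apply: ctM; [apply: ctD; exact: ctd|exact: ct_cst]|
    apply: ctB; exact: ct].
have Si : X i.+1 = X i + hx * 1 by rewrite nodeS mulr1.
have S0 (i' : nat) : X i' = X i' + hx * 0 by rewrite mulr0 addr0.
set P0 := rescaled i j (w i j); set P1 := rescaled (ordS i) j (w (ordS i) j).
set V0 := rescaled i j (v i j); set V1 := rescaled (ordS i) j (v (ordS i) j).
have sP0 : smooth2 P0 by exact: so. have sP1 : smooth2 P1 by exact: so.
have sV0 : smooth2 V0 by exact: so. have sV1 : smooth2 V1 by exact: so.
have cDD : ct2 (fun t r => Dx P0 t r * Dx V0 t r).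
  by apply: ct2M; exact/smooth2_ct/smooth2_dx.
pose E r := (Dx P0 1 r + Dx P1 0 r) / 2 * (V1 0 r - V0 1 r)
     + (Dx V0 1 r + Dx V1 0 r) / 2 * (P1 0 r - P0 1 r).
have cE : continuous E.
  have ct (f : R -> R -> R) t : smooth2 f -> continuous (f t).
    by move=> /smooth2_ct/(ct2_y t).
  have ctd (f : R -> R -> R) t : smooth2 f -> continuous (Dx f t).
    by move=> /smooth2_dx/smooth2_ct/(ct2_y t).
  by apply: ctD; apply: ctM; [apply: ctM; [apply: ctD; exact: ctd|exact: ct_cst]|
    apply: ctB; exact: ct|apply: ctM; [apply: ctD; exact: ctd|exact: ct_cst]|
    apply: ctB; exact: ct].
have -> : refint (rescaled i j (fun x y => Dx (w i j) x y * Dx (v i j) x y)) =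
    hx^-1 * hx^-1 * J 0 1 (fun r => J 0 1 (fun t => Dx P0 t r * Dx V0 t r)).
  rewrite -(J_swap 0 1 0 1 cDD) -[RHS]refintZ//.
  apply: eq_JJ => t r _ _; rewrite /oncell !dxo// -/P0 -/V0; ring.
have -> : J 0 1 (fun r => xavg a b (fun i j => Dx (w i j)) i j (Y j + hy * r) * xjump a b v i j (Y j + hy * r)
   + xavg a b (fun i j => Dx (v i j)) i j (Y j + hy * r) * xjump a b w i j (Y j + hy * r)) = hx^-1 * J 0 1 E.
  rewrite -JZ//; apply: eq_J => r _.
  rewrite /xavg /xjump /xminus /xplus /xn Si (S0 (ordS i)) !dxo// -/P0 -/P1 -/V0 -/V1 /E.
  by rewrite /P1 /V1 /P0 /V0 /oncell; field; rewrite gt_eqF.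
have -> : J 0 1 (row_form P0 P1 V0 V1) = J 0 1 (fun r => J 0 1 (fun t => Dx P0 t r * Dx V0 t r)) + J 0 1 E.
  by rewrite -JD//; exact: (ct2_J_swap 0 1 cDD).
by field; rewrite gt_eqF.
Qed.

End Cells.

(** Integrate [row_residual_bound] over all rows: on a fixed row the test function is one polynomial
    per cell. *)
Lemma Xform_residual_bound : exists C : R, 0 <= C /\
  forall (a b c d : R) (N M : nat) (w : R -> R -> R) (v : piecewise R N M) (e r : R),
  a < b -> c < d -> (0 < N)%N -> (0 < M)%N -> 0 < e ->
  smooth2 w -> periodic2 a b c d w -> in_Qh k v ->
  Nsq a b c d (iter k.+3 (@Dx R) w) <= r ->
  Nsq a b c d (iter k.+1 (@Dy R) (Dx (Dx w))) <= r ->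
  Xform a b c d (pint s lam a b c d w) v
    + inner a b c d (fun _ _ => Dx (Dx w)) v
  <= C / e * ((mesh_size a b c d N M ^+ k.+1) ^+ 2 * r) + e * inner a b c d v v.
Proof.
have [C [C0 HC]] := row_residual_bound k0 ref.
exists (2 * C); split; first by rewrite mulr_ge0.
move=> a b c d N M w v e r ab cd N0 M0 e0 sw pw hv hX hYX.
set hx := step a b N; set hy := step c d M; set h := mesh_size _ _ _ _ _ _.
have hx0 : 0 < hx := step_gt0 ab N0.
have hy0 : 0 < hy := step_gt0 cd M0.
have [hxh hyh] := step_le_mesh a b c d N M.
pose o := oncell a b c d N M.
have sv i j : smooth2 (v i j) := Qpoly_smooth2 (hv i j).
have sxx := smooth2_dx (smooth2_dx sw).
pose g i j := o i j w.
have sg i j : smooth2 (g i j) by exact: smooth2_oncell.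
pose vo (i : 'I_N) (j : 'I_M) := o i j (v i j).
have svo i j : smooth2 (vo i j) by exact: smooth2_oncell.
have hvo i j : Qpoly k (vo i j) by apply: Qpoly_oncell; exact: hv.
pose po (i : 'I_N) (j : 'I_M) := rint s lam (g i j).
have hpo i j : Qpoly k (po i j) by exact: Qpoly_rint.
have spo i j : smooth2 (po i j) := Qpoly_smooth2 (hpo i j).
have link m (i : 'I_N) (j : nat) t u : iter m (@Dx R) (g (ordS i) j) t u = iter m (@Dx R) (g i j) (1 + t) u.
  rewrite /g /o !iterdx_oncell//; congr (_ * _); rewrite /oncell.
  have pf x : iter m (@Dx R) w (x + (b - a)) (node c d M j + hy * u) = iter m (@Dx R) w x (node c d M j + hy * u).
    by have [] := periodic2_iterdx m sw pw x (node c d M j + hy * u).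
  exact: (@node_ordS R a b N N0 i (fun x => iter m (@Dx R) w x (node c d M j + hy * u)) t pf).
(* With this weight the factor hy / hx of the row representation turns [e1] into e times the cell
   area hx hy, which is the scale of the L2 product. *)
pose e1 := hx ^+ 2 * e; have e10 : 0 < e1 by rewrite mulr_gt0// exprn_gt0.
pose bnd (j : 'I_M) u := C / e1 * \sum_(i < N) (J 0 1 (fun t => iter k.+3 (@Dx R) (g i j) t u ^+ 2)
       + refint (fun t u' => iter k.+1 (@Dy R) (Dx (Dx (g i j))) t u' ^+ 2))
     + e1 * \sum_(i < N) J 0 1 (fun t => vo i j t u ^+ 2).
pose rw (j : 'I_M) u := \sum_(i < N) (row_form (po i j) (po (ordS i) j) (vo i j) (vo (ordS i) j) u
     + J 0 1 (fun t => Dx (Dx (g i j)) t u * vo i j t u)).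
have pw_bound j u : 0 <= u <= 1 -> rw j u <= bnd j u.
  move=> u01; have [V HV] := choice (fun i => Qpoly_x u (hvo i j)).
  have := HC N (fun i => g i j) V u e1 (fun i => sg i j) (fun i m t u => link m i j t u)
     (fun i => (HV i).1) u01 e10.
  rewrite /rw /bnd.
  have -> : \sum_(i < N) Int (V i ^+ 2) = \sum_(i < N) J 0 1 (fun t => vo i j t u ^+ 2).
    apply: eq_bigr => i _; apply: eq_J => t _.
    by rewrite horner_exp -(HV i).2.
  apply: le_trans; rewrite le_eqVlt; apply/orP; left; apply/eqP.
  apply: eq_bigr => i _; rewrite /row_form /bilinear_residual.
  have dp i' t : Dx (po i' j) t u = (interp s lam (fun t => (interp s lam (g i' j t)).[u]))^`().[t].
    by rewrite dxE; apply: is_derive_derive1; exact: is_derive_poly.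
  have dv i' t : Dx (vo i' j) t u = (V i')^`().[t].
    rewrite dxE (_ : (_ ^~ u) = horner (V i')); last by apply/funext => t'; exact: (HV i').2.
    by apply: is_derive_derive1; exact: is_derive_poly.
  rewrite !dp !dv !(HV _).2; congr (_ + _ + _).
    by apply: eq_J => t _; rewrite dp dv.
  by apply: eq_J => t _; rewrite (HV i).2.
have cX (i : 'I_N) (j : 'I_M) := ct2X (n := 2) (smooth2_ct (smooth2_iterdx k.+3 (sg i j))).
have cV i j := ct2X (n := 2) (smooth2_ct (svo i j)).
have cgv (i : 'I_N) (j : 'I_M) : ct2 (fun t u => Dx (Dx (g i j)) t u * vo i j t u).
  by apply: ct2M; [exact/smooth2_ct/smooth2_dx/smooth2_dx|exact: smooth2_ct].
have crf (i : 'I_N) (j : 'I_M) : continuous (row_form (po i j) (po (ordS i) j) (vo i j) (vo (ordS i) j)).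
  exact: row_form_ct.
have cgv1 (i : 'I_N) (j : 'I_M) : continuous (fun u => J 0 1 (fun t => Dx (Dx (g i j)) t u * vo i j t u)).
  exact: (ct2_J_swap 0 1 (cgv i j)).
have crw j : continuous (rw j).
  by apply: ct_sum => i; apply: ctD.
have cX1 (i : 'I_N) (j : 'I_M) : continuous (fun u => J 0 1 (fun t => iter k.+3 (@Dx R) (g i j) t u ^+ 2)).
  exact: (ct2_J_swap 0 1 (cX i j)).
have cV1 (i : 'I_N) (j : 'I_M) : continuous (fun u => J 0 1 (fun t => vo i j t u ^+ 2)).
  exact: (ct2_J_swap 0 1 (cV i j)).
have csX (j : 'I_M) : continuous (fun u => \sum_(i < N) (J 0 1 (fun t => iter k.+3 (@Dx R) (g i j) t u ^+ 2)
       + refint (fun t u' => iter k.+1 (@Dy R) (Dx (Dx (g i j))) t u' ^+ 2))).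
  by apply: ct_sum => i; apply: ctD => //; exact: ct_cst.
have csV (j : 'I_M) : continuous (fun u => \sum_(i < N) J 0 1 (fun t => vo i j t u ^+ 2)).
  exact: ct_sum.
have cbnd j : continuous (bnd j) by apply: ctD; exact: ctZ.
have XE : Xform a b c d (pint s lam a b c d w) v + inner a b c d (fun _ _ => Dx (Dx w)) v =
    hy / hx * \sum_(j < M) J 0 1 (rw j).
  rewrite (Xform_rows ab cd N0 M0 (in_Qh_pint k0 ref ab cd N0 M0 w) hv).
  rewrite inner_refint//; first last.
    by move=> i j; exact: smooth2_ct.
    by move=> i j; exact: smooth2_ct.
  rewrite (_ : \sum_(j < M) J 0 1 (rw j) = \sum_(j < M) J 0 1 (fun r => \sum_(i < N)
    row_form (po i j) (po (ordS i) j) (vo i j) (vo (ordS i) j) r)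
    + \sum_(j < M) \sum_(i < N) refint (fun t u => Dx (Dx (g i j)) t u * vo i j t u)); last first.
    rewrite -big_split; apply: eq_bigr => j _ /=.
    have -> : \sum_(i < N) refint (fun t u => Dx (Dx (g i j)) t u * vo i j t u) =
      J 0 1 (fun u => \sum_(i < N) J 0 1 (fun t => Dx (Dx (g i j)) t u * vo i j t u)).
      rewrite J_sum//; apply: eq_bigr => i _.
      by rewrite /refint (J_swap 0 1 0 1 (cgv i j)).
    rewrite -JD; [|exact: ct_sum|exact: ct_sum].
    by apply: eq_J => u _; rewrite -big_split.
  rewrite mulrDr; congr (_ * _ + _).
    apply: eq_bigr => j _; apply: eq_J => u _; apply: eq_bigr => i _.
    by rewrite !oncell_pint.
  rewrite exchange_big /= !mulr_sumr; apply: eq_bigr => j _.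
  rewrite !mulr_sumr; apply: eq_bigr => i _.
  rewrite (_ : refint (fun t u => Dx (Dx (g i j)) t u * vo i j t u) =
     hx ^+ 2 * refint (fun t u => o i j (Dx (Dx w)) t u * vo i j t u)).
    by rewrite -/hx -/hy; field; rewrite gt_eqF.
  rewrite -refintZ; last first.
    by apply: ct2M; [exact/ct2_oncell/smooth2_ct|exact: smooth2_ct].
  apply: eq_JJ => t u _ _.
  by rewrite /g /o -[Dx (Dx _)]/(iter 2 (@Dx R) _) iterdx_oncell// mulrA.
rewrite {}XE.
apply: (@le_trans _ _ (hy / hx * \sum_(j < M) J 0 1 (bnd j))).
  apply: ler_wpM2l; [by apply: divr_ge0; exact: ltW|apply: ler_sum] => j _.
  by apply: le_J => // u; exact: pw_bound.
have -> : \sum_(j < M) J 0 1 (bnd j) = C / e1 *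
   (\sum_(i < N) \sum_(j < M) refint (fun t u => iter k.+3 (@Dx R) (g i j) t u ^+ 2)
   + \sum_(i < N) \sum_(j < M) refint (fun t u' => iter k.+1 (@Dy R) (Dx (Dx (g i j))) t u' ^+ 2))
   + e1 * \sum_(i < N) \sum_(j < M) refint (fun t u => vo i j t u * vo i j t u).
  have ex (F : 'I_N -> 'I_M -> R) : \sum_i \sum_j F i j = \sum_j \sum_i F i j by exact: exchange_big.
  rewrite !ex.
  rewrite -big_split !mulr_sumr -big_split; apply: eq_bigr => j _ /=.
  rewrite /bnd JD; [|exact: ctZ..].
  rewrite JZ// JZ//; congr (_ * _ + _ * _).
    rewrite -big_split J_sum; last by move=> i; apply: ctD; [exact: cX1|exact: ct_cst].
    apply: eq_bigr => i _; rewrite (JD 0 1 (cX1 i j) (@ct_cst _ _ _)).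
    rewrite (J_cst _ ler01) subr0 mulr1; congr (_ + _).
    by rewrite /refint (J_swap 0 1 0 1 (cX i j)).
  rewrite J_sum//; apply: eq_bigr => i _.
  by rewrite -(J_swap 0 1 0 1 (cV i j)); apply: eq_JJ => t u _ _; rewrite expr2.
have r0 : 0 <= r by apply: le_trans hX; exact: Nsq_ge0.
have E1 : hx * hy * \sum_(i < N) \sum_(j < M) refint (fun t u => iter k.+3 (@Dx R) (g i j) t u ^+ 2)
    = (hx ^+ k.+3) ^+ 2 * Nsq a b c d (iter k.+3 (@Dx R) w).
  rewrite -(sum_cells_sq ab cd N0 M0); last exact/smooth2_ct/smooth2_iterdx.
  by congr (_ * _); apply: eq_bigr => i _; apply: eq_bigr => j _; rewrite /g /o iterdx_oncell.
have E2 : hx * hy * \sum_(i < N) \sum_(j < M) refint (fun t u' => iter k.+1 (@Dy R) (Dx (Dx (g i j))) t u' ^+ 2)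
    = (hx ^+ 2 * hy ^+ k.+1) ^+ 2 * Nsq a b c d (iter k.+1 (@Dy R) (Dx (Dx w))).
  rewrite -(sum_cells_sq ab cd N0 M0); last exact/smooth2_ct/smooth2_iterdy.
  congr (_ * _); apply: eq_bigr => i _; apply: eq_bigr => j _.
  rewrite -[Dx (Dx _)]/(iter 2 (@Dx R) _) /g /o (iterdx_oncell _ _ _ _ _ _ 2)//.
  rewrite iterdyZ; last exact/smooth2_oncell.
  rewrite iterdy_oncell//; apply: eq_JJ => t u _ _; by rewrite mulrA.
have E3 : inner a b c d v v = hx * hy * \sum_(i < N) \sum_(j < M) refint (fun t u => vo i j t u * vo i j t u).
  by rewrite inner_refint// => i j; exact: smooth2_ct.
rewrite E3.
have h0 : 0 <= h by apply: le_trans hxh; exact: ltW.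
have sq (z : R) : 0 <= z -> z <= h -> (z ^+ k.+1) ^+ 2 <= (h ^+ k.+1) ^+ 2.
  move=> z0 zh; rewrite lerXn2r ?nnegrE ?exprn_ge0//.
  by rewrite lerXn2r ?nnegrE.
have b1 : (hx ^+ k.+1) ^+ 2 * Nsq a b c d (iter k.+3 (@Dx R) w) <= (h ^+ k.+1) ^+ 2 * r.
  by apply: ler_pM => //; [exact: sqr_ge0|exact: Nsq_ge0|apply: sq => //; exact: ltW].
have b2 : (hy ^+ k.+1) ^+ 2 * Nsq a b c d (iter k.+1 (@Dy R) (Dx (Dx w))) <= (h ^+ k.+1) ^+ 2 * r.
  by apply: ler_pM => //; [exact: sqr_ge0|exact: Nsq_ge0|apply: sq => //; exact: ltW].
move: E1 E2; set S1 := \sum_(i < N) _; set S2 := \sum_(i < N) _; set S3 := \sum_(i < N) _.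
move=> E1 E2.
(* The price of that weight is hx^(-4). It cancels exactly against the squares of hx^(k+3) and of
   hx^2 hy^(k+1) coming from the rescaled derivatives. *)
have -> : hy / hx * (C / e1 * (S1 + S2) + e1 * S3) =
   C / e * ((hx * hy * S1) / hx ^+ 4 + (hx * hy * S2) / hx ^+ 4) + e * (hx * hy * S3).
  by rewrite /e1; field; rewrite !gt_eqF.
rewrite lerD2r E1 E2.
have -> : (hx ^+ k.+3) ^+ 2 * Nsq a b c d (iter k.+3 (@Dx R) w) / hx ^+ 4 =
    (hx ^+ k.+1) ^+ 2 * Nsq a b c d (iter k.+3 (@Dx R) w).
  by rewrite 2!(exprS hx); field; rewrite gt_eqF.
have -> : (hx ^+ 2 * hy ^+ k.+1) ^+ 2 * Nsq a b c d (iter k.+1 (@Dy R) (Dx (Dx w))) / hx ^+ 4 =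
   (hy ^+ k.+1) ^+ 2 * Nsq a b c d (iter k.+1 (@Dy R) (Dx (Dx w))).
  by field; rewrite gt_eqF.
rewrite [leRHS](_ : _ = C / e * ((h ^+ k.+1) ^+ 2 * r + (h ^+ k.+1) ^+ 2 * r)); last by ring.
by apply: ler_wpM2l; [apply: divr_ge0 => //; exact: ltW|exact: lerD].
Qed.

End FormOnInterpolant.

Section Linearity.
Variables (R : realType) (a b c d : R) (N M : nat).
Hypotheses (ab : a < b) (cd : c < d) (N0 : (0 < N)%N) (M0 : (0 < M)%N).
Implicit Types (w v u : piecewise R N M).

Definition ctp w := forall i j, ct2 (w i j).

Definition subp w v : piecewise R N M := fun i j x y => w i j x y - v i j x y.

Lemma in_Qh_ctp k w : in_Qh k w -> ctp w.
Proof. by move=> hw i j; exact: (smooth2_ct (Qpoly_smooth2 (hw i j))). Qed.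

Lemma in_Qh_subp k w v : in_Qh k w -> in_Qh k v -> in_Qh k (subp w v).
Proof.
move=> hw hv i j; have := QpolyD (hw i j) (QpolyZ (-1) (hv i j)).
by move=> [C hC]; exists C => x y; rewrite -hC mulN1r.
Qed.

Lemma ctp_subp w v : ctp w -> ctp v -> ctp (subp w v).
Proof. by move=> cw cv i j; exact: (ctB (cw i j) (cv i j)). Qed.

Lemma innerC w v : inner a b c d w v = inner a b c d v w.
Proof.
rewrite /inner; apply: eq_bigr => i _; apply: eq_bigr => j _.
by congr (iint _ _); apply/funext => x; apply/funext => y; rewrite mulrC.
Qed.

Lemma inner_JJ w v : ctp w -> ctp v -> inner a b c d w v =
  \sum_(i < N) \sum_(j < M) JJ (node a b N i) (node a b N i.+1) (node c d M j) (node c d M j.+1)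
     (fun x y => w i j x y * v i j x y).
Proof.
move=> cw cv; apply: eq_bigr => i _; apply: eq_bigr => j _.
by rewrite iint_JJ//; exact: ct2M.
Qed.

Lemma innerB w v u : ctp w -> ctp v -> ctp u ->
  inner a b c d (subp w v) u = inner a b c d w u - inner a b c d v u.
Proof.
move=> cw cv cu; rewrite !inner_JJ//; last exact: ctp_subp.
rewrite -sumrB; apply: eq_bigr => i _; rewrite -sumrB; apply: eq_bigr => j _.
have cwu := ct2M (cw i j) (cu i j); have cvu := ct2M (cv i j) (cu i j).
rewrite -mulN1r -JJZ// -JJD//; last exact: ct2Z.
by apply: eq_JJ => x y _ _; rewrite /subp; ring.
Qed.

Lemma inner_ge0 w : 0 <= inner a b c d w w.
Proof.
apply: sumr_ge0 => i _; apply: sumr_ge0 => j _; apply: Rintegral_ge0 => z _.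
by rewrite -expr2 sqr_ge0.
Qed.

Lemma le_inner w1 v1 w2 v2 w3 v3 (z2 z3 : R) :
  ctp w1 -> ctp v1 -> ctp w2 -> ctp v2 -> ctp w3 -> ctp v3 ->
  (forall i j x y, w1 i j x y * v1 i j x y <=
     z2 * (w2 i j x y * v2 i j x y) + z3 * (w3 i j x y * v3 i j x y)) ->
  inner a b c d w1 v1 <= z2 * inner a b c d w2 v2 + z3 * inner a b c d w3 v3.
Proof.
move=> cw1 cv1 cw2 cv2 cw3 cv3 le; rewrite !inner_JJ// !mulr_sumr -big_split.
apply: ler_sum => i _ /=; rewrite !mulr_sumr -big_split; apply: ler_sum => j _ /=.
have c1 := ct2M (cw1 i j) (cv1 i j); have c2 := ct2M (cw2 i j) (cv2 i j).
have c3 := ct2M (cw3 i j) (cv3 i j).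
rewrite -!JJZ// -JJD; [|exact: ct2Z..].
have c23 := ct2D (ct2Z (k := z2) c2) (ct2Z (k := z3) c3).
apply: le_J; [exact: (ct2_J _ _ c1)|exact: (ct2_J _ _ c23)|move=> x _].
by apply: le_J; [exact: (ct2_y x c1)|exact: (ct2_y x c23)|move=> y _; exact: le].
Qed.

Lemma inner_young w v (e : R) : ctp w -> ctp v -> 0 < e ->
  inner a b c d w v <= e^-1 * inner a b c d w w + e * inner a b c d v v.
Proof.
move=> cw cv e0; apply: le_inner => // i j x y.
by have := young (w i j x y) (v i j x y) e0; rewrite !expr2 mulrC [_ / e]mulrC.
Qed.

Lemma innerNr w v : ctp w -> ctp v ->
  inner a b c d w (fun i j x y => - v i j x y) = - inner a b c d w v.
Proof.
move=> cw cv; rewrite !inner_JJ//; last by move=> i j; exact: (ctN (cv i j)).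
rewrite -sumrN; apply: eq_bigr => i _; rewrite -sumrN; apply: eq_bigr => j _.
rewrite -mulN1r -JJZ; last exact: (ct2M (cw i j) (cv i j)).
by apply: eq_JJ => x y _ _; ring.
Qed.

Lemma row_formB (P0 P1 Q0 Q1 V0 V1 : R -> R -> R) r :
  smooth2 P0 -> smooth2 P1 -> smooth2 Q0 -> smooth2 Q1 -> smooth2 V0 -> smooth2 V1 ->
  row_form (fun x y => P0 x y - Q0 x y) (fun x y => P1 x y - Q1 x y) V0 V1 r =
  row_form P0 P1 V0 V1 r - row_form Q0 Q1 V0 V1 r.
Proof.
move=> sP0 sP1 sQ0 sQ1 sV0 sV1.
have DB (f g : R -> R -> R) x y : smooth2 f -> smooth2 g -> Dx (fun x y => f x y - g x y) x y = Dx f x y - Dx g x y.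
  move=> sf sg; rewrite dxE; apply: is_derive_derive1.
  by apply: dvB; exact: smooth2_is_dx.
have ctd (f : R -> R -> R) : smooth2 f -> continuous (Dx f ^~ r).
  by move=> sf; apply: ct2_x; exact/smooth2_ct/smooth2_dx.
rewrite /row_form !DB//.
have -> : J 0 1 (fun t => Dx (fun x y => P0 x y - Q0 x y) t r * Dx V0 t r) =
  J 0 1 (fun t => Dx P0 t r * Dx V0 t r) - J 0 1 (fun t => Dx Q0 t r * Dx V0 t r).
  rewrite -JB; [|by apply: ctM; exact: ctd..].
  by apply: eq_J => t _; rewrite DB// mulrBl.
by field.
Qed.

(** Linearity is read off the row representation, where every integral is over the unit interval. *)
Lemma XformB k w v u : in_Qh k w -> in_Qh k v -> in_Qh k u ->
  Xform a b c d (subp w v) u = Xform a b c d w u - Xform a b c d v u.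
Proof.
move=> hw hv hu; have hwv := in_Qh_subp hw hv.
rewrite (Xform_rows ab cd N0 M0 hw hu) (Xform_rows ab cd N0 M0 hv hu) (Xform_rows ab cd N0 M0 hwv hu).
have so (z : piecewise R N M) (i : 'I_N) (j : 'I_M) : in_Qh k z -> smooth2 (oncell a b c d N M i j (z i j)).
  by move=> hz; apply: smooth2_oncell; exact: (Qpoly_smooth2 (hz i j)).
rewrite -mulrBr; congr (_ * _); rewrite -sumrB; apply: eq_bigr => j _.
rewrite -JB; [|by apply: ct_sum => i; apply: row_form_ct; exact: so..].
apply: eq_J => r _; rewrite -sumrB; apply: eq_bigr => i _.
by rewrite -row_formB; [|exact: so..].
Qed.

End Linearity.

Lemma DxE (R : realType) (v : R -> R -> R) : Dx v = dx v.
Proof. by rewrite Dx.unlock. Qed.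

Lemma DyE (R : realType) (v : R -> R -> R) : Dy v = dy v.
Proof. by rewrite Dy.unlock. Qed.

Section FullForm.
Variables (R : realType).
Implicit Types (w : R -> R -> R).

Lemma Aform_split (a b c d : R) (N M : nat) k (w v : piecewise R N M) :
  in_Qh k w -> in_Qh k v ->
  Aform a b c d w v = Xform a b c d w v + Xform c d a b (trp w) (trp v).
Proof.
move=> hw hv.
have sw i j : smooth2 (w i j) := Qpoly_smooth2 (hw i j).
have sv i j : smooth2 (v i j) := Qpoly_smooth2 (hv i j).
have EX : \sum_(i < N) \sum_(j < M) iint (xcell a b i `*` ycell c d j)
    (fun x y => pdx w i j x y * pdx v i j x y + pdy w i j x y * pdy v i j x y) =
  \sum_(i < N) \sum_(j < M) iint (xcell a b i `*` ycell c d j) (fun x y => Dx (w i j) x y * Dx (v i j) x y)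
  + \sum_(j < M) \sum_(i < N) iint (xcell c d j `*` ycell a b i)
      (fun y x => Dx (trp w j i) y x * Dx (trp v j i) y x).
  rewrite [Z in _ = _ + Z]exchange_big /= -big_split; apply: eq_bigr => i _ /=.
  rewrite -big_split; apply: eq_bigr => j _ /=.
  have c1 : ct2 (fun x y => Dx (w i j) x y * Dx (v i j) x y).
    by apply: ct2M; exact/smooth2_ct/smooth2_dx.
  have c2 : ct2 (fun x y => Dy (w i j) x y * Dy (v i j) x y).
    by apply: ct2M; exact/smooth2_ct/smooth2_dy.
  rewrite /pdx /pdy /= -!DxE -!DyE /xcell /ycell /trp (dx_tr (w i j)) (dx_tr (v i j)).
  transitivity (JJ (xn a b N i) (xn a b N i.+1) (yn c d M j) (yn c d M j.+1)
     (fun x y => Dx (w i j) x y * Dx (v i j) x y + Dy (w i j) x y * Dy (v i j) x y)).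
    exact: (iint_JJ _ _ _ _ (ct2D c1 c2)).
  rewrite JJD//; congr (_ + _); first exact/esym/(iint_JJ _ _ _ _ c1).
  exact/esym/(iint_JJ_swap _ _ _ _ (ct2_swap c2)).
rewrite /Aform EX /Xform -[LHS]addrA [RHS]addrACA; congr (_ + (_ + _)).
  apply: eq_bigr => i _; apply: eq_bigr => j _.
  rewrite J.unlock; apply: eq_Rintegral => y _.
  by rewrite /xavg /xjump /xminus /xplus /pdx /= -!DxE.
rewrite exchange_big; apply: eq_bigr => j _; apply: eq_bigr => i _.
rewrite J.unlock; apply: eq_Rintegral => x _.
by rewrite /xavg /xjump /yavg /yjump /xminus /xplus /yminus /yplus /pdy /= -!DyE /trp !(dx_tr (w _ _)) !(dx_tr (v _ _)).
Qed.

(** This symmetry is what makes the cross terms of the two equations cancel in the energy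
    estimate. *)
Lemma AformC (a b c d : R) (N M : nat) (w v : piecewise R N M) :
  Aform a b c d w v = Aform a b c d v w.
Proof.
rewrite /Aform; apply: (f_equal2 +%R); first apply: (f_equal2 +%R).
- apply: eq_bigr => i _; apply: eq_bigr => j _; apply: (f_equal (iint _)).
  by apply/funext => x; apply/funext => y; rewrite mulrC [pdy _ _ _ _ _ * _]mulrC.
- apply: eq_bigr => i _; apply: eq_bigr => j _; apply: eq_Rintegral => y _.
  exact: addrC.
- apply: eq_bigr => i _; apply: eq_bigr => j _; apply: eq_Rintegral => y _.
  exact: addrC.
Qed.

Lemma AformB (a b c d : R) (N M : nat) k (w v u : piecewise R N M) :
  a < b -> c < d -> (0 < N)%N -> (0 < M)%N ->
  in_Qh k w -> in_Qh k v -> in_Qh k u ->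
  Aform a b c d (subp w v) u = Aform a b c d w u - Aform a b c d v u.
Proof.
move=> ab cd N0 M0 hw hv hu.
rewrite !(Aform_split _ _ _ _ (k := k))//; last exact: in_Qh_subp.
rewrite (XformB ab cd N0 M0 hw hv hu).
have := XformB cd ab M0 N0 (in_Qh_trp hw) (in_Qh_trp hv) (in_Qh_trp hu).
rewrite (_ : subp (trp w) (trp v) = trp (subp w v))// => ->; ring.
Qed.

Variables (k : nat) (s : 'I_k.+3 -> R) (lam : 'I_k.+3 -> {poly R}).
Hypothesis k0 : (0 < k)%N.
Hypothesis ref : reference_interpolation s lam.

Lemma rint_tr (g : R -> R -> R) : rint s lam (tr g) = tr (rint s lam g).
Proof.
apply/funext => t; apply/funext => r; rewrite /tr !rintE exchange_big.
by apply: eq_bigr => p _; apply: eq_bigr => q _; rewrite [in RHS](mulrC (lam _).[_]).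
Qed.

Lemma trp_pint (a b c d : R) (N M : nat) w :
  trp (@pint R k s lam a b c d N M w) = pint s lam c d a b (tr w).
Proof.
apply/funext => j; apply/funext => i; apply/funext => y; apply/funext => x.
rewrite /trp /tr /pint (_ : oncell c d a b M N j i (fun y x => w x y) = tr (oncell a b c d N M i j w))//.
by rewrite rint_tr.
Qed.

Lemma inner_trp (a b c d : R) (N M : nat) (w v : piecewise R N M) : ctp w -> ctp v ->
  inner c d a b (trp w) (trp v) = inner a b c d w v.
Proof.
move=> cw cv; rewrite /inner exchange_big; apply: eq_bigr => i _; apply: eq_bigr => j _.
have c1 := ct2M (cw i j) (cv i j).
by rewrite /xcell /ycell (iint_JJ _ _ _ _ c1) (iint_JJ_swap _ _ _ _ (ct2_swap c1)).
Qed.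

Lemma Aform_residual_bound : exists C : R, 0 <= C /\
  forall (a b c d : R) (N M : nat) (w : R -> R -> R) (v : piecewise R N M) (e r : R),
  a < b -> c < d -> (0 < N)%N -> (0 < M)%N -> 0 < e ->
  smooth2 w -> periodic2 a b c d w -> in_Qh k v -> residual_seminorms a b c d k w r ->
  Aform a b c d (pint s lam a b c d w) v + inner a b c d (fun _ _ => Lap w) v
  <= C / e * ((mesh_size a b c d N M ^+ k.+1) ^+ 2 * r) + e * inner a b c d v v.
Proof.
have [C [C0 HC]] := Xform_residual_bound k0 ref.
(* Two directions, each with weight e/2, which doubles its constant. *)
exists (4 * C); split; first by rewrite mulr_ge0.
move=> a b c d N M w v e r ab cd N0 M0 e0 sw pw hv [hX hY hYX hXY].
have hp := in_Qh_pint k0 ref ab cd N0 M0 w.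
have e20 : 0 < e / 2 by rewrite divr_gt0.
have h1 := HC a b c d N M w v (e / 2) r ab cd N0 M0 e20 sw pw hv hX hYX.
have hX' : Nsq c d a b (iter k.+3 (@Dx R) (tr w)) <= r.
  have it m : iter m (@Dx R) (tr w) = tr (iter m (@Dy R) w).
    by elim: m => // m ih; rewrite !iterS ih dx_tr.
  by rewrite it Nsq_tr//; exact/smooth2_ct/smooth2_iterdy.
have hY' : Nsq c d a b (iter k.+1 (@Dy R) (Dx (Dx (tr w)))) <= r.
  have it m (f : R -> R -> R) : iter m (@Dy R) (tr f) = tr (iter m (@Dx R) f).
    by elim: m => // m ih; rewrite !iterS ih dy_tr.
  by rewrite !dx_tr it Nsq_tr//; exact/smooth2_ct/smooth2_iterdx/smooth2_dy/smooth2_dy.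
have h2 := HC c d a b M N (tr w) (trp v) (e / 2) r cd ab M0 N0 e20 (smooth2_tr sw)
  (periodic2_tr pw) (in_Qh_trp hv) hX' hY'.
have cv := in_Qh_ctp hv.
have cxx : ctp (fun (_ : 'I_N) (_ : 'I_M) => Dx (Dx w)).
  by move=> i j; exact/smooth2_ct/smooth2_dx/smooth2_dx.
have cyy : ctp (fun (_ : 'I_N) (_ : 'I_M) => Dy (Dy w)).
  by move=> i j; exact/smooth2_ct/smooth2_dy/smooth2_dy.
have mE : mesh_size c d a b M N = mesh_size a b c d N M by rewrite /mesh_size maxC.
have i1 : inner c d a b (fun (_ : 'I_M) (_ : 'I_N) => Dx (Dx (tr w))) (trp v) =
   inner a b c d (fun _ _ => Dy (Dy w)) v.
  by rewrite -(inner_trp a b c d cyy cv) !dx_tr.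
have i2 : inner a b c d (fun (_ : 'I_N) (_ : 'I_M) => Lap w) v =
  inner a b c d (fun _ _ => Dx (Dx w)) v + inner a b c d (fun _ _ => Dy (Dy w)) v.
  have cN : ctp (fun (_ : 'I_N) (_ : 'I_M) x y => - Dy (Dy w) x y).
    by move=> i j; exact: (ctN (cyy i j)).
  have -> : (fun (_ : 'I_N) (_ : 'I_M) => Lap w) =
     subp (fun _ _ => Dx (Dx w)) (fun _ _ x y => - Dy (Dy w) x y).
    apply/funext => i; apply/funext => j; apply/funext => x; apply/funext => y.
    by rewrite /subp /Lap opprK.
  by rewrite innerB// (innerC _ _ _ _ (fun _ _ x y => - _)) innerNr// opprK (innerC _ _ _ _ v).
rewrite (Aform_split a b c d hp hv) trp_pint i2.
move: h1 h2; rewrite mE i1 (inner_trp a b c d cv cv).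
set E := mesh_size _ _ _ _ _ _; set iv := inner a b c d v v.
rewrite (_ : C / (e / 2) = 2 * C / e); last by field; rewrite gt_eqF.
move=> h1 h2; have h3 := lerD h1 h2.
rewrite [leLHS](_ : _ = Xform a b c d (pint s lam a b c d w) v + inner a b c d (fun _ _ => Dx (Dx w)) v +
  (Xform c d a b (pint s lam c d a b (tr w)) (trp v) + inner a b c d (fun _ _ => Dy (Dy w)) v)); last by ring.
apply: (le_trans h3); rewrite le_eqVlt; apply/orP; left; apply/eqP.
by field; rewrite gt_eqF.
Qed.

End FullForm.

(** * Evolution in time *)

Section OneSidedTimeDerivative.
Variable R : realType.
Implicit Types (g : R -> R) (t s e : R).

Definition halfline : set R := [set s | 0 <= s].

Lemma within_halfline_proper t : 0 <= t -> ProperFilter (within halfline t^').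
Proof.
move=> t0; apply: Build_ProperFilter_ex => P [e /= e0 he].
have e2 : 0 < e / 2 by rewrite divr_gt0.
exists (t + e / 2); apply: (he (t + e / 2)).
- rewrite /= opprD addrA subrr add0r normrN gtr0_norm//.
  by rewrite ltr_pdivrMr// ltr_pMr// ltr1n.
- by rewrite gt_eqF// ltrDl.
- by rewrite /halfline /= addr_ge0// ltW.
Qed.

Lemma tderivable_eps g t : 0 <= t -> tderivable g t -> forall e, 0 < e ->
  exists2 h, 0 < h & forall s, 0 <= s -> s != t -> `|s - t| < h ->
    `|tderive g t - (s - t)^-1 * (g s - g t)| < e.
Proof.
move=> t0 dg e e0; have PF := within_halfline_proper t0.
have : tquot g t --> tderive g t by exact: dg.
rewrite /tquot => /cvgrPdist_lt/(_ e e0)[h /= h0 hh].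
exists h => // s s0 st sth; apply: hh => //=.
by rewrite distrC.
Qed.

Lemma tderivable_continuous g : (forall t, 0 <= t -> tderivable g t) ->
  {within halfline, continuous g}.
Proof.
move=> dg; apply/subspace_continuousP => t t0.
apply/cvgrPdist_lt => e e0.
have [h h0 hh] := tderivable_eps t0 (dg t t0) ltr01.
set L := tderive g t in hh.
have L0 : 0 < `|L| + 1 by rewrite ltr_wpDl.
exists (Num.min h (e / (`|L| + 1))); first by rewrite /= lt_min h0 divr_gt0.
move=> s /=; rewrite lt_min => /andP[sh se] s0.
have [->|st] := eqVneq s t; first by rewrite subrr normr0.
have q := hh s s0 st; rewrite distrC in sh; have {}q := q sh.
rewrite distrC (_ : g s - g t = (s - t) * ((s - t)^-1 * (g s - g t))); last first.
  by rewrite mulVKf// subr_eq0.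
rewrite normrM; apply: (@le_lt_trans _ _ (`|s - t| * (`|L| + 1))).
  rewrite ler_wpM2l//; set x := _^-1 * _ in q *.
  by rewrite (_ : x = L - (L - x)); [apply: (le_trans (ler_normB _ _)); rewrite lerD2l ltW|ring].
by rewrite -ltr_pdivlMr// distrC.
Qed.

Lemma tderivable_is_derive g t : 0 < t -> tderivable g t -> is_derive t 1 g (tderive g t).
Proof.
move=> t0 dg; have E := tderivable_eps (ltW t0) dg.
set L := tderive g t in E *.
have cv : (fun h => h^-1 *: (g (h *: 1 + t) - g t)) @ 0^' --> L.
  apply/cvgrPdist_lt => e e0; have [h h0 hh] := E e e0.
  (* Increments smaller than t keep the argument in the half-line, so near t > 0 the one-sided
     quotient is the ordinary one. *)
  exists (Num.min h t); first by rewrite /= lt_min h0.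
  move=> z /=; rewrite sub0r normrN lt_min => /andP[zh zt] z0.
  have := hh (z + t); rewrite addrK scaler1; apply => //.
  - by move: zt; rewrite ltr_norml => /andP[? _]; lra.
  - by rewrite -subr_eq0 addrK.
apply: DeriveDef; first by apply/cvg_ex; exists L.
exact: cvg_lim cv.
Qed.

(** Carries identities known for positive times over to the initial time. *)
Lemma halfline_unique (f : R -> R) : {within halfline, continuous f} ->
  (forall t, 0 < t -> f t = 0) -> f 0 = 0.
Proof.
move=> /subspace_continuousP/(_ 0 (lexx _)) c0 f0.
apply/eqP; rewrite -normr_eq0 eq_le normr_ge0 andbT leNgt; apply/negP => h.
move/cvgrPdist_lt : c0 => /(_ _ h)[e /= e0 he].
have e2 : 0 < e / 2 by rewrite divr_gt0.
have := he (e / 2); rewrite /= sub0r normrN gtr0_norm// ltr_pdivrMr// ltr_pMr// ltr1n.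
move=> /(_ isT); rewrite /halfline/= => h2; have := h2 (ltW e2).
by rewrite /from_subspace (f0 _ e2) subr0 ltxx.
Qed.

End OneSidedTimeDerivative.

Section SpaceTimeSmoothness.
Variable R : realType.
Implicit Types (u f : R -> R -> R -> R) (t x y : R).

Lemma smooth_pderive e u : smooth u -> smooth (pderive e u).
Proof. by move=> su w; have := su (rcons w e); rewrite foldr_rcons. Qed.

Lemma smooth_pderives w u : smooth u -> smooth (foldr (@pderive R) u w).
Proof. by move=> su; elim: w => //= e w; exact: smooth_pderive. Qed.

Lemma smooth_within_continuous u : smooth u ->
  {within [set z : R * R * R | 0 <= z.1.1], continuous (fun z : R * R * R => u z.1.1 z.1.2 z.2)}.
Proof. by move=> /(_ [::])[]. Qed.

Lemma ct_subspace (T : topologicalType) (A : set (R * R * R)) (F : R * R * R -> R)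
    (h : T -> R * R * R) : {within A, continuous F} -> continuous h ->
  (forall z, A (h z)) -> continuous (fun z => F (h z)).
Proof.
move=> /subspace_continuousP cF ch hA z.
apply: (@cvg_comp _ _ _ h F _ (within A (nbhs (h z)))); last exact: cF.
move=> P /= PA; have hh : \forall z' \near z, A (h z') -> P (h z') := ch z _ PA.
suff : \forall z' \near z, P (h z') by [].
by apply: filterS hh => z' H; exact: H (hA z').
Qed.

Lemma smooth_ct2 u t : smooth u -> 0 <= t -> ct2 (u t).
Proof.
move=> su t0; apply: (ct_subspace (h := fun z : R * R => (t, z.1, z.2)) (smooth_within_continuous su)) => //.
apply: ct_pair; last exact: ct_snd.
by apply: ct_pair; [exact: ct_const|exact: ct_fst].
Qed.

Lemma smooth_smooth2 u t : smooth u -> 0 <= t -> smooth2 (u t).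
Proof.
move=> su t0 n; elim: n u su => [|n ih] u su; split => //; try exact: smooth_ct2.
have [h _] := su [::]; split.
- by move=> x y; case: (h t x y t0) => _ d _; exact: d.
- by move=> x y; case: (h t x y t0) => _ _ d; exact: d.
- by rewrite Dx.unlock; apply: (ih (pderive SpaceX u)); exact: (@smooth_pderive SpaceX).
- by rewrite Dy.unlock; apply: (ih (pderive SpaceY u)); exact: (@smooth_pderive SpaceY).
Qed.

Lemma smooth_tderivable u t x y : smooth u -> 0 <= t -> tderivable (fun s => u s x y) t.
Proof. by move=> su t0; have [h _] := su [::]; case: (h t x y t0) => d _ _; exact: d. Qed.

(** The equation is given for t > 0 only. Its extension to t = 0 is needed because the initial error
    is bounded through u_t at t = 0. *)
Lemma smooth_solution_pde (a b c d : R) (u0 : R -> R -> R) u : smooth_solution a b c d u0 u ->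
  forall t, 0 <= t -> dt u t = fun x y => - Lap (Lap (u t)) x y.
Proof.
move=> [su _ pde _] t t0; apply/funext => x; apply/funext => y.
move: t0; rewrite le_eqVlt => /predU1P[<-|t0]; last by rewrite LapE pde.
pose D w := foldr (@pderive R) u w.
pose X := SpaceX; pose Y := SpaceY.
have ctD' w : {within @halfline R, continuous (fun s => D w s x y)}.
  by apply: tderivable_continuous => s s0; apply: smooth_tderivable => //; exact: smooth_pderives.
have LL s : 0 <= s -> Lap (Lap (u s)) x y =
    D [:: X; X; X; X] s x y + D [:: X; X; Y; Y] s x y + (D [:: Y; Y; X; X] s x y + D [:: Y; Y; Y; Y] s x y).
  move=> s0; have su2 := smooth_smooth2 su s0.
  have sx := smooth2_dx (smooth2_dx su2); have sy := smooth2_dy (smooth2_dy su2).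
  have -> : Lap (Lap (u s)) = fun x y => Dx (Dx (Dx (Dx (u s)))) x y + Dx (Dx (Dy (Dy (u s)))) x y
     + (Dy (Dy (Dx (Dx (u s)))) x y + Dy (Dy (Dy (Dy (u s)))) x y).
    rewrite {1}/Lap {1}/Lap dxD// dxD; [|exact: smooth2_dx..].
    by rewrite {1}/Lap dyD// dyD; [|exact: smooth2_dy..].
  by rewrite Dx.unlock Dy.unlock.
pose F s := dt u s x y + (D [:: X; X; X; X] s x y + D [:: X; X; Y; Y] s x y + (D [:: Y; Y; X; X] s x y + D [:: Y; Y; Y; Y] s x y)).
have F0 : F 0 = 0.
  apply: halfline_unique.
    apply: ctD; first exact: (ctD' [:: Time]).
    by apply: ctD; apply: ctD; exact: ctD'.
  by move=> s s0; rewrite /F -LL ?ltW// pde// LapE addNr.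
by apply/eqP; rewrite -addr_eq0 LL//; apply/eqP.
Qed.

End SpaceTimeSmoothness.

(** * Differentiating the discrete energy in time *)

Section EnergyDerivative.
Variables (R : realType) (a b c d : R) (N M k : nat).
Hypotheses (ab : a < b) (cd : c < d) (N0 : (0 < N)%N) (M0 : (0 < M)%N).
Local Notation idx := ('I_k.+1 * 'I_k.+1)%type.
Implicit Types (f : R -> R -> R) (w v : piecewise R N M).

(** Values at the integer points 0, ..., k in both variables are coordinates on the tensor
    polynomials. The points may lie outside the cell, since a polynomial is known on the whole
    plane. *)
Definition sample f (P : idx) : R := f P.1%:R P.2%:R.

Definition tensor (l : 'I_k.+1 -> {poly R}) (P : idx) : R -> R -> R :=
  fun x y => (l P.1).[x] * (l P.2).[y].

Lemma sample_basis : exists l : 'I_k.+1 -> {poly R}, (forall i, (size (l i) <= k.+1)%N) /\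
  forall f, Qpoly k f -> forall x y, f x y = \sum_P sample f P * tensor l P x y.
Proof.
have inj : injective (fun i : 'I_k.+1 => i%:R : R).
  by move=> i j /eqP; rewrite eqr_nat => /eqP/val_inj.
have [l [sl hl]] := lagrange_basis inj; exists l; split => // f hf x y.
have interp1 (g : R -> R -> R) : Qpoly k g -> forall x y, g x y = \sum_(p < k.+1) g p%:R y * (l p).[x].
  move=> hg x' y'; have [p [sp hp]] := Qpoly_x y' hg.
  rewrite hp {1}(hl _ sp) horner_sum; apply: eq_bigr => i _.
  by rewrite hornerZ hp.
rewrite (interp1 _ hf) -(pair_bigA _ (fun p q => sample f (p, q) * tensor l (p, q) x y)) /=.
apply: eq_bigr => p _; have := interp1 _ (Qpoly_tr hf) y p%:R; rewrite /tr => ->.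
by rewrite mulr_suml; apply: eq_bigr => q _; rewrite /sample /tensor /=; ring.
Qed.

Lemma JJ_sum (I : Type) (s : seq I) (F : I -> R -> R -> R) (x0 x1 y0 y1 : R) :
  (forall i, ct2 (F i)) ->
  JJ x0 x1 y0 y1 (fun x y => \sum_(i <- s) F i x y) = \sum_(i <- s) JJ x0 x1 y0 y1 (F i).
Proof.
move=> cF; rewrite /JJ -J_sum; last by move=> i; exact: (ct2_J y0 y1 (cF i)).
by apply: eq_J => x _; rewrite J_sum// => i; exact: (ct2_y x (cF i)).
Qed.

(** [G] is the Gram matrix of the basis. The energy becomes a quadratic form in finitely many point
    values, so pointwise time derivatives suffice and no differentiation under the integral is
    required. *)
Lemma inner_samples : exists G : 'I_N -> 'I_M -> idx -> idx -> R,
  forall w v, in_Qh k w -> in_Qh k v -> inner a b c d w v =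
    \sum_i \sum_j \sum_P \sum_Q sample (w i j) P * sample (v i j) Q * G i j P Q.
Proof.
have [l [sl hl]] := sample_basis.
have ctl P : ct2 (tensor l P) by exact: ct2_horner.
exists (fun i j P Q => JJ (node a b N i) (node a b N i.+1) (node c d M j) (node c d M j.+1)
   (fun x y => tensor l P x y * tensor l Q x y)) => w v hw hv.
rewrite inner_JJ; [|exact: in_Qh_ctp hw|exact: in_Qh_ctp hv].
apply: eq_bigr => i _; apply: eq_bigr => j _.
have cPQ P Q : ct2 (fun x y => tensor l P x y * tensor l Q x y) := ct2M (ctl P) (ctl Q).
have cs P Q : ct2 (fun x y => sample (w i j) P * sample (v i j) Q * (tensor l P x y * tensor l Q x y)).
  exact: (ct2Z (k := sample (w i j) P * sample (v i j) Q) (cPQ P Q)).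
have csum P : ct2 (fun x y => \sum_Q sample (w i j) P * sample (v i j) Q * (tensor l P x y * tensor l Q x y)).
  by apply: ct_sum => Q; exact: cs.
transitivity (JJ (node a b N i) (node a b N i.+1) (node c d M j) (node c d M j.+1)
  (fun x y => \sum_P \sum_Q sample (w i j) P * sample (v i j) Q * (tensor l P x y * tensor l Q x y))).
  apply: eq_JJ => x y _ _; rewrite (hl _ (hw i j)) (hl _ (hv i j)) mulr_suml.
  apply: eq_bigr => P _; rewrite mulr_sumr; apply: eq_bigr => Q _; ring.
rewrite JJ_sum//; apply: eq_bigr => P _; rewrite JJ_sum//; apply: eq_bigr => Q _.
exact: (JJZ _ _ _ _ _ (cPQ P Q)).
Qed.

Variables (v dv : R -> piecewise R N M).
Hypothesis hv : forall t : R, 0 <= t -> in_Qh k (v t).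
Hypothesis cv : forall i j x y, {within @halfline R, continuous (fun s => v s i j x y)}.
Hypothesis vdv : forall t : R, 0 < t -> forall i j (x y : R), is_derive t 1 (fun s => v s i j x y) (dv t i j x y).

Lemma near_pos (t : R) : 0 < t -> \forall s \near t, 0 <= s.
Proof. by move=> t0; near=> s; rewrite ltW//; near: s; exact: lt_nbhsr. Unshelve. all: by end_near. Qed.

(** The scheme provides time derivatives at each point only; by the expansion in point values they
    again form an admissible discrete function. *)
Lemma in_Qh_derivative (t : R) : 0 < t -> in_Qh k (dv t).
Proof.
move=> t0 i j; have [l [sl hl]] := sample_basis.
suff : Qpoly k (dv t i j) by [].
rewrite (_ : dv t i j = fun x y => \sum_P sample (dv t i j) P * tensor l P x y).
  by apply: Qpoly_sum => P; apply: QpolyZ; exact: Qpoly_horner.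
apply/funext => x; apply/funext => y.
have d1 : is_derive t 1 (fun s => \sum_P sample (v s i j) P * tensor l P x y)
    (\sum_P sample (dv t i j) P * tensor l P x y).
  apply: dv_sum => P; apply: (is_derive_eq (dvM (vdv t0 i j _ _) (dv_cst _ _))).
  by rewrite mulr0 addr0.
have d2 : is_derive t 1 (fun s => v s i j x y) (\sum_P sample (dv t i j) P * tensor l P x y).
  apply: near_eq_is_derive d1.
  by apply: filterS (near_pos t0) => s s0; rewrite -(hl _ (hv s0 i j)).
by rewrite -(is_derive_derive1 d2) (is_derive_derive1 (vdv t0 i j x y)).
Qed.

Lemma energy_is_derive (t : R) : 0 < t ->
  is_derive t 1 (fun s => inner a b c d (v s) (v s)) (2 * inner a b c d (dv t) (v t)).
Proof.
move=> t0; have [G hG] := inner_samples.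
have hd := in_Qh_derivative t0; have h0 := hv (ltW t0).
have d1 : is_derive t 1 (fun s => \sum_i \sum_j \sum_P \sum_Q sample (v s i j) P * sample (v s i j) Q * G i j P Q)
  (\sum_i \sum_j \sum_P \sum_Q (sample (dv t i j) P * sample (v t i j) Q * G i j P Q
     + sample (v t i j) P * sample (dv t i j) Q * G i j P Q)).
  apply: dv_sum => i; apply: dv_sum => j; apply: dv_sum => P; apply: dv_sum => Q.
  apply: (is_derive_eq (dvM (dvM (vdv t0 i j _ _) (vdv t0 i j _ _)) (dv_cst _ _))).
  by rewrite mulr0 addr0 mulrDl.
have d2 : is_derive t 1 (fun s => inner a b c d (v s) (v s))
  (\sum_i \sum_j \sum_P \sum_Q (sample (dv t i j) P * sample (v t i j) Q * G i j P Q
     + sample (v t i j) P * sample (dv t i j) Q * G i j P Q)).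
  apply: near_eq_is_derive d1.
  by apply: filterS (near_pos t0) => s s0; rewrite hG//; exact: hv.
apply: (is_derive_eq d2).
rewrite (_ : 2 * _ = inner a b c d (dv t) (v t) + inner a b c d (v t) (dv t)); last first.
  by rewrite [X in _ + X]innerC; ring.
rewrite !hG// -big_split; apply: eq_bigr => i _; rewrite -big_split; apply: eq_bigr => j _.
rewrite -big_split; apply: eq_bigr => P _; rewrite -big_split; apply: eq_bigr => Q _.
by [].
Qed.

Lemma energy_within_continuous : {within @halfline R, continuous (fun s => inner a b c d (v s) (v s))}.
Proof.
have [G hG] := inner_samples.
have c1 : {within @halfline R, continuous (fun s => \sum_i \sum_j \sum_P \sum_Q
    sample (v s i j) P * sample (v s i j) Q * G i j P Q)}.
  apply: ct_sum => i; apply: ct_sum => j; apply: ct_sum => P; apply: ct_sum => Q.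
  by apply: ctM; [apply: ctM; exact: cv|exact: ct_cst].
apply: subspace_eq_continuous c1 => s; rewrite inE => s0; apply/esym; rewrite /from_subspace.
by apply: hG; exact: hv.
Qed.

End EnergyDerivative.

Section GronwallStep.
Variable R : realType.

(** The derivative of the root is [D / G], and a suitable weight [e] bounds it by a constant. The
    summand [dl ^+ 2] keeps the root differentiable where the energy vanishes. *)
Lemma sqrt_energy_growth (E D : R -> R) (dl t : R) : 0 < dl -> 0 <= t ->
  (forall s, 0 <= E s) -> {within @halfline R, continuous E} ->
  (forall s : R, 0 < s -> is_derive s 1 E (2 * D s)) ->
  (forall s e, 0 < s -> s <= t -> 0 < e -> D s <= dl ^+ 2 * (1 + e^-1) + 2 * e * E s) ->
  Num.sqrt (E t + dl ^+ 2) <= Num.sqrt (E 0 + dl ^+ 2) + 4 * dl * t.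
Proof.
move=> dl0 t0 E0 cE dE hD; pose G s := Num.sqrt (E s + dl ^+ 2).
have pos s : 0 < E s + dl ^+ 2 by rewrite ltr_wpDl// exprn_gt0.
have G0 s : 0 < G s by rewrite sqrtr_gt0.
have dG (s : R) : 0 < s -> is_derive s 1 G (D s / G s).
  move=> s0; have d1 := dvD (dE s s0) (dv_cst (dl ^+ 2) s).
  have d2 := @is_derive1_comp _ (@Num.sqrt R) (fun s => E s + dl ^+ 2) s _ _ (is_derive1_sqrt (pos s)) d1.
  by apply: (is_derive_eq d2); rewrite addr0 /GRing.scale/= -/(G s); field; rewrite gt_eqF.
have cG : {within `[0, t], continuous G}.
  have cE' : {within `[0, t], continuous E}.
    by apply: continuous_subspaceW cE => s; rewrite /halfline /= in_itv/= => /andP[].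
  have c2 : {within `[0, t], continuous (fun s => E s + dl ^+ 2)} by apply: ctD => //; exact: ct_cst.
  by move=> s; apply: (continuous_comp (c2 s)); exact: sqrt_continuous.
have slope s : 0 < s -> s <= t -> D s / G s <= 4 * dl.
  move=> s0 st; rewrite ler_pdivrMr//.
  (* The weight e = dl / G balances the terms: dl^2, dl^2 / e and 2 e E are at most dl G, dl G and 2
     dl G, which explains the slope 4 dl. *)
  have e0 : 0 < dl / G s by rewrite divr_gt0.
  apply: (le_trans (hD s _ s0 st e0)); rewrite invf_div.
  have GE : E s <= G s ^+ 2 by rewrite sqr_sqrtr ?(ltW (pos s))// lerDl sqr_ge0.
  have dG' : dl <= G s.
    by rewrite -[leLHS]ger0_norm ?(ltW dl0)// -sqrtr_sqr; apply: ler_wsqrtr; rewrite lerDr.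
  have h1 : 2 * (dl / G s) * E s <= 2 * dl * G s.
    apply: (@le_trans _ _ (2 * (dl / G s) * G s ^+ 2)).
      by apply: ler_wpM2l => //; rewrite mulr_ge0// ltW.
    by rewrite le_eqVlt; apply/orP; left; apply/eqP; field; rewrite gt_eqF.
  have h2 : dl ^+ 2 * (G s / dl) = dl * G s by field; rewrite gt_eqF.
  have h3 : dl ^+ 2 <= dl * G s by rewrite expr2 ler_pM2l.
  by rewrite mulrDr mulr1 h2; lra.
move: t0; rewrite le_eqVlt => /predU1P[<-|t0]; first by rewrite mulr0 addr0.
have dG' (s : R) : s \in `]0, t[ -> is_derive s 1 G (D s / G s).
  by rewrite in_itv/= => /andP[s0 _]; exact: dG.
have [s + e] := MVT t0 dG' cG.
rewrite in_itv/= => /andP[s0 st].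
have : G t - G 0 <= 4 * dl * t.
  by rewrite e subr0 ler_pM2r//; apply: slope => //; exact: ltW.
by rewrite -/(G t) -/(G 0); lra.
Qed.

End GronwallStep.

Section SobolevNorm.
Variables (R : realType) (a b c d : R).
Hypotheses (ab : a < b) (cd : c < d).
Local Notation Dx := (@Dx R).
Local Notation Dy := (@Dy R).

Lemma Hnorm_sqr m v : smooth2 v -> Hnorm a b c d m v ^+ 2 =
  \sum_(i < m.+1) \sum_(j < m.+1 | (i + j <= m)%N) Nsq a b c d (iter i Dx (iter j Dy v)).
Proof.
move=> sv; rewrite /Hnorm sqr_sqrtr; last first.
  apply: sumr_ge0 => i _; apply: sumr_ge0 => j _; apply: Rintegral_ge0 => z _.
  exact: sqr_ge0.
apply: eq_bigr => i _; apply: eq_bigr => j _.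
rewrite iint_JJ; first by rewrite Dx.unlock Dy.unlock.
apply: ct2X; have := smooth2_ct (smooth2_iterdx i (smooth2_iterdy j sv)).
by rewrite Dx.unlock Dy.unlock.
Qed.

Lemma Nsq_le_Hnorm m v i j : smooth2 v -> (i + j <= m)%N ->
  Nsq a b c d (iter i Dx (iter j Dy v)) <= Hnorm a b c d m v ^+ 2.
Proof.
move=> sv ijm; rewrite Hnorm_sqr//.
have im : (i < m.+1)%N by lia.
have jm : (j < m.+1)%N by lia.
rewrite (bigD1 (Ordinal im))//= (bigD1 (Ordinal jm))//= -addrA lerDl.
rewrite addr_ge0//; first by apply: sumr_ge0 => *; exact: Nsq_ge0.
by apply: sumr_ge0 => *; apply: sumr_ge0 => *; exact: Nsq_ge0.
Qed.

Lemma smooth_bound_compact u T : smooth u ->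
  exists K : R, forall t x y, 0 <= t <= T -> a <= x <= b -> c <= y <= d -> `|u t x y| <= K.
Proof.
move=> su.
have cK : compact ((`[0, T]%classic `*` `[a, b]%classic `*` `[c, d]%classic) : set (R * R * R)).
  by apply: compact_setX; [apply: compact_setX|]; exact: segment_compact.
have cu := continuous_subspaceW _ (smooth_within_continuous su).
have sub : (`[0, T]%classic `*` `[a, b]%classic `*` `[c, d]%classic : set (R * R * R))
    `<=` [set z | 0 <= z.1.1].
  by move=> [[t x] y] [[/=]]; rewrite in_itv/= => /andP[].
have /compact_bounded[K [_ hK]] := continuous_compact (cu _ sub) cK.
exists (K + 1) => t x y t0 xab ycd; apply: (hK (K + 1)); first by rewrite ltrDl.
by exists (t, x, y).
Qed.

(** Without an upper bound [sup] would only be a default value and could not dominate the norms. *)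
Lemma Hnorm_bounded m u T : smooth u ->
  has_ubound [set Hnorm a b c d m (dt u s) | s in `[0, T]].
Proof.
move=> su; have sdt : smooth (dt u) := smooth_pderive Time su.
have word i j t : iter i (@dx R) (iter j (@dy R) (dt u t)) =
    foldr (@pderive R) (dt u) (nseq i SpaceX ++ nseq j SpaceY) t.
  elim: i => [|i ih] /=; last by rewrite ih.
  by elim: j => //= j ->.
have bnd (ij : 'I_m.+1 * 'I_m.+1) : exists K : R, forall t, 0 <= t <= T ->
    Nsq a b c d (iter ij.1 Dx (iter ij.2 Dy (dt u t))) <= K.
  have [K hK] := smooth_bound_compact T (smooth_pderives (nseq ij.1 SpaceX ++ nseq ij.2 SpaceY) sdt).
  exists (K ^+ 2 * (d - c) * (b - a)) => t tT; have /andP[t0 _] := tT.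
  have s2 := smooth_smooth2 sdt t0.
  have cX := ct2X (n := 2) (smooth2_ct (smooth2_iterdx ij.1 (smooth2_iterdy ij.2 s2))).
  have pt x y : a <= x <= b -> c <= y <= d -> iter ij.1 Dx (iter ij.2 Dy (dt u t)) x y ^+ 2 <= K ^+ 2.
    move=> xab ycd; have := hK t x y tT xab ycd; rewrite -word Dx.unlock Dy.unlock => h.
    by rewrite -real_normK ?num_real// lerXn2r ?nnegrE// (le_trans _ h).
  rewrite /Nsq /JJ -(J_cst _ (ltW ab)).
  apply: le_J; [exact: (ct2_J c d cX)|exact: ct_cst|move=> x xab].
  rewrite -(J_cst _ (ltW cd)).
  by apply: le_J; [exact: (ct2_y x cX)|exact: ct_cst|move=> y ycd; exact: pt].
have [K hK] := choice bnd.
exists (Num.sqrt (\sum_(i < m.+1) \sum_(j < m.+1 | (i + j <= m)%N) K (i, j))) => _ [t + <-].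
rewrite /= in_itv/= => tT; have /andP[t0 _] := tT.
have h0 : 0 <= Hnorm a b c d m (dt u t) by exact: sqrtr_ge0.
rewrite -[leLHS]ger0_norm// -sqrtr_sqr Hnorm_sqr; last exact: smooth_smooth2.
apply: ler_wsqrtr; apply: ler_sum => i _; apply: ler_sum => j _.
exact: (hK (i, j)).
Qed.

Lemma Nsq_dt_le_sup m u T t i j : smooth u -> 0 <= t <= T -> (i + j <= m)%N ->
  Nsq a b c d (iter i Dx (iter j Dy (dt u t))) <=
  sup [set Hnorm a b c d m (dt u s) | s in `[0, T]] ^+ 2.
Proof.
move=> su tT ijm; have /andP[t0 _] := tT.
have s2 := smooth_smooth2 (smooth_pderive Time su) t0.
apply: (le_trans (Nsq_le_Hnorm s2 ijm)).
have h0 : 0 <= Hnorm a b c d m (dt u t) by exact: sqrtr_ge0.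
have hs : Hnorm a b c d m (dt u t) <= sup [set Hnorm a b c d m (dt u s) | s in `[0, T]].
  by apply: (ub_le_sup (Hnorm_bounded m T su)); exists t => //=; rewrite in_itv.
by rewrite lerXn2r ?nnegrE// (le_trans h0).
Qed.

End SobolevNorm.

Lemma inner_subpC (R : realType) (a b c d : R) (N M : nat) (w v : piecewise R N M) :
  inner a b c d (subp w v) (subp w v) = inner a b c d (subp v w) (subp v w).
Proof.
apply: eq_bigr => i _; apply: eq_bigr => j _; apply: (f_equal (iint _)).
by apply/funext => x; apply/funext => y; rewrite /subp; ring.
Qed.

(** * Energy inequality for the scheme and the error estimate *)

Section ErrorEstimate.
Variables (R : realType) (k : nat) (s : 'I_k.+3 -> R) (lam : 'I_k.+3 -> {poly R}).
Hypothesis k0 : (0 < k)%N.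
Hypothesis ref : reference_interpolation s lam.

(** The weight [e] stays free on the terms with xi, for use in [sqrt_energy_growth]. The terms with
    zeta are absorbed at once by the energy of zeta on the left. *)
Lemma energy_inequality : exists C : R, 0 <= C /\
  forall (a b c d : R) (N M : nat) (u q ut : R -> R -> R) (uh qh uht : piecewise R N M) (e r : R),
  a < b -> c < d -> (0 < N)%N -> (0 < M)%N -> 0 < e ->
  smooth2 u -> smooth2 q -> periodic2 a b c d u -> periodic2 a b c d q ->
  q = (fun x y => - Lap u x y) -> ut = Lap q ->
  residual_seminorms a b c d k u r -> residual_seminorms a b c d k q r ->
  approx_seminorms a b c d k q r -> approx_seminorms a b c d k ut r ->
  in_Qh k uh -> in_Qh k qh -> in_Qh k uht ->
  (forall phi, in_Qh k phi -> inner a b c d uht phi = - Aform a b c d qh phi) ->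
  (forall psi, in_Qh k psi -> inner a b c d qh psi = Aform a b c d uh psi) ->
  inner a b c d (subp (pint s lam a b c d ut) uht) (subp (pint s lam a b c d u) uh) <=
    C * ((mesh_size a b c d N M ^+ k.+1) ^+ 2 * r) * (1 + e^-1) +
    2 * e * inner a b c d (subp (pint s lam a b c d u) uh) (subp (pint s lam a b c d u) uh).
Proof.
have [C1 [C10 H1]] := Aform_residual_bound k0 ref.
have [C2 [C20 H2]] := pint_error k0 ref.
exists (2 * C1 + 2 * C2); split; first by rewrite addr_ge0// mulr_ge0.
move=> a b c d N M u q ut uh qh uht e r ab cd N0 M0 e0 su sq pu pq qE utE ru rq aq aut huh hqh huht eq1 eq2; set xi := subp _ uh.
have sut : smooth2 ut by rewrite utE; exact: smooth2_lap.
have hP w : in_Qh k (@pint R k s lam a b c d N M w) := in_Qh_pint k0 ref ab cd N0 M0 w.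
have cP w : ctp (@pint R k s lam a b c d N M w) := in_Qh_ctp (hP w).
have cw (w : R -> R -> R) : smooth2 w -> ctp (fun (_ : 'I_N) (_ : 'I_M) => w) by move=> sw i j; exact: smooth2_ct.
pose Pq : piecewise R N M := pint s lam a b c d q.
pose Put : piecewise R N M := pint s lam a b c d ut.
pose zeta := subp qh Pq.
have hxi : in_Qh k xi := in_Qh_subp (hP u) huh.
have hzeta : in_Qh k zeta := in_Qh_subp hqh (hP q).
have cxi := in_Qh_ctp hxi; have czeta := in_Qh_ctp hzeta.
have cqh := in_Qh_ctp hqh; have cuht := in_Qh_ctp huht.
(* Zeta appears in one residual and in one interpolation error; weight 1/2 for each consumes exactly
   ||zeta||^2 and doubles the constants [C1] and [C2]. *)
have h2 : (0 : R) < 2^-1 by rewrite invr_gt0.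
have R1 := H1 a b c d N M q xi e r ab cd N0 M0 e0 sq pq hxi rq.
have R2 := H1 a b c d N M u zeta 2^-1 r ab cd N0 M0 h2 su pu hzeta ru.
have cut := ctp_subp (cP ut) (cw ut sut).
have cq := ctp_subp (cw q sq) (cP q).
have Y1 := inner_young a b c d cut cxi e0.
have Y2 := inner_young a b c d cq czeta h2.
set H := _ ^+ 2 * r.
have r0 : 0 <= r by have [h _ _] := aut; apply: le_trans h; exact: Nsq_ge0.
have H0 : 0 <= H by rewrite mulr_ge0// sqr_ge0.
have E1 : inner a b c d (subp (fun _ _ => ut) Put) (subp (fun _ _ => ut) Put) <= C2 * H.
  by rewrite /H mulrA; exact: (H2 a b c d N M ut r ab cd N0 M0 sut aut).
have E2 : inner a b c d (subp (fun _ _ => q) Pq) (subp (fun _ _ => q) Pq) <= C2 * H.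
  by rewrite /H mulrA; exact: (H2 a b c d N M q r ab cd N0 M0 sq aq).
rewrite inner_subpC in Y1; rewrite invrK in Y2.
have I1 := innerB a b c d (cP ut) (cw ut sut) cxi.
have I2 := innerB a b c d (cw q sq) (cP q) czeta.
have I3 := innerB a b c d (cP ut) cuht cxi.
have I4 := innerB a b c d cqh (cP q) czeta.
have A1 := AformB ab cd N0 M0 hqh (hP q) hxi.
have A2 := AformB ab cd N0 M0 (hP u) huh hzeta.
have I5 : inner a b c d (fun _ _ => Lap u) zeta = - inner a b c d (fun _ _ => q) zeta.
  rewrite innerC -[LHS]opprK (_ : (fun (_ : 'I_N) (_ : 'I_M) => q) = fun i j x y => - Lap u x y); last by rewrite qE.
  by rewrite (innerC _ _ _ _ (fun _ _ x y => - _)) innerNr//; exact: cw (smooth2_lap su).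
have S1 := AformC a b c d zeta xi.
rewrite I3 (eq1 xi hxi).
rewrite (eq2 zeta hzeta) in I4.
rewrite -utE in R1; rewrite I5 invrK in R2.
have ei : 0 <= e^-1 by rewrite invr_ge0 ltW.
have {}E1 := ler_wpM2l ei E1.
have C1H : 0 <= e^-1 * (C1 * H) := mulr_ge0 ei (mulr_ge0 C10 H0).
have C2H : 0 <= e^-1 * (C2 * H) := mulr_ge0 ei (mulr_ge0 C20 H0).
rewrite -/H in R1 R2.
move: R1 R2 Y1 Y2 E1 E2 I1 I2 I4 A1 A2 S1 C1H C2H.
rewrite -/Pq -/Put -/xi -/zeta (mulrC C1 e^-1).
set Iuu := inner _ _ _ _ (subp _ Put) (subp _ Put).
set Iqq := inner _ _ _ _ (subp _ Pq) (subp _ Pq).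
move: Iuu Iqq (inner _ _ _ _ xi xi) (inner _ _ _ _ zeta zeta) => Iuu Iqq X Z.
lra.
Qed.

End ErrorEstimate.

Lemma lapZ (R : realType) (z : R) (f : R -> R -> R) : smooth2 f ->
  Lap (fun x y => z * f x y) = fun x y => z * Lap f x y.
Proof.
move=> sf; have sx := smooth2_dx sf; have sy := smooth2_dy sf.
by rewrite /Lap dxZ// dxZ// dyZ// dyZ//; apply/funext => x; apply/funext => y; rewrite mulrDr.
Qed.

Section SolutionSeminorms.
Variables (R : realType) (a b c d : R).
Hypotheses (ab : a < b) (cd : c < d).
Local Notation Dx := (@Dx R).
Local Notation Dy := (@Dy R).

Lemma iterdxZ m (z : R) f : smooth2 f ->
  iter m Dx (fun x y => z * f x y) = fun x y => z * iter m Dx f x y.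
Proof.
by move=> sf; elim: m => //= m ->; rewrite dxZ//; exact: smooth2_iterdx.
Qed.

Lemma NsqZ (z : R) f : ct2 f -> Nsq a b c d (fun x y => z * f x y) = z ^+ 2 * Nsq a b c d f.
Proof.
move=> cf; rewrite /Nsq -JJZ; last exact: ct2X.
by apply: eq_JJ => x y _ _; rewrite exprMn.
Qed.

Lemma periodic2_lap f : smooth2 f -> periodic2 a b c d f -> periodic2 a b c d (Lap f).
Proof.
move=> sf pf; have sx := smooth2_dx sf; have sy := smooth2_dy sf.
have px := periodic2_dx sx (periodic2_dx sf pf); have py := periodic2_dy sy (periodic2_dy sf pf).
move=> x y; have [h1 h2] := px x y; have [h3 h4] := py x y.
by rewrite /Lap h1 h2 h3 h4.
Qed.

Lemma residual_seminorms_le k w (r r' : R) : r <= r' ->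
  residual_seminorms a b c d k w r -> residual_seminorms a b c d k w r'.
Proof. by move=> rr [h1 h2 h3 h4]; split; apply: le_trans rr. Qed.

Lemma approx_seminorms_le k w (r r' : R) : r <= r' ->
  approx_seminorms a b c d k w r -> approx_seminorms a b c d k w r'.
Proof. by move=> rr [h1 h2 h3]; split; apply: le_trans rr. Qed.

(** The loss in the two Poincaré steps of [approx_seminorms_residual]. *)
Definition regularity_factor : R := (1 + (b - a) ^+ 2) ^+ 2 * (1 + (d - c) ^+ 2) ^+ 2.

Lemma regularity_factor_ge1 : 1 <= regularity_factor.
Proof.
have h (x : R) : 1 <= (1 + x ^+ 2) ^+ 2.
  by apply: exprn_ege1; rewrite lerDl sqr_ge0.
by rewrite -[1]mulr1; apply: ler_pM.
Qed.

(** Regularity is lifted twice, from u_t = Lap q to q and from q = - Lap u to u. Each passage from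
    residual to approximation seminorms costs one [regularity_factor], hence its square. *)
Lemma solution_seminorms k u q ut (r0 r : R) : (0 < k)%N -> smooth2 u -> periodic2 a b c d u ->
  q = (fun x y => - Lap u x y) -> ut = Lap q -> approx_seminorms a b c d k ut r0 ->
  r = regularity_factor ^+ 2 * r0 ->
  [/\ smooth2 q, periodic2 a b c d q,
      residual_seminorms a b c d k u r /\ residual_seminorms a b c d k q r &
      [/\ approx_seminorms a b c d k u r, approx_seminorms a b c d k q r &
          approx_seminorms a b c d k ut r]].
Proof.
move=> k0 su pu qE utE aut rE; have sl := smooth2_lap su.
have qZ : q = fun x y => -1 * Lap u x y.
  by rewrite qE; apply/funext => x; apply/funext => y; rewrite mulN1r.
have sq : smooth2 q by rewrite qZ; exact: smooth2Z.
have pq : periodic2 a b c d q.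
  by move=> x y; have [h1 h2] := periodic2_lap su pu x y; rewrite qE h1 h2.
have [hx hy hxy] := aut.
have r00 : 0 <= r0 by apply: le_trans hx; exact: Nsq_ge0.
have F1 := regularity_factor_ge1; set F := regularity_factor in F1 rE.
have F0 : 0 <= F by apply: le_trans F1.
have r01 : r0 <= F * r0 by rewrite ler_peMl.
have r12 : F * r0 <= r by rewrite rE expr2 -mulrA ler_peMl// mulr_ge0.
have rq : residual_seminorms a b c d k q r0.
  by apply: (residual_seminorms_lap ab cd sq pq); rewrite -utE.
have aq := approx_seminorms_residual ab cd k0 sq pq rq; rewrite -/regularity_factor -/F in aq.
have ru : residual_seminorms a b c d k u (F * r0).
  have [qx qy _] := aq.
  have sN f : smooth2 f -> Nsq a b c d (fun x y => -1 * f x y) = Nsq a b c d f.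
    by move=> sf; rewrite NsqZ; [rewrite sqrrN expr1n mul1r|exact: smooth2_ct].
  apply: (residual_seminorms_lap ab cd su pu).
    by move: qx; rewrite qZ iterdxZ// sN//; exact: smooth2_iterdx.
  by move: qy; rewrite qZ iterdyZ// sN//; exact: smooth2_iterdy.
have au := approx_seminorms_residual ab cd k0 su pu ru; rewrite -/regularity_factor -/F in au.
have r02 := le_trans r01 r12; split => //.
  by split; [exact: residual_seminorms_le r12 ru|exact: residual_seminorms_le r02 rq].
split; [|exact: approx_seminorms_le r12 aq|exact: approx_seminorms_le r02 aut].
by move: au; rewrite mulrA -expr2 -rE.
Qed.

End SolutionSeminorms.

Section InterpolantInTime.
Variables (R : realType) (k : nat) (s : 'I_k.+3 -> R) (lam : 'I_k.+3 -> {poly R}).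
Variables (a b c d : R) (N M : nat) (u : R -> R -> R -> R).
Hypothesis su : smooth u.
Local Notation P w := (pint s lam a b c d w : piecewise R N M).

(** The interpolant is a fixed linear combination of point values, so it commutes with the time
    derivative. *)
Lemma pint_is_derive (t : R) (i : 'I_N) (j : 'I_M) (x y : R) : 0 < t ->
  is_derive t 1 (fun s => P (u s) i j x y) (P (dt u t) i j x y).
Proof.
move=> t0; rewrite /pint rintE.
rewrite (_ : (fun _ => _) = fun t' : R => \sum_p \sum_q oncell a b c d N M i j (u t') (s p) (s q) *
   ((lam p).[(x - node a b N i) / step a b N] * (lam q).[(y - node c d M j) / step c d M])); last first.
  by apply/funext => t'; rewrite rintE.
apply: dv_sum => p; apply: dv_sum => q.
have h (x' y' : R) : is_derive t (1:R) (fun s => u s x' y') (dt u t x' y').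
  by apply: tderivable_is_derive => //; apply: smooth_tderivable => //; exact: ltW.
have h2 := dvM (h (node a b N i + step a b N * s p) (node c d M j + step c d M * s q)) (dv_cst _ _).
by apply: (is_derive_eq (h2 _)); rewrite mulr0 addr0.
Qed.

Lemma pint_within_continuous (i : 'I_N) (j : 'I_M) (x y : R) :
  {within @halfline R, continuous (fun s => P (u s) i j x y)}.
Proof.
rewrite (_ : (fun _ => _) = fun t' : R => \sum_p \sum_q oncell a b c d N M i j (u t') (s p) (s q) *
   ((lam p).[(x - node a b N i) / step a b N] * (lam q).[(y - node c d M j) / step c d M])); last first.
  by apply/funext => t'; rewrite /pint rintE.
apply: ct_sum => p; apply: ct_sum => q; apply: ctM; last exact: ct_cst.
by apply: tderivable_continuous => t t0; exact: smooth_tderivable.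
Qed.

End InterpolantInTime.

Theorem theorem3p2 (R : realType) (k : nat) (a b c d : R) :
  (1 <= k)%N -> a < b -> c < d ->
  exists C0 C1 : R -> R,
  forall (u0 : R -> R -> R) (u : R -> R -> R -> R),
  smooth_solution a b c d u0 u ->
  forall (N M : nat), (0 < N)%N -> (0 < M)%N ->
  forall (uh qh : R -> piecewise R N M),
  dg_solution a b c d k u0 uh qh ->
  forall T t : R, 0 <= t -> t <= T ->
  let S := sup [set Hnorm a b c d k.+1 (dt u s) | s in `[0, T]] in
  L2norm a b c d (fun (i : 'I_N) (j : 'I_M) x y => u t x y - uh t i j x y)
    <= (C0 S + C1 S * T) * mesh_size a b c d N M ^+ k.+1.
Proof.
move=> k0 ab cd.
have [nd [lam ref]] := reference_interpolation_exists R k0.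
have [C1 [C10 HE]] := energy_inequality k0 ref.
have [C2 [C20 HI]] := pint_error k0 ref.
pose F := regularity_factor a b c d ^+ 2.
have F0 : 0 < F by rewrite exprn_gt0// (lt_le_trans ltr01 (regularity_factor_ge1 _ _ _ _)).
(* The summands 1 make [dl] positive even when [C1], [C2] or [S] is zero; 8 is the constant of the
   final comparison. *)
pose K S := 8 * Num.sqrt ((C1 + C2 + 1) * (F * (1 + S ^+ 2))).
exists K, K => u0 u sol N M N0 M0 uh qh [hQ htd eq1 eq2 [_ eq0]] T t t0 tT; lazy zeta; set S := sup _.
set h := mesh_size a b c d N M ^+ k.+1.
pose r := F * (1 + S ^+ 2).
have r0 : 0 < r by rewrite mulr_gt0// ltr_wpDr// sqr_ge0.
have h0 : 0 < h.
  by rewrite exprn_gt0// /mesh_size lt_max (step_gt0 ab N0).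
pose dl := Num.sqrt ((C1 + C2 + 1) * r) * h.
have Kr0 : 0 < (C1 + C2 + 1) * r by rewrite mulr_gt0// ltr_wpDl// addr_ge0.
have dl0 : 0 < dl by rewrite mulr_gt0// sqrtr_gt0.
have dl2 : dl ^+ 2 = (C1 + C2 + 1) * (h ^+ 2 * r).
  by rewrite /dl exprMn sqr_sqrtr ?ltW//; ring.
have Hr0 : 0 <= h ^+ 2 * r by rewrite mulr_ge0 ?sqr_ge0// ltW.
have C1dl : C1 * (h ^+ 2 * r) <= dl ^+ 2.
  by rewrite dl2; apply: ler_wpM2r => //; lra.
have C2dl : C2 * (h ^+ 2 * r) <= dl ^+ 2.
  by rewrite dl2; apply: ler_wpM2r => //; lra.
have [su per _ ic] := sol; have pde := smooth_solution_pde sol.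
pose P w : piecewise R N M := pint nd lam a b c d w.
pose v s := subp (P (u s)) (uh s).
pose dv s := subp (P (dt u s)) (ptderive uh s).
have hP w : in_Qh k (P w) := in_Qh_pint k0 ref ab cd N0 M0 w.
have hv (s : R) : 0 <= s -> in_Qh k (v s).
  by move=> s0; have [hu _] := hQ s s0; exact: in_Qh_subp.
have su2 (s : R) : 0 <= s -> smooth2 (u s) by exact: smooth_smooth2.
have pu (s : R) : 0 <= s -> periodic2 a b c d (u s) by move=> s0 x y; exact: per.
have cv i j x y : {within @halfline R, continuous (fun s => v s i j x y)}.
  apply: ctB; first exact: pint_within_continuous.
  by apply: tderivable_continuous => s; exact: htd.
have vuh (s : R) : 0 < s -> forall i j (x y : R),
    is_derive s 1 (fun s => uh s i j x y) (ptderive uh s i j x y).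
  by move=> s0 i j x y; apply: tderivable_is_derive => //; apply: htd; exact: ltW.
have vdv (s : R) : 0 < s -> forall i j (x y : R),
    is_derive s 1 (fun s => v s i j x y) (dv s i j x y).
  by move=> s0 i j x y; apply: dvB; [exact: pint_is_derive|exact: vuh].
have hduh (s : R) : 0 < s -> in_Qh k (ptderive uh s).
  apply: (in_Qh_derivative _ vuh) => s0 s00; by have [] := hQ s0 s00.
have semi (s : R) : 0 <= s <= t -> let q := fun x y => - Lap (u s) x y in
  [/\ smooth2 q, periodic2 a b c d q,
      residual_seminorms a b c d k (u s) r /\ residual_seminorms a b c d k q r &
      [/\ approx_seminorms a b c d k (u s) r, approx_seminorms a b c d k q r &
          approx_seminorms a b c d k (dt u s) r]] /\ dt u s = Lap q.
  move=> /andP[s0 st] q.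
  have sT : 0 <= s <= T by rewrite s0 (le_trans st).
  have sl := smooth2_lap (su2 s s0).
  have dtE : dt u s = Lap q.
    rewrite pde// /q (_ : (fun x y => - Lap (u s) x y) = fun x y => -1 * Lap (u s) x y).
      by rewrite lapZ//; apply/funext => x; apply/funext => y; rewrite mulN1r.
    by apply/funext => x; apply/funext => y; rewrite mulN1r.
  have S2 i j : (i + j <= k.+1)%N -> Nsq a b c d (iter i (@Dx R) (iter j (@Dy R) (dt u s))) <= 1 + S ^+ 2.
    by move=> ij; apply: (le_trans (Nsq_dt_le_sup ab cd su sT ij)); rewrite lerDr.
  split => //; apply: (solution_seminorms ab cd k0 (su2 s s0) (pu s s0) (erefl q) dtE _ (erefl r)).
  by split; [apply: (S2 k.+1 0%N); rewrite addn0|exact: (S2 0%N k.+1)|exact: (S2 1%N k)].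
have eta s : 0 <= s <= t ->
    inner a b c d (subp (fun _ _ => u s) (P (u s))) (subp (fun _ _ => u s) (P (u s))) <= dl ^+ 2.
  move=> st; have [[_ _ _ [au _ _]] _] := semi s st; have /andP[s0 _] := st.
  apply: (le_trans (HI a b c d N M (u s) r ab cd N0 M0 (su2 s s0) au)).
  by rewrite -mulrA.
pose E s := inner a b c d (v s) (v s).
have E0 s : 0 <= E s := inner_ge0 _ _ _ _ _.
have growth : Num.sqrt (E t + dl ^+ 2) <= Num.sqrt (E 0 + dl ^+ 2) + 4 * dl * t.
  apply: (sqrt_energy_growth (D := fun s => inner a b c d (dv s) (v s)) dl0 t0 E0).
  - exact: energy_within_continuous hv cv.
  - by move=> s s0; exact: (energy_is_derive a b c d hv vdv s0).
  - move=> s e s0 st e0; have s00 := ltW s0.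
    have sst : 0 <= s <= t by rewrite s00.
    have [[sq pq [ru rq] [_ aq adt]] dtE] := semi s sst.
    have [huh hqh] := hQ s s00.
    have := HE a b c d N M _ _ _ _ _ _ e r ab cd N0 M0 e0 (su2 s s00) sq (pu s s00) pq (erefl _)
      dtE ru rq aq adt huh hqh (hduh s s0) (fun phi => eq1 s phi s00) (fun psi => eq2 s psi s00).
    move=> h1; apply: (le_trans h1); rewrite lerD2r ler_wpM2r//.
    by rewrite addr_ge0// invr_ge0 ltW.
have cP w : ctp (P w) := in_Qh_ctp (hP w).
have cu (s : R) : 0 <= s -> ctp (fun (_ : 'I_N) (_ : 'I_M) => u s).
  by move=> s0 i j; exact/smooth2_ct/su2.
have cuh (s : R) : 0 <= s -> ctp (uh s).
  by move=> s0; have [huh _] := hQ s s0; exact: in_Qh_ctp huh.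
have cvp (s : R) : 0 <= s -> ctp (v s) by move=> s0; exact: in_Qh_ctp (hv s s0).
(* The L2 projection gives ||xi||^2 = (Pu - u, xi) at time 0; Young with weight 1/2 bounds this by 2
   dl^2 + ||xi||^2 / 2. *)
have init : E 0 <= 4 * dl ^+ 2.
  have l0 : 0 <= (0 : R) by [].
  have u00 : u0 = u 0 by apply/funext => x; apply/funext => y; rewrite ic.
  have orth := eq0 _ (hv 0 l0); rewrite u00 in orth.
  have h2 : (0 : R) < 2^-1 by rewrite invr_gt0.
  have y1 := inner_young a b c d (ctp_subp (cP (u 0)) (cu 0 l0)) (cvp 0 l0) h2.
  rewrite invrK inner_subpC (innerB _ _ _ _ (cP (u 0)) (cu 0 l0) (cvp 0 l0)) in y1.
  have := eta 0; rewrite lexx t0 => /(_ isT) e1.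
  have EE : E 0 = inner a b c d (P (u 0)) (v 0) - inner a b c d (uh 0) (v 0).
    by rewrite -(innerB _ _ _ _ (cP (u 0)) (cuh 0 l0) (cvp 0 l0)).
  rewrite orth in EE; rewrite -EE -/(E 0) in y1.
  by lra.
(* The argument of the root is at most 5 dl^2, rounded up to (3 dl)^2. *)
have G0 : Num.sqrt (E 0 + dl ^+ 2) <= 3 * dl.
  have d3 : 0 <= 3 * dl by rewrite mulr_ge0// ltW.
  rewrite -[leRHS]ger0_norm// -sqrtr_sqr; apply: ler_wsqrtr.
  have d2 : 0 <= dl ^+ 2 by exact: sqr_ge0.
  rewrite (_ : (3 * dl) ^+ 2 = 9 * dl ^+ 2); last by ring.
  by lra.
have Et : E t <= ((3 + 4 * t) * dl) ^+ 2.
  have h1 : Num.sqrt (E t + dl ^+ 2) <= (3 + 4 * t) * dl by lra.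
  have p1 : 0 <= (3 + 4 * t) * dl by apply: le_trans h1; exact: sqrtr_ge0.
  have : Num.sqrt (E t + dl ^+ 2) ^+ 2 <= ((3 + 4 * t) * dl) ^+ 2.
    by rewrite lerXn2r ?nnegrE// sqrtr_ge0.
  by rewrite sqr_sqrtr ?addr_ge0 ?sqr_ge0//; have := sqr_ge0 dl; lra.
(* The error is split at the interpolant, with (x + y)^2 <= 2 x^2 + 2 y^2. *)
have tot : inner a b c d (subp (fun _ _ => u t) (uh t)) (subp (fun _ _ => u t) (uh t)) <=
    2 * dl ^+ 2 + 2 * ((3 + 4 * t) * dl) ^+ 2.
  have ct1 := ctp_subp (cu t t0) (cuh t t0).
  have ct2 := ctp_subp (cu t t0) (cP (u t)).
  have le3 : inner a b c d (subp (fun _ _ => u t) (uh t)) (subp (fun _ _ => u t) (uh t)) <=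
     2 * inner a b c d (subp (fun _ _ => u t) (P (u t))) (subp (fun _ _ => u t) (P (u t))) + 2 * E t.
    apply: le_inner => //; try exact: cvp.
    move=> i j x y; rewrite /v /subp.
    set A := u t x y; set B := P _ _ _ _ _; set D := uh _ _ _ _ _.
    have := sqr_ge0 ((A - B) - (B - D)); rewrite !expr2; nra.
  have := eta t; rewrite t0 lexx => /(_ isT) e1.
  by lra.
rewrite (_ : (K S + K S * T) * h = 8 * (1 + T) * dl); last by rewrite /K /dl /r; ring.
have p1 : 0 <= 8 * (1 + T) * dl.
  by apply: mulr_ge0; [lra|exact: ltW].
rewrite /L2norm -[leRHS]ger0_norm// -sqrtr_sqr; apply: ler_wsqrtr.
apply: (le_trans tot).
(* It remains to compare 2 + 2 (3 + 4t)^2 = 20 + 48 t + 32 t^2 with 64 (1 + t)^2. *)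
rewrite (_ : 2 * dl ^+ 2 + 2 * ((3 + 4 * t) * dl) ^+ 2 = (2 + 2 * (3 + 4 * t) ^+ 2) * dl ^+ 2); last by ring.
rewrite [leRHS]exprMn; apply: ler_wpM2r; first exact: sqr_ge0.
have T2 : (8 * (1 + t)) ^+ 2 <= (8 * (1 + T)) ^+ 2 by rewrite lerXn2r ?nnegrE; lra.
by apply: le_trans T2; rewrite !expr2; nra.
Qed.
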